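(* Let $Z=G(U)+\varepsilon$ satisfy conditions (1)--(5) listed in the context and let $z\in\mathbb R^d$. Let $(u^a_1,\ldots,u^a_M)$ denote the analysis ensemble resulting from the Ensemble Kalman filter (EnKF) with ensemble size $M$, and $\tilde\mu^a_M=\frac1M\sum_{j=1}^M\delta_{u^a_j}$ the associated empirical measure. Let $\mu^a$ denote the distribution (push-forward measure) of the analysis variable $U^a=U+K(z-Z)$, $K=\mathrm{Cov}(U,Z)\mathrm{Cov}(Z)^{-1}$. Then for any separable Hilbert space $\mathcal Y$ and any $f:\mathcal X\to\mathcal Y$ for which there is a constant $C$ with $$\|f(u)-f(v)\|_{\mathcal Y}\le C(1+\|u\|_{\mathcal X}+\|v\|_{\mathcal X})\,\|u-v\|_{\mathcal X}\qquad\forall u,v\in\mathcal X,$$ there holds $$\lim_{M\to\infty}\int_{\mathcal X}f(u)\,\tilde\mu^a_M(\mathrm du)=\int_{\mathcal X}f(u)\,\mu^a(\mathrm du)\qquad\mathbb P\text{-a.s.}$$ This implies, in particular, $$\lim_{M\to\infty}\frac1M\sum_{j=1}^Mu^a_j=\mathbb E[U^a]\quad\text{and}\quad\lim_{M\to\infty}\frac1M\sum_{j=1}^M(u^a_j-\bar u^a)\otimes(u^a_j-\bar u^a)=\mathrm{Cov}(U^a)\qquad\mathbb P\text{-a.s.},$$ where $\bar u^a=\frac1M\sum_{j=1}^Mu^a_j$, as well as $$\mathbb P\left(\lim_{M\to\infty}d_W(\tilde\mu^a_M,\mu^a)=0\right)=1.$$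
   Context: $\mathcal X$ is a separable Hilbert space with norm $\|\cdot\|=\|\cdot\|_{\mathcal X}$; $|\cdot|$ is the Euclidean norm on $\mathbb R^d$. All random variables live on a probability space $(\Omega,\mathcal F,\mathbb P)$. $U$ is $\mathcal X$-valued, $\varepsilon$ is $\mathbb R^d$-valued, $G:\mathcal X\to\mathbb R^d$, and $Z=G(U)+\varepsilon$. Conditions: (1) $U\sim\mu_0$, $\varepsilon\sim\nu_\varepsilon$ and $(U,\varepsilon)\sim\mu_0\otimes\nu_\varepsilon$ (independence). (2) $\nu_\varepsilon$ has Lebesgue density $\rho(\varepsilon)=c\,e^{-\ell(\varepsilon)}$ with $c>0$ and $\ell:\mathbb R^d\to[0,\infty)$ measurable. (3) $G$ is continuous. (4) With $\Phi(u;z):=\ell(z-G(u))$, there is a nondecreasing $\psi:[0,\infty)\to[0,\infty)$ with $\lim_{s\to0}\psi(s)=\psi(0)=0$ and $\int_{\mathcal X}|\Phi(u;z_1)-\Phi(u;z_2)|^2\,\mu_0(\mathrm du)\le\psi(|z_1-z_2|)$ for all $z_1,z_2\in\mathbb R^d$. (5) $\int_{\mathcal X}(\|u\|^2+|G(u)|^2)\,\mu_0(\mathrm du)<\infty$ and $\int_{\mathbb R^d}|\varepsilon|^2\,\nu_\varepsilon(\mathrm d\varepsilon)<\infty$. Covariance: $\mathrm{Cov}(X,Y)=\mathbb E[(X-\mathbb E X)\otimes(Y-\mathbb E Y)]$, $\mathrm{Cov}(X)=\mathrm{Cov}(X,X)$; for $X$ with values in $\mathcal X$ and $Y$ with values in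 $\mathbb R^d$, $\mathrm{Cov}(X,Y)$ is regarded as the linear operator $\mathbb R^d\to\mathcal X$, $x\mapsto\mathbb E[\langle Y-\mathbb EY,x\rangle(X-\mathbb EX)]$ (and likewise for empirical covariances). EnKF analysis ensemble: let $(u_j,\varepsilon_j)_{j\in\mathbb N}$ be i.i.d. with $(u_j,\varepsilon_j)\sim\mu_0\otimes\nu_\varepsilon$ and $z_j=G(u_j)+\varepsilon_j$. For ensemble size $M$ put $\boldsymbol u=(u_1,\ldots,u_M)$, $\boldsymbol z=(z_1,\ldots,z_M)$, $\bar{\boldsymbol u}=\frac1M\sum_{j=1}^Mu_j$, $\bar{\boldsymbol z}=\frac1M\sum_{j=1}^Mz_j$, and $$\mathrm{Cov}(\boldsymbol u,\boldsymbol z)=\frac1{M-1}\sum_{j=1}^M(u_j-\bar{\boldsymbol u})\otimes(z_j-\bar{\boldsymbol z}),\qquad \mathrm{Cov}(\boldsymbol z)=\frac1{M-1}\sum_{j=1}^M(z_j-\bar{\boldsymbol z})\otimes(z_j-\bar{\boldsymbol z}).$$ With $\tilde K=\mathrm{Cov}(\boldsymbol u,\boldsymbol z)\mathrm{Cov}(\boldsymbol z)^{-1}$ the analysis ensemble is $u^a_j=u_j+\tilde K(z-z_j)$, $j=1,\ldots,M$ (so each $u^a_j$ depends on $M$); it is considered for $M$ large enough that $\mathrm{Cov}(\boldsymbol z)$ is invertible, which $\mathbb P$-a.s. holds for all sufficiently large $M$. $\delta_x$ is the Dirac measure at $x$. Wasserstein metric: $d_W(\mu_1,\mu_2):=\sup\left|\int_{\mathcal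 X}f\,\mathrm d\mu_1-\int_{\mathcal X}f\,\mathrm d\mu_2\right|$, the supremum being over all $f:\mathcal X\to\mathbb R$ with $|f(u)-f(v)|\le\|u-v\|$ for all $u,v\in\mathcal X$. *)

(* Defs.v *)
From HB Require Import structures.
From mathcomp Require Import all_boot all_order all_algebra.
From mathcomp Require Import finmap.
From mathcomp Require Import all_classical all_reals all_analysis.
From mathcomp Require Import ring lra.

Set Implicit Arguments.
Unset Strict Implicit.
Unset Printing Implicit Defensive.

Import Order.TTheory GRing.Theory Num.Theory.
Import numFieldNormedType.Exports.

Local Open Scope classical_set_scope.
Local Open Scope ring_scope.

HB.mixin Record CompleteNormedModule_isHilbert (R : realType) H
    of CompleteNormedModule R H := {
  inner : H -> H -> R ;
  innerC : forall x y, inner x y = inner y x ;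
  innerDl : forall x y z, inner (x + y) z = inner x z + inner y z ;
  innerZl : forall (a : R) x y, inner (a *: x) y = a * inner x y ;
  innerxx : forall x, inner x x = `|x| ^+ 2 }.

#[short(type="hilbertType")]
HB.structure Definition Hilbert (R : realType) :=
  {H of CompleteNormedModule R H & CompleteNormedModule_isHilbert R H}.

Definition separable (T : topologicalType) :=
  exists2 D : set T, countable D & dense D.

Notation borel T := (g_sigma_algebraType (@open T)).

(* R^d with its Euclidean norm; the library's norm on 'rV_d is the sup norm *)
Definition euclid (R : realType) (d : nat) := 'rV[R]_d.

Section euclid_hilbert.
Context (R : realType) (d : nat).
Notation E := (euclid R d).

HB.instance Definition _ := GRing.Lmodule.copy E 'rV[R]_d.

Definition euclid_dot (x y : E) : R := \sum_(i < d) x ord0 i * y ord0 i.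
Definition euclid_norm (x : E) : R := Num.sqrt (euclid_dot x x).

Lemma euclid_dotC x y : euclid_dot x y = euclid_dot y x.
Proof. by apply: eq_bigr => i _; rewrite mulrC. Qed.

Lemma euclid_dotDl x y z :
  euclid_dot (x + y) z = euclid_dot x z + euclid_dot y z.
Proof.
by rewrite /euclid_dot -big_split; apply: eq_bigr => i _; rewrite mxE mulrDl.
Qed.

Lemma euclid_dotZl a x y : euclid_dot (a *: x) y = a * euclid_dot x y.
Proof.
by rewrite /euclid_dot mulr_sumr; apply: eq_bigr => i _; rewrite mxE mulrA.
Qed.

Lemma euclid_dotDr x y z :
  euclid_dot x (y + z) = euclid_dot x y + euclid_dot x z.
Proof. by rewrite euclid_dotC euclid_dotDl !(euclid_dotC x). Qed.

Lemma euclid_dotZr a x y : euclid_dot x (a *: y) = a * euclid_dot x y.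
Proof. by rewrite euclid_dotC euclid_dotZl euclid_dotC. Qed.

Lemma euclid_dot_ge0 x : 0 <= euclid_dot x x.
Proof. by apply: sumr_ge0 => i _; rewrite -expr2 sqr_ge0. Qed.

Lemma euclid_normE x : euclid_norm x ^+ 2 = euclid_dot x x.
Proof. by rewrite sqr_sqrtr ?euclid_dot_ge0. Qed.

Lemma euclid_norm_ge0 x : 0 <= euclid_norm x.
Proof. exact: sqrtr_ge0. Qed.

Lemma euclid_coord_le (x : E) i : `|x ord0 i| <= euclid_norm x.
Proof.
rewrite -(@ler_pXn2r _ 2) ?nnegrE ?euclid_norm_ge0// euclid_normE.
rewrite real_normK ?num_real// /euclid_dot (bigD1 i)//= -expr2 lerDl.
by apply: sumr_ge0 => j _; rewrite -expr2 sqr_ge0.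
Qed.

Lemma euclid_norm0_eq0 (x : E) : euclid_norm x = 0 -> x = 0.
Proof.
move=> x0; apply/rowP => i; rewrite mxE; apply/eqP.
by rewrite -normr_le0 -x0 euclid_coord_le.
Qed.

Lemma euclid_cauchy_schwarz x y :
  euclid_dot x y <= euclid_norm x * euclid_norm y.
Proof.
have [y0|y0] := eqVneq (euclid_norm y) 0.
  rewrite (euclid_norm0_eq0 y0) /euclid_dot big1 ?mulr_ge0 ?euclid_norm_ge0//.
  by move=> i _; rewrite mxE mulr0.
have [x0|x0] := eqVneq (euclid_norm x) 0.
  rewrite (euclid_norm0_eq0 x0) /euclid_dot big1 ?mulr_ge0 ?euclid_norm_ge0//.
  by move=> i _; rewrite mxE mul0r.
have xy0 : 0 < 2 * (euclid_norm x * euclid_norm y).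
  by rewrite !mulr_gt0// lt_def ?x0 ?y0 euclid_norm_ge0.
have := euclid_dot_ge0 (euclid_norm y *: x + (- euclid_norm x) *: y).
rewrite !(euclid_dotDl, euclid_dotDr, euclid_dotZl, euclid_dotZr).
rewrite (euclid_dotC y x) -!euclid_normE => h.
rewrite -subr_ge0 -(pmulr_rge0 _ xy0).
by move: h; congr (_ <= _); ring.
Qed.

Lemma euclid_normD x y : euclid_norm (x + y) <= euclid_norm x + euclid_norm y.
Proof.
rewrite -(@ler_pXn2r _ 2) ?nnegrE ?addr_ge0 ?euclid_norm_ge0//.
rewrite sqrrD !euclid_normE !(euclid_dotDl, euclid_dotDr) (euclid_dotC y x).
have := euclid_cauchy_schwarz x y; rewrite mulr2n; lra.
Qed.

Lemma euclid_normZ (a : R) x : euclid_norm (a *: x) = `|a| * euclid_norm x.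
Proof.
rewrite /euclid_norm euclid_dotZl euclid_dotZr mulrA -expr2.
by rewrite sqrtrM ?sqr_ge0// sqrtr_sqr.
Qed.

HB.instance Definition _ := Lmodule_isNormed.Build R E
  euclid_normD euclid_normZ euclid_norm0_eq0.

Lemma euclid_complete (F : set_system E) :
  ProperFilter F -> cauchy F -> cvg F.
Proof.
move=> FF /cauchyP Fc; apply/cvg_ex.
have coord i : cvg ((fun v : E => v ord0 i) @ F).
  apply: cauchy_cvg; apply: cauchy_exP => e e0.
  have [x xe] := Fc e e0; exists (x ord0 i); rewrite /= nbhs_simpl.
  apply: filterS xe => y; rewrite -!ball_normE/= => xye.
  by apply: le_lt_trans xye; have := euclid_coord_le (x - y) i; rewrite !mxE.
exists (\row_i lim ((fun v : E => v ord0 i) @ F)).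
apply/cvgrPdist_lt => /= e e0.
pose a := e / d.+1%:R.
have a0 : 0 < a by rewrite divr_gt0.
have near_coord : \forall v \near F, forall i : 'I_d,
    `|(lim ((fun v : E => v ord0 i) @ F) : R) - (v : E) ord0 i| < a.
  apply: filter_forall => i.
  by have /cvgrPdist_lt/(_ a a0) := coord i.
apply: filterS near_coord => v va.
set w : E := _ - _.
rewrite -(@ltr_pXn2r _ 2) ?nnegrE ?normr_ge0 ?(ltW e0)//.
have -> : `|w| ^+ 2 = euclid_dot w w by exact: euclid_normE.
apply: (@le_lt_trans _ _ (\sum_(i < d) a ^+ 2)).
  apply: ler_sum => i _; rewrite -expr2 -real_normK ?num_real//.
  rewrite ler_pXn2r ?nnegrE ?normr_ge0 ?(ltW a0)// /w !mxE; exact: ltW (va i).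
rewrite sumr_const card_ord -mulr_natl /a expr_div_n mulrCA gtr_pMr ?exprn_gt0//.
rewrite ltr_pdivrMr ?exprn_gt0// mul1r -natrX ltr_nat.
by rewrite (leq_trans (ltnSn d))// leq_pmulr.
Qed.

HB.instance Definition _ := Uniform_isComplete.Build E euclid_complete.

Lemma euclid_dotxx (x : E) : euclid_dot x x = `|x| ^+ 2.
Proof. by rewrite -euclid_normE. Qed.

HB.instance Definition _ := CompleteNormedModule_isHilbert.Build R E
  euclid_dotC euclid_dotDl euclid_dotZl euclid_dotxx.

End euclid_hilbert.

Definition euclid_cons (R : realType) (d : nat) (p : R * euclid R d) :
  euclid R d.+1 := row_mx p.1%:M p.2.

(* d-fold product of the Lebesgue measure on the line *)
Fixpoint lebesgue_euclid (R : realType) (d : nat) {struct d} :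
    set (borel (euclid R d)) -> \bar R :=
  match d with
  | 0 => dirac ((0 : euclid R 0) : borel (euclid R 0))
  | d'.+1 => pushforward (lebesgue_measure \x @lebesgue_euclid R d')%E
      (@euclid_cons R d' :
         measurableTypeR R * borel (euclid R d') -> borel (euclid R d'.+1))
  end.

Section law_independence.
Context (R : realType) d (Omega : measurableType d) (P : probability Omega R).

Definition has_law d' (T : measurableType d') (X : Omega -> T)
    (mu : set T -> \bar R) : Prop :=
  measurable_fun [set: Omega] X /\
  forall A, measurable A -> pushforward P X A = mu A.

Definition mutually_independent d' (T : measurableType d')
    (X : nat -> Omega -> T) : Prop :=
  forall (J : {fset nat}) (A : nat -> set T),
    (forall j, j \in J -> measurable (A j)) ->
    P (\bigcap_(j in [set` J]) (X j @^-1` A j)) =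
      (\prod_(j <- J) P (X j @^-1` A j))%E.

End law_independence.

Section bochner.
Context d (T : measurableType d) (R : realType) (H : hilbertType R).
Implicit Types (mu : set T -> \bar R) (f s : T -> H).

Definition bochner_simple mu s : Prop :=
  [/\ measurable_fun [set: T] (s : T -> borel H),
      finite_set (range s) &
      (mu (s @^-1` [set~ 0]%R) < +oo)%E].

(* a possible infinite mass of the fiber over 0 does not contribute *)
Definition bochner_simple_integral mu s : H :=
  \sum_(y \in range s) fine (mu (s @^-1` [set y])) *: y.

(* Only meant for separable H, where Borel measurability of f is strong
   measurability. The library's integral of a nonnegative function accepts
   non-measurable integrands, hence the explicit measurability clause. *)
Definition is_bochner_integral mu f (y : H) : Prop :=
  measurable_fun [set: T] (f : T -> borel H) /\
  exists s : nat -> T -> H,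
    [/\ forall n, bochner_simple mu (s n),
        (\int[mu]_x (`|f x - s n x|)%:E)%E @[n --> \oo] --> 0%E &
        bochner_simple_integral mu (s n) @[n --> \oo] --> y].

Definition bochner_integrable mu f : Prop := exists y, is_bochner_integral mu f y.

(* 0 when f is not integrable *)
Definition bochner mu f : H := xget 0 (is_bochner_integral mu f).

End bochner.

Definition tensor (R : realType) (H1 H2 : hilbertType R) (x : H1) (y : H2) :
  H2 -> H1 := fun v => inner y v *: x.

Definition Cov d (Omega : measurableType d) (R : realType)
    (P : probability Omega R) (H1 H2 : hilbertType R)
    (X : Omega -> H1) (Y : Omega -> H2) : H2 -> H1 := fun v =>
  bochner P (fun w => tensor (X w - bochner P X) (Y w - bochner P Y) v).

Section empirical.
Context (R : realType) (M : nat).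

Definition emp_mean (H : hilbertType R) (x : nat -> H) : H :=
  M%:R^-1 *: \sum_(j < M) x j.

Definition emp_Cov (H1 H2 : hilbertType R) (x : nat -> H1) (y : nat -> H2) :
    H2 -> H1 :=
  (M.-1)%:R^-1 *: \sum_(j < M) tensor (x j - emp_mean x) (y j - emp_mean y).

Definition emp_measure (H : hilbertType R) (x : nat -> H) :
    set (borel H) -> \bar R :=
  mscale (M%:R^-1)%:nng (msum (fun j => \d_(x j : borel H)) M).

End empirical.

(* inverse of a linear operator of R^d, through its matrix in the canonical
   basis (vectors are rows, so operators act by multiplication on the right) *)
Definition euclid_inv (R : realType) (d : nat) (A : euclid R d -> euclid R d) :
  euclid R d -> euclid R d := fun v => v *m invmx (lin1_mx A).

Section kalman.
Context (R : realType) (H : hilbertType R) (d : nat).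

Definition kalman_gain (C : euclid R d -> H) (D : euclid R d -> euclid R d) :
  euclid R d -> H := C \o euclid_inv D.

(* zs is the simulated data ensemble, z the observation. invmx returns its
   argument on a singular matrix, so the gain is total. *)
Definition enkf_analysis (M : nat) (u : nat -> H) (zs : nat -> euclid R d)
    (z : euclid R d) (j : nat) : H :=
  u j + kalman_gain (emp_Cov M u zs) (emp_Cov M zs zs) (z - zs j).

End kalman.

Section hilbert_schmidt.
Context (R : realType) (H1 H2 : hilbertType R).

Definition orthonormal (B : set H1) : Prop :=
  forall e f, B e -> B f -> inner e f = (e == f)%:R.

(* Norm of the Hilbert tensor product. For bounded A the supremum over all
   orthonormal sets is attained at every orthonormal basis. *)
Definition hs_norm (A : H1 -> H2) : \bar R :=
  sqrte (ereal_sup [set (\esum_(e in B) (`|A e| ^+ 2)%:E)%E | B in orthonormal]).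

End hilbert_schmidt.

Definition wasserstein (R : realType) (H : hilbertType R)
    (mu1 mu2 : set (borel H) -> \bar R) : \bar R :=
  ereal_sup [set `| \int[mu1]_u (f u)%:E - \int[mu2]_u (f u)%:E |%E
            | f in [set f : H -> R | forall u v, `|f u - f v| <= `|u - v|]].

(* Main.v *)
Require Import Defs.
From HB Require Import structures.
From mathcomp Require Import all_boot all_order all_algebra.
From mathcomp Require Import finmap.
From mathcomp Require Import all_classical all_reals all_analysis.
From mathcomp Require Import measurable_realfun.
From mathcomp Require Import ring lra.

Set Implicit Arguments.
Unset Strict Implicit.
Unset Printing Implicit Defensive.

Import Order.TTheory GRing.Theory Num.Theory.
Import numFieldNormedType.Exports.

Local Open Scope classical_set_scope.
Local Open Scope ring_scope.

(* With xi_j = (u_j, eps_j), which are i.i.d. with law m = mu0 (x) nu, put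
   a(u, e) = u + K (z - (G u + e)), so that mua is the law of a under m. The
   analysis ensemble differs from (a (xi_j))_j only through the gain.
   - Strong law of large numbers (Etemadi's truncation argument along
     geometrically growing blocks), extended to Hilbert-valued variables by
     simple approximations with values in a countable dense set. The same
     approximations give uniformity over all 1-Lipschitz functions, hence the
     Wasserstein convergence, and over all finite orthonormal families, hence
     the Hilbert-Schmidt convergence of the second moments.
   - Cov Z is invertible: otherwise Z would almost surely lie in a hyperplane,
     whereas the noise is independent of U and has a Lebesgue density.
     Therefore the empirical gains converge to K, in operator norm as R^d has
     finite dimension.
   - The average of |u^a_j - a (xi_j)| (1 + |u^a_j| + |a (xi_j)|) is at most the
     gain error times an average that converges by the strong law; this gives
     the convergence for functions of quadratic growth and, with it, all the
     other claims. *)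

(** A null set has to be fixed before any of the uncountably many Lipschitz functions or orthonormal
    families is chosen. Errors are therefore bounded by quantities free of that choice, namely the
    mean distance to a simple approximation and the deviations of the frequencies of its finitely
    many fibres, so that countably many scalar strong laws suffice. A Bochner integral is given by
    an approximating sequence; for a finite measure and a separable space this is equivalent to
    integrability of the norm together with [inner y v = \int inner (f x) v] for all v, which turns
    identities between vectors into real ones. The inverse in the gain is total, so nothing is
    conditioned on the empirical covariance being invertible: its determinant converges to a nonzero
    limit, and the singular case disappears for large M. The weight [1 + |.| + |.|] in the ensemble
    error is the modulus in the growth condition on f, and second moments suffice to integrate the
    products it produces. *)

Lemma near_eq_cvgn (T : topologicalType) (u v : nat -> T) (l : T) :
  (\forall n \near \oo, u n = v n) ->
  u n @[n --> \oo] --> l -> v n @[n --> \oo] --> l.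
Proof.
by move=> uv; apply: cvg_trans; apply: near_eq_cvg; apply: filterS uv => n ->.
Qed.

Lemma cvg_dist_squeeze (R : realType) (V : normedModType R) (u : nat -> V) (l : V)
    (e : nat -> R) :
  (\forall n \near \oo, `|u n - l| <= e n) -> e n @[n --> \oo] --> 0 ->
  u n @[n --> \oo] --> l.
Proof.
move=> ue e0; apply/cvgrPdist_lt => r r0.
have /cvgrPdist_lt /(_ r r0) := e0.
apply: filterS2 ue => n un; rewrite sub0r normrN distrC => er.
by rewrite (le_lt_trans un)// (le_lt_trans _ er)// ler_norm.
Qed.

(** * Transfer of integrals along a law *)

Section law_transfer.
Context d1 d2 (T : measurableType d1) (E : measurableType d2) (R : realType).
Variables (P : {measure set T -> \bar R}) (mu : {measure set E -> \bar R}).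
Variable X : T -> E.
Hypothesis mX : measurable_fun [set: T] X.
Hypothesis law : forall A, measurable A -> P (X @^-1` A) = mu A.

Lemma law_ge0_integral (f : E -> \bar R) :
  measurable_fun [set: E] f -> (forall x, 0 <= f x)%E ->
  (\int[P]_x f (X x) = \int[mu]_y f y)%E.
Proof.
move=> mf f0.
have := @ge0_integral_pushforward _ _ _ _ R X mX P setT f measurableT mf.
rewrite preimage_setT => <-; last by move=> x _; exact: f0.
by apply: eq_measure_integral => A mA _; rewrite /= -law.
Qed.

Lemma law_integrable (h : E -> R) :
  mu.-integrable setT (EFin \o h) -> P.-integrable setT (EFin \o (h \o X)).
Proof.
move=> /integrableP[mh hoo]; apply/integrableP; split.
  exact: measurableT_comp mh mX.
have /= -> := @law_ge0_integral (fun y => `|(h y)%:E|%E).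
- exact: hoo.
- by apply/measurable_EFinP; apply: measurableT_comp => //; apply/measurable_EFinP.
- by move=> x; rewrite lee_fin.
Qed.

Lemma law_Rintegral (h : E -> R) :
  mu.-integrable setT (EFin \o h) ->
  \int[P]_x h (X x) = \int[mu]_y h y.
Proof.
move=> ih; rewrite /Rintegral; congr fine.
have mh : measurable_fun setT (EFin \o h) by case/integrableP: ih.
have := @integral_pushforward _ _ _ _ R X mX P setT (EFin \o h) mh.
rewrite preimage_setT => /(_ (law_integrable ih) measurableT) /= <-.
by apply: eq_measure_integral => A mA _; rewrite /= -law.
Qed.

End law_transfer.

(** Rectangles determine the product measure, and independence at the two indices i and j gives its
    value on them. Pairs are what a variance computation sees. *)
Lemma indep_pair_law d d' (Omega : measurableType d) (E : measurableType d')
    (R : realType) (P : probability Omega R) (m : probability E R)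
    (xi : nat -> Omega -> E) :
  (forall j, has_law P (xi j) m) -> mutually_independent P xi ->
  forall i j, i != j -> forall A, measurable A ->
    P ((fun w => (xi i w, xi j w)) @^-1` A) = (m \x m)%E A.
Proof.
move=> law ind i j ij.
have mp : measurable_fun setT (fun w => (xi i w, xi j w)).
  by apply/measurable_fun_pairP; split; [exact: (law i).1|exact: (law j).1].
move=> A mA.
rewrite (@product_measure_unique _ _ _ _ R m m
  (measure_function_pushforward__canonical__measure_function_Measure P mp)) //=.
move=> B C mB mC; rewrite /pushforward.
have := ind [fset i; j]%fset (fun k => if k == i then B else C).
have -> : \bigcap_(k in [set` [fset i; j]%fset]) (xi k @^-1` (if k == i then B else C)) =
  (fun w => (xi i w, xi j w)) @^-1` (B `*` C).
  apply/seteqP; split => [w h|w [/= hB hC] k].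
    split => /=.
      by have := h i; rewrite eqxx; apply; rewrite /= in_fset2 eqxx.
    by have := h j; rewrite eq_sym (negbTE ij); apply; rewrite /= in_fset2 eqxx orbT.
  by rewrite /= in_fset2 => /orP[]/eqP ->; rewrite ?eqxx// eq_sym (negbTE ij).
move=> -> ; last by move=> k _; case: ifP.
rewrite big_fsetU1 ?inE//= big_seq_fset1 eqxx eq_sym (negbTE ij).
by rewrite -(law i).2// -(law j).2.
Qed.

(** Monotone convergence bounds the integral of the sum of the series by C, so the series converges
    almost everywhere and its terms tend to 0. This takes the place of a Borel-Cantelli argument. *)
Lemma nonneg_series_ae_cvg0 d (T : measurableType d) (R : realType)
    (P : {measure set T -> \bar R}) (f : nat -> T -> R) (C : R) :
  (forall n, measurable_fun setT (f n)) -> (forall n x, 0 <= f n x) ->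
  (forall N, (\sum_(n < N) \int[P]_x (f n x)%:E <= C%:E)%E) ->
  {ae P, forall x, f n x @[n --> \oo] --> 0}.
Proof.
move=> mf f0 fC.
have mf' n : measurable_fun setT (EFin \o f n) by exact/measurable_EFinP.
have f0' n x : (0 <= (EFin \o f n) x)%E by rewrite lee_fin.
pose F (x : T) : \bar R := (\sum_(n <oo) (f n x)%:E)%E.
have F0 x : (0 <= F x)%E by apply: nneseries_ge0 => n _ _; rewrite lee_fin.
have iF : P.-integrable setT F.
  apply/integrableP; split.
    exact: (@ge0_emeasurable_sum _ _ _ setT (fun n => EFin \o f n) predT).
  under eq_integral do rewrite gee0_abs//.
  rewrite (@integral_nneseries _ _ _ P setT measurableT (fun n => EFin \o f n)) //.
  apply: (@le_lt_trans _ _ C%:E); last exact: ltry.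
  apply: lime_le; first by apply: is_cvg_ereal_nneg_natsum => n _; exact: integral_ge0.
  by apply: nearW => N; rewrite big_mkord.
have := integrable_ae measurableT iF.
apply: filterS => x /(_ I) Ffin.
have cv : cvgn (series (fun n => f n x)).
  apply: nondecreasing_is_cvgn.
    by apply: nondecreasing_series => n _ _; exact: f0.
  exists (fine (F x)) => _ [n _ <-].
  rewrite -lee_fin fineK// /series/= -sumEFin.
  by apply: nneseries_lim_ge => k _ _; rewrite lee_fin.
exact: cvg_series_cvg_0 cv.
Qed.

(** * Integrability of real functions *)

Lemma bounded_measurable_integrable d (T : measurableType d) (R : realType)
    (mu : {measure set T -> \bar R}) (g : T -> R) (M : R) :
  (mu setT < +oo)%E -> measurable_fun setT g -> (forall x, `|g x| <= M) ->
  mu.-integrable setT (EFin \o g).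
Proof.
move=> muoo mg gM; apply: measurable_bounded_integrable => //.
by exists M; split; [rewrite num_real|move=> N MN x _ /=; rewrite (le_trans (gM x))// ltW].
Qed.

Lemma probability_bounded_integrable d (T : measurableType d) (R : realType)
    (mu : probability T R) (g : T -> R) (M : R) :
  measurable_fun setT g -> (forall x, `|g x| <= M) ->
  mu.-integrable setT (EFin \o g).
Proof.
move=> mg gM; apply: (bounded_measurable_integrable _ mg gM).
by rewrite [X in (X < _)%E](@probability_setT _ _ _ mu) ltry.
Qed.

Section integrable_EFin.
Context d (T : measurableType d) (R : realType) (mu : {measure set T -> \bar R}).
Implicit Types f g : T -> R.

Lemma integrable_cst_fin (r : R) : (mu setT < +oo)%E ->
  mu.-integrable setT (EFin \o (fun=> r)).
Proof. by move=> muoo; apply: (@bounded_measurable_integrable _ _ _ _ _ `|r|). Qed.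

Lemma integrable_EFinZl (r : R) f : mu.-integrable setT (EFin \o f) ->
  mu.-integrable setT (EFin \o (fun x => r * f x)).
Proof.
move=> fi; rewrite (_ : _ \o _ = (fun x => r%:E * (f x)%:E)%E) //.
exact: integrableZl.
Qed.

Lemma integrable_EFinD f g : mu.-integrable setT (EFin \o f) ->
  mu.-integrable setT (EFin \o g) -> mu.-integrable setT (EFin \o (fun x => f x + g x)).
Proof.
move=> fi gi; rewrite (_ : _ \o _ = ((EFin \o f) \+ (EFin \o g))%E) //.
exact: integrableD.
Qed.

Lemma integrable_EFinB f g : mu.-integrable setT (EFin \o f) ->
  mu.-integrable setT (EFin \o g) -> mu.-integrable setT (EFin \o (fun x => f x - g x)).
Proof.
move=> fi gi; rewrite (_ : _ \o _ = ((EFin \o f) \- (EFin \o g))%E) //.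
exact: integrableB.
Qed.

Lemma le_integrable_EFin f g : measurable_fun setT f ->
  mu.-integrable setT (EFin \o g) -> (forall x, `|f x| <= g x) ->
  mu.-integrable setT (EFin \o f).
Proof.
move=> mf gi fg; apply: le_integrable gi => //; first exact/measurable_EFinP.
by move=> x _; rewrite lee_fin (le_trans (fg x))// ler_norm.
Qed.

Lemma Rintegral_dominated_cvg (f_ : nat -> T -> R) f g :
  (forall n, measurable_fun setT (f_ n)) -> measurable_fun setT f ->
  (forall x, f_ n x @[n --> \oo] --> f x) -> mu.-integrable setT (EFin \o g) ->
  (forall n x, `|f_ n x| <= g x) ->
  \int[mu]_x f_ n x @[n --> \oo] --> \int[mu]_x f x.
Proof.
move=> mf_ mf f_f ig f_g.
have mf' : measurable_fun setT (EFin \o f) by exact/measurable_EFinP.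
have [||iF _ C] := @dominated_convergence _ _ _ mu setT measurableT
  (fun n => EFin \o f_ n) (EFin \o f) (EFin \o g)
  (fun n => (measurable_EFinP _ _).2 (mf_ n)) mf' _ ig.
- by apply: aeW => x _; apply: cvg_EFin => //; [exact: nearW|exact: f_f].
- by apply: aeW => x n _; rewrite lee_fin f_g.
- by apply: fine_cvg; rewrite fineK//; exact: integrable_fin_num iF.
Qed.

End integrable_EFin.

Lemma integrable_sumr d (T : measurableType d) (R : realType)
    (mu : {measure set T -> \bar R}) (I : Type) (s : seq I) (f : I -> T -> R) :
  (forall i, mu.-integrable setT (EFin \o f i)) ->
  mu.-integrable setT (EFin \o (fun x => \sum_(i <- s) f i x)).
Proof.
move=> fi.
have -> : EFin \o (fun x => \sum_(i <- s) f i x) =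
    (fun x => \sum_(i <- s) (EFin \o f i) x)%E.
  by apply/funext => x /=; rewrite sumEFin.
by apply: (integrable_sum measurableT) => i _; exact: fi.
Qed.

Lemma Rintegral_sum d (T : measurableType d) (R : realType)
    (mu : {measure set T -> \bar R}) (I : Type) (s : seq I) (f : I -> T -> R) :
  (forall i, mu.-integrable setT (EFin \o f i)) ->
  \int[mu]_x (\sum_(i <- s) f i x) = \sum_(i <- s) \int[mu]_x f i x.
Proof.
move=> fi; elim: s => [|a s ih].
  rewrite big_nil; under eq_Rintegral do rewrite big_nil.
  by rewrite Rintegral_cst// mul0r.
rewrite big_cons; under eq_Rintegral do rewrite big_cons.
by rewrite RintegralD ?ih//; exact: integrable_sumr.
Qed.

(** * Variance of sums of i.i.d. variables *)

Section iid_variance.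
Context d d' (Omega : measurableType d) (E : measurableType d') (R : realType).
Variables (P : probability Omega R) (m : probability E R).
Variable xi : nat -> Omega -> E.
Hypothesis law : forall j, has_law P (xi j) m.
Hypothesis ind : mutually_independent P xi.

(** The joint law of the pair is [m \x m], where Fubini factorises the integral. The bound M makes
    the integrands integrable. *)
Lemma iid_mul_Rintegral (g : E -> R) (M : R) i j : i != j ->
  measurable_fun setT g -> (forall x, `|g x| <= M) ->
  \int[P]_w (g (xi i w) * g (xi j w)) = (\int[m]_x g x) ^+ 2.
Proof.
move=> ij mg gM.
have M0 : 0 <= M by rewrite (le_trans _ (gM point)).
have mp : measurable_fun setT (fun w => (xi i w, xi j w)).
  by apply/measurable_fun_pairP; split; [exact: (law i).1|exact: (law j).1].
have mgg : measurable_fun setT (fun p : E * E => g p.1 * g p.2).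
  by apply: measurable_funM; apply: measurableT_comp.
have ig : m.-integrable setT (EFin \o g) by exact: probability_bounded_integrable gM.
have igg : (m \x m)%E.-integrable setT (EFin \o (fun p : E * E => g p.1 * g p.2)).
  apply: (bounded_measurable_integrable (M := M * M)) => //.
    have mm1 : ((m \x m)%E [set: E * E] = 1)%E.
      by rewrite -setXTT product_measure1E//= !probability_setT mule1.
    by rewrite [X in (X < _)%E]mm1 ltry.
  by move=> p; rewrite normrM ler_pM.
have := @law_Rintegral _ _ _ _ _ P (m \x m)%E _ mp
  (indep_pair_law law ind ij) _ igg.
move=> /= ->.
rewrite /Rintegral -(integral12_prod_meas1 igg) /=.
have -> : fubini_F m (EFin \o (fun p : E * E => g p.1 * g p.2)) =
    (fun x => (\int[m]_y g y)%:E * (g x)%:E)%E.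
  apply/funext => x; rewrite /fubini_F /=.
  under eq_integral do rewrite EFinM.
  rewrite integralZl// muleC; congr (_ * _)%E.
  by rewrite fineK//; exact: integrable_fin_num.
by rewrite integralZl// fineM ?expr2//; exact: integrable_fin_num.
Qed.

(** After centring, the off-diagonal terms vanish by independence, and a diagonal term is the
    variance of g, at most its second moment. *)
Lemma iid_variance_le (g : E -> R) (M : R) (k : nat) :
  measurable_fun setT g -> (forall x, `|g x| <= M) ->
  \int[P]_w ((\sum_(i < k) g (xi i w) - k%:R * \int[m]_x g x) ^+ 2)
    <= k%:R * \int[m]_x (g x ^+ 2).
Proof.
move=> mg gM.
set mu := \int[m]_x g x.
pose g0 x := g x - mu.
have mg0 : measurable_fun setT g0 by apply: measurable_funB.
have g0M x : `|g0 x| <= M + `|mu| by rewrite (le_trans (ler_normB _ _))// lerD.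
have ig : m.-integrable setT (EFin \o g) by exact: probability_bounded_integrable gM.
have M0 : 0 <= M by rewrite (le_trans _ (gM point)).
have ic r : m.-integrable setT (EFin \o (fun=> r)) by exact: finite_measure_integrable_cst.
have m1 : fine (m setT) = 1 by rewrite probability_setT.
have g0int : \int[m]_x g0 x = 0.
  by rewrite RintegralB// Rintegral_cst// m1 mulr1 subrr.
have Mm0 : 0 <= M + `|mu| by rewrite addr_ge0.
have ip i j : P.-integrable setT (EFin \o (fun w => g0 (xi i w) * g0 (xi j w))).
  apply: (@probability_bounded_integrable _ _ _ _ _ ((M + `|mu|) * (M + `|mu|))).
    by apply: measurable_funM; apply: measurableT_comp => //; exact: (law _).1.
  by move=> w; rewrite normrM ler_pM.
have -> : \int[P]_w ((\sum_(i < k) g (xi i w) - k%:R * mu) ^+ 2) =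
  \int[P]_w (\sum_(i < k) \sum_(j < k) g0 (xi i w) * g0 (xi j w)).
  apply: eq_Rintegral => w _.
  rewrite -big_distrlr /= -expr2 /g0 sumrB sumr_const card_ord.
  by rewrite mulr_natl.
rewrite Rintegral_sum; last first.
  by move=> i; exact: integrable_sumr.
rewrite (eq_bigr (fun=> \int[m]_x (g0 x ^+ 2))).
  rewrite sumr_const card_ord -[leLHS]mulr_natl ler_wpM2l//.
  have isq (h : E -> R) N : measurable_fun setT h -> (forall x, `|h x| <= N) ->
      m.-integrable setT (EFin \o (fun x => h x ^+ 2)).
    move=> mh hN; apply: (@probability_bounded_integrable _ _ _ _ _ (N ^+ 2)).
      exact: measurable_funX.
    by move=> x; rewrite normrX lerXn2r// nnegrE (le_trans _ (hN x)).
  (* The bracket integrates to [2 * mu ^+ 2 - mu ^+ 2], which is nonnegative and is dropped. *)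
  have -> : \int[m]_x (g0 x ^+ 2) = \int[m]_x (g x ^+ 2 - (2 * mu * g x - mu ^+ 2)).
    by apply: eq_Rintegral => x _; rewrite /g0; ring.
  have i2 : m.-integrable setT (EFin \o (fun x => 2 * mu * g x)).
    exact: integrable_EFinZl.
  rewrite RintegralB//; [|exact: isq gM|exact: integrable_EFinB].
  rewrite lerBlDr lerDl RintegralB// RintegralZl// Rintegral_cst// m1 mulr1 -/mu.
  by have := sqr_ge0 mu; rewrite expr2; lra.
move=> i _; rewrite Rintegral_sum// (bigD1 i)//= big1 ?addr0.
  under eq_Rintegral do rewrite -expr2.
  rewrite (@law_Rintegral _ _ _ _ _ P m (xi i) (law i).1 (law i).2 (fun x => g0 x ^+ 2))//.
  apply: (@probability_bounded_integrable _ _ _ _ _ ((M + `|mu|) ^+ 2)).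
    exact: measurable_funX.
  by move=> x; rewrite normrX lerXn2r// nnegrE.
move=> j ji; rewrite (@iid_mul_Rintegral _ (M + `|mu|))// ?g0int ?expr0n//.
by rewrite eq_sym; apply: contra ji => /eqP/val_inj ->.
Qed.

End iid_variance.

(** * Strong law of large numbers *)

(* Indices growing geometrically with ratio about 1 + 1/(p+1). *)
Fixpoint block (p n : nat) : nat :=
  if n is n'.+1 then (block p n' + block p n' %/ p.+1).+1 else 1.

Lemma ler_sum_telescope (R : realType) (a T : nat -> R) N :
  (forall n, a n <= T n.+1 - T n) -> \sum_(n < N) a n <= T N - T 0%N.
Proof.
move=> aT; rewrite -(telescope_sumr T (leq0n N)) big_mkord.
by apply: ler_sum.
Qed.

Section block_theory.
Context (R : realType) (p : nat).
Local Notation k := (block p).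

Lemma block_gt0 n : (0 < k n)%N. Proof. by case: n. Qed.

Lemma blockS_gt n : (k n < k n.+1)%N.
Proof. by rewrite /= ltnS leq_addr. Qed.

Lemma block_ge n : (n < k n)%N.
Proof. by elim: n => // n ih; exact: leq_trans (blockS_gt n). Qed.

(** With denominators cleared: consecutive indices grow at least by the ratio 1 + 1/(p+1). Both
    telescoping sums below rest on this inequality. *)
Lemma blockS_lower n : (k n + p.+1 * k n <= p.+1 * k n.+1)%N.
Proof.
have h := ltn_ceil (k n) (ltn0Sn p).
by rewrite [in leqRHS]/= -addnS mulnDr addnC leq_add2l mulnC ltnW.
Qed.

(** Growth is at most by the ratio 1 + 1/(p+1), up to an additive error that stems from the
    successor in [block] and is absorbed into [k n] once [p.+1 <= k n]. *)
Lemma blockS_upper n : (p.+1 * k n.+1 <= p.+2 * k n + p.+1)%N.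
Proof.
rewrite (_ : k n.+1 = k n + (k n %/ p.+1).+1)%N; last by rewrite /= addnS.
rewrite mulnDr [in leqRHS]mulSn (addnC (k n) (_ * _)%N) -addnA leq_add2l mulnS addnC.
by rewrite leq_add2r mulnC leq_trunc_div.
Qed.

(** A ratio bound uniform in p, crude but enough to keep [k n.+1] below 3x when [k n] is below x. *)
Lemma blockS_le3 n : (k n.+1 <= 3 * k n)%N.
Proof.
rewrite /= -addnS mulSn leq_add2l mulSn mul1n -addn1 leq_add ?block_gt0//.
exact: leq_div.
Qed.

Lemma block_exists n0 m : (k n0 <= m)%N ->
  exists2 n, (n0 <= n)%N & (k n <= m < k n.+1)%N.
Proof.
elim: m => [|m ih]; first by rewrite leqNgt block_gt0.
rewrite leq_eqVlt => /predU1P[<-|].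
  by exists n0 => //; rewrite leqnn blockS_gt.
rewrite ltnS => /ih[n n0n /andP[knm mkn]].
have [h|h] := ltnP m.+1 (k n.+1).
  by exists n => //; rewrite leqW.
exists n.+1; first exact: leqW.
by rewrite h /= (leq_ltn_trans mkn)// blockS_gt.
Qed.

Let kR n : 0 < (k n)%:R :> R. Proof. by rewrite ltr0n block_gt0. Qed.

Lemma block_inv_sum (x : R) N : 0 < x ->
  \sum_(n < N | x <= (k n)%:R) ((k n)%:R^-1 : R) <= p.+2%:R / x.
Proof.
move=> x0.
(* When [x <= k n], [blockS_lower] says exactly that [1 / k n <= p.+2 * (1 / k n - 1 / k n.+1)]. The
   maximum with x keeps T nonincreasing before that and caps it by [p.+2 / x]. *)
pose T n : R := p.+2%:R / Num.max x (k n)%:R.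
have T0 n : 0 <= T n by rewrite divr_ge0// le_max ltW.
have step n : (if x <= (k n)%:R then (k n)%:R^-1 else 0) <= T n - T n.+1.
  case: ifPn => xk.
    rewrite /T !max_r//; last by rewrite (le_trans xk)// ler_nat ltnW// blockS_gt.
    rewrite -mulrBr -(@ler_pM2r _ ((k n)%:R * (k n.+1)%:R)) ?mulr_gt0//.
    rewrite mulrA mulVf ?gt_eqF// mul1r -mulrA mulrBl mulrA mulVf ?gt_eqF// mul1r.
    rewrite mulrCA mulVf ?gt_eqF// mulr1.
    have := blockS_lower n; rewrite -(ler_nat R) natrD !natrM.
    by rewrite -[p.+2]addn1 natrD; lra.
  rewrite subr_ge0 /T ler_wpM2l// lef_pV2 ?posrE ?lt_max ?x0//.
  by rewrite ge_max !le_max lexx/= ler_nat (ltnW (blockS_gt n)) orbT.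
rewrite big_mkcond /=.
have tele := @ler_sum_telescope _ (fun n => if x <= (k n)%:R then (k n)%:R^-1 else 0)
  (fun n => - T n) N (fun n => ltac:(rewrite opprK addrC; exact: step)).
rewrite opprK addrC in tele.
apply: (le_trans tele); rewrite (@le_trans _ _ (T 0))//; first by rewrite gerBl.
by rewrite /T ler_wpM2l// lef_pV2 ?posrE ?lt_max ?x0// le_max lexx.
Qed.

Lemma block_sum (x : R) N : 0 <= x ->
  \sum_(n < N | (k n)%:R < x) ((k n)%:R : R) <= p.+1%:R * (3 * x).
Proof.
move=> x0.
(* [blockS_lower] also reads [k n <= p.+1 * (k n.+1 - k n)]. If [k n < x] then [k n.+1 < 3 * x], so
   the cap at 3x is inactive at both ends of the increment, while it bounds the total. *)
pose T n : R := p.+1%:R * Num.min (k n)%:R (3 * x).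
have step n : (if (k n)%:R < x then (k n)%:R else 0) <= T n.+1 - T n.
  case: ifPn => xk.
    have h3 := blockS_le3 n; rewrite -(ler_nat R) natrM in h3.
    rewrite /T !min_l; [| lra | lra].
    by have := blockS_lower n; rewrite -(ler_nat R) natrD !natrM; lra.
  rewrite subr_ge0 /T ler_wpM2l// le_min !ge_min lexx orbT andbT.
  by rewrite ler_nat (ltnW (blockS_gt n)).
rewrite big_mkcond /=.
have T0 : 0 <= T 0 by rewrite /T mulr_ge0// le_min ler0n/= mulr_ge0.
have tele := ler_sum_telescope N step.
apply: (le_trans tele); rewrite (@le_trans _ _ (T N))//; first by rewrite gerBl.
by rewrite /T ler_wpM2l// ge_min lexx orbT.
Qed.

End block_theory.

(* Since S is monotone, [S n / n] oscillates within a block by a factor of at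
   most the ratio 1 + 1/(p+1), which tends to 1. *)
Lemma block_cvg (R : realType) (S : nat -> R) (mu : R) :
  (forall n, 0 <= S n) -> (forall m n, (m <= n)%N -> S m <= S n) ->
  (forall p, S (block p n) / (block p n)%:R @[n --> \oo] --> mu) ->
  n%:R^-1 * S n @[n --> \oo] --> mu.
Proof.
move=> S0 Sn Sp.
have mu0 : 0 <= mu.
  apply: (ler_cvg_to (cvg_cst 0) (Sp 0)); apply: nearW => n.
  by rewrite divr_ge0.
apply/cvgrPdist_le => /= e e0.
(* With q = p+1, comparing m with the ends of its block costs a factor [(q + 2) / q]. The choice
   [4 * (mu + e) <= q * e] keeps this loss, together with the error e/4 at the block ends, within
   e. *)
pose D := 4 * (mu + e) / e.
have D0 : 0 < D by rewrite divr_gt0// mulr_gt0// ltr_wpDl.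
pose p := Num.truncn D.
have pD : D <= p.+1%:R by rewrite ltW// truncnS_gt.
have /cvgrPdist_le /(_ (e / 4)) := Sp p.
have e4 : 0 < e / 4 by rewrite divr_gt0.
move=> /(_ e4) [n1 _ hn1].
(* From index p+1 on, [block p n] is at least p+1, so the additive error in [blockS_upper] costs at
   most one more [block p n]. *)
pose n0 := maxn n1 p.+1.
exists (block p n0) => // m /= hm.
have [n n0n /andP[knm mkn]] := block_exists hm.
have k0 : 0 < (block p n)%:R :> R by rewrite ltr0n block_gt0.
have k1 : 0 < (block p n.+1)%:R :> R by rewrite ltr0n block_gt0.
have m0 : 0 < m%:R :> R by rewrite ltr0n (leq_trans (block_gt0 p n)).
have n1n : (n1 <= n)%N by rewrite (leq_trans _ n0n)// leq_maxl.
have pn : (p.+1 <= block p n)%N.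
  by rewrite (leq_trans _ (ltnW (block_ge p n)))// (leq_trans _ n0n)// leq_maxr.
have := hn1 n n1n; have := hn1 n.+1 (leqW n1n); rewrite /= -/(block p n.+1).
set s1 := S (block p n.+1) / _; set s0 := S (block p n) / _.
have s1E : S (block p n.+1) = s1 * (block p n.+1)%:R by rewrite divfK// gt_eqF.
have s0E : S (block p n) = s0 * (block p n)%:R by rewrite divfK// gt_eqF.
have s10 : 0 <= s1 by rewrite divr_ge0.
have s00 : 0 <= s0 by rewrite divr_ge0.
rewrite !ler_norml => /andP[a1 a2] /andP[b1 b2].
have l1 : S m <= s1 * (block p n.+1)%:R by rewrite -s1E Sn// ltnW.
have l0 : s0 * (block p n)%:R <= S m by rewrite -s0E Sn.
have up : p.+1%:R * (block p n.+1)%:R <= p.+1%:R * (block p n)%:R + 2 * (block p n)%:R :> R.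
  have := blockS_upper p n; rewrite -(ler_nat R) natrD !natrM.
  by move: pn; rewrite -(ler_nat R) -[p.+2]addn1 natrD; lra.
have kb : (block p n)%:R <= m%:R :> R by rewrite ler_nat.
have kb' : m%:R <= (block p n.+1)%:R :> R by rewrite ler_nat ltnW.
rewrite mulrC.
set sm := S m / m%:R.
have smE : S m = sm * m%:R by rewrite divfK// gt_eqF.
have p0 : 0 < p.+1%:R :> R by [].
have De : 4 * (mu + e) <= p.+1%:R * e by rewrite -ler_pdivrMr.
rewrite smE in l0 l1.
move: l0 l1 up kb kb' De a1 a2 b1 b2.
set K0 := (block p n)%:R in k0 *; set K1 := (block p n.+1)%:R in k1 *.
set q := p.+1%:R in p0 *; set M := m%:R in m0 *.
move=> l0 l1 up kb kb' De a1 a2 b1 b2.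
have upM : q * M <= (q + 2) * K0 by rewrite (le_trans _ (_ : q * K1 <= _)) ?ler_pM2l//; lra.
apply/andP; split.
  have h1 : q * sm * M <= s1 * (q + 2) * M.
    have u1 : q * (sm * M) <= q * (s1 * K1) by rewrite ler_pM2l.
    have u2 : s1 * (q * K1) <= s1 * ((q + 2) * M).
      by rewrite ler_wpM2l// (le_trans up)// -mulrDl ler_pM2l//; lra.
    lra.
  rewrite ler_pM2r// in h1.
  have h2 : s1 * (q + 2) <= (mu + e / 4) * (q + 2) by rewrite ler_wpM2r//; lra.
  have : q * sm <= q * (mu + e) by nra.
  by rewrite ler_pM2l//; lra.
have h1 : s0 * q * M <= sm * (q + 2) * M.
  have u1 : s0 * (q * M) <= s0 * ((q + 2) * K0) by rewrite ler_wpM2l.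
  have u2 : (q + 2) * (s0 * K0) <= (q + 2) * (sm * M) by rewrite ler_pM2l//; lra.
  lra.
rewrite ler_pM2r// in h1.
have sm0 : 0 <= sm by rewrite divr_ge0.
have [?|sme] := leP (mu - sm) e; first by [].
have h2 : sm * (q + 2) <= (mu - e) * (q + 2) by rewrite ler_wpM2r//; lra.
nra.
Qed.

Section slln.
Context d d' (Omega : measurableType d) (E : measurableType d') (R : realType).
Variables (P : probability Omega R) (m : probability E R).
Variable xi : nat -> Omega -> E.
Hypothesis law : forall j, has_law P (xi j) m.
Hypothesis ind : mutually_independent P xi.
Variable h : E -> R.
Hypotheses (mh : measurable_fun setT h) (h0 : forall x, 0 <= h x).
Hypothesis ih : m.-integrable setT (EFin \o h).

(** All summands of a block are truncated at one level c, the block length, instead of the i-th one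
    at level i, so they stay identically distributed. The sum of [tail] counts the summands changed
    by the truncation. *)
Let trunc (c : R) x : R := if h x <= c then h x else 0.
Let tail (c : R) x : R := if c < h x then 1 else 0.

Let mtrunc c : measurable_fun setT (trunc c).
Proof. by apply: measurable_fun_ifT => //; exact: measurable_fun_ler. Qed.

Let mtail c : measurable_fun setT (tail c).
Proof. by apply: measurable_fun_ifT => //; exact: measurable_fun_ltr. Qed.

Let trunc_le c x : 0 <= c -> `|trunc c x| <= c.
Proof. by move=> c0; rewrite ger0_norm// /trunc; case: ifP. Qed.

Let tail_le c x : `|tail c x| <= 1.
Proof. by rewrite /tail; case: ifP; rewrite ?normr1 ?normr0. Qed.

Let tail_ge0 c x : 0 <= tail c x.
Proof. by rewrite /tail; case: ifP. Qed.

Let itrunc2 c : 0 <= c -> m.-integrable setT (EFin \o (fun x => trunc c x ^+ 2)).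
Proof.
move=> c0; apply: (@probability_bounded_integrable _ _ _ _ _ (c ^+ 2)).
  exact: measurable_funX.
by move=> x; rewrite normrX lerXn2r// ?nnegrE// trunc_le.
Qed.

Let itail c : m.-integrable setT (EFin \o tail c).
Proof. exact: (@probability_bounded_integrable _ _ _ _ _ 1). Qed.

Section along_blocks.
Variable p : nat.
Let k n : R := (block p n)%:R.
Let k0 n : 0 < k n. Proof. by rewrite ltr0n block_gt0. Qed.
Let mean n : R := \int[m]_x trunc (k n) x.
Let dev n w : R :=
  ((\sum_(i < block p n) trunc (k n) (xi i w) - k n * mean n) / k n) ^+ 2.
Let over n w : R := \sum_(i < block p n) tail (k n) (xi i w).

Let mdev n : measurable_fun setT (dev n).
Proof.
apply: measurable_funX; apply: measurable_funM => //.
apply: measurable_funB => //; apply: measurable_sum => i.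
by apply: measurableT_comp => //; exact: (law i).1.
Qed.

Let mover n : measurable_fun setT (over n).
Proof.
by apply: measurable_sum => i; apply: measurableT_comp => //; exact: (law i).1.
Qed.

Let idev n : P.-integrable setT (EFin \o dev n).
Proof.
pose M := (\sum_(i < block p n) k n + `|k n * mean n|) / k n.
apply: (@probability_bounded_integrable _ _ _ _ _ (M ^+ 2)) => // w.
rewrite normrX lerXn2r ?nnegrE//.
  by rewrite divr_ge0 ?(ltW (k0 n))// addr_ge0// sumr_ge0// => i _; exact: ltW.
rewrite normrM (@ger0_norm _ (k n)^-1) ?invr_ge0 ?(ltW (k0 n))//.
rewrite ler_pM2r ?invr_gt0// (le_trans (ler_normB _ _))// lerD2r.
by rewrite (le_trans (ler_norm_sum _ _ _))// ler_sum// => i _; rewrite trunc_le// ltW.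
Qed.

Let iover n : P.-integrable setT (EFin \o over n).
Proof.
apply: integrable_sumr => i.
have := @law_integrable _ _ _ _ _ P m (xi i) (law i).1 (law i).2 (tail (k n)).
by apply.
Qed.

Let dev_le n : \int[P]_w dev n w <= (k n)^-1 * \int[m]_x (trunc (k n) x ^+ 2).
Proof.
pose D w := \sum_(i < block p n) trunc (k n) (xi i w) - k n * mean n.
have -> : \int[P]_w dev n w = (k n)^-2 * \int[P]_w (D w ^+ 2).
  rewrite -RintegralZl//; last first.
    rewrite (_ : _ \o _ = EFin \o (fun w => k n ^+ 2 * dev n w)).
      exact: integrable_EFinZl.
    apply/funext => w /=; rewrite /dev expr_div_n mulrCA mulfV ?mulr1//.
    by rewrite expf_neq0// gt_eqF.
  by apply: eq_Rintegral => w _; rewrite /dev expr_div_n mulrC.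
have := iid_variance_le law ind (block p n) (mtrunc (k n))
  (fun x => trunc_le x (ltW (k0 n))).
rewrite -/(mean n) -/(k n) => V.
rewrite (@le_trans _ _ ((k n)^-2 * (k n * \int[m]_x (trunc (k n) x ^+ 2))))//.
  by rewrite ler_wpM2l// invr_ge0 exprn_ge0// ltW.
by rewrite mulrA expr2 invfM mulfVK// gt_eqF.
Qed.

Let over_le n : \int[P]_w over n w = k n * \int[m]_x tail (k n) x.
Proof.
rewrite Rintegral_sum; last first.
  move=> i; have := @law_integrable _ _ _ _ _ P m (xi i) (law i).1 (law i).2 (tail (k n)).
  by apply.
rewrite (eq_bigr (fun=> \int[m]_x tail (k n) x)).
  by rewrite sumr_const card_ord mulr_natl.
by move=> i _; rewrite (@law_Rintegral _ _ _ _ _ P m (xi i) (law i).1 (law i).2 (tail (k n))).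
Qed.

(** Sum and integral are exchanged and the sum is estimated for each x: [h x ^+ 2] times the sum of
    [1 / k n] over [h x <= k n] is at most [p.+2 * h x] by [block_inv_sum], and the sum of [k n]
    over [k n < h x] is at most [3 * p.+1 * h x] by [block_sum]. A first moment of h is thus
    enough. *)
Let total_le N : \sum_(n < N) \int[P]_w (dev n w + over n w)
  <= (p.+2%:R + 3 * p.+1%:R) * \int[m]_x h x.
Proof.
pose F n x := (k n)^-1 * trunc (k n) x ^+ 2 + k n * tail (k n) x.
have iF n : m.-integrable setT (EFin \o F n).
  have i1 : m.-integrable setT (EFin \o (fun x => (k n)^-1 * trunc (k n) x ^+ 2)).
    by apply: integrable_EFinZl; exact/itrunc2/ltW.
  have i2 : m.-integrable setT (EFin \o (fun x => k n * tail (k n) x)).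
    exact: integrable_EFinZl.
  exact: integrable_EFinD.
rewrite (@le_trans _ _ (\sum_(n < N) \int[m]_x F n x))//.
  apply: ler_sum => n _; rewrite RintegralD// over_le RintegralD//.
  - rewrite !RintegralZl//; last exact/itrunc2/ltW.
    by rewrite lerD2r; exact: dev_le.
  - by apply: integrable_EFinZl; exact/itrunc2/ltW.
  - exact: integrable_EFinZl.
rewrite -Rintegral_sum// -RintegralZl//.
apply: le_Rintegral => //.
- exact: integrable_sumr.
- exact: integrable_EFinZl.
move=> x _; rewrite /F big_split /= mulrDl lerD//.
  rewrite (_ : \sum_(i < N) _ =
      h x ^+ 2 * \sum_(i < N | h x <= (block p i)%:R) ((block p i)%:R^-1 : R)).
    have [hx0|hx0] := eqVneq (h x) 0; first by rewrite hx0 expr0n/= mul0r mulr0.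
    have hxp : 0 < h x by rewrite lt_def hx0 h0.
    have := @block_inv_sum R p (h x) N hxp.
    move=> /(ler_wpM2l (exprn_ge0 2 (h0 x))) /le_trans; apply.
    by rewrite mulrCA expr2 mulfK.
  rewrite mulr_sumr [RHS]big_mkcond /=; apply: eq_bigr => i _.
  by rewrite /trunc /k; case: ifP; rewrite ?expr0n/= ?mulr0// mulrC.
rewrite (_ : \sum_(i < N) _ = \sum_(i < N | (block p i)%:R < h x) ((block p i)%:R : R)).
  by rewrite (le_trans (block_sum _ _ (h0 x)))// mulrA (mulrC _ 3).
rewrite [RHS]big_mkcond /=; apply: eq_bigr => i _.
by rewrite /tail /k; case: ifP; rewrite ?mulr1 ?mulr0.
Qed.

Let mean_cvg : mean n @[n --> \oo] --> \int[m]_x h x.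
Proof.
apply: (Rintegral_dominated_cvg (g := h)) => //.
- move=> x; apply: cvg_near_cst.
  exists (Num.truncn (h x)) => // n /= hn.
  rewrite /trunc /k (le_trans (ltW (truncnS_gt (h x))))// ler_nat.
  by rewrite (leq_trans _ (block_ge p n)).
- by move=> n x; rewrite ger0_norm// /trunc; case: ifP.
Qed.

(** Truncated means along blocks have summable variances, and the expected numbers of truncated
    summands are summable too, so [dev] and [over] both tend to 0 almost surely. *)
Lemma slln_along_blocks : {ae P, forall w,
  (\sum_(i < block p n) h (xi i w)) / (block p n)%:R @[n --> \oo] --> \int[m]_x h x}.
Proof.
have dev0 n w : 0 <= dev n w by rewrite sqr_ge0.
have over0 n w : 0 <= over n w by rewrite sumr_ge0.
have : {ae P, forall w, dev n w + over n w @[n --> \oo] --> 0}.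
  apply: (@nonneg_series_ae_cvg0 _ _ _ P (fun n w => dev n w + over n w)
    ((p.+2%:R + 3 * p.+1%:R) * \int[m]_x h x)).
  - by move=> n; exact: measurable_funD.
  - by move=> n w; exact: addr_ge0.
  move=> N; rewrite (eq_bigr (fun n : 'I_N => (\int[P]_w (dev n w + over n w))%:E)).
    by rewrite sumEFin lee_fin; exact: total_le.
  move=> n _; rewrite /Rintegral fineK//.
  by apply: integrable_fin_num => //; exact: integrable_EFinD.
apply: filterS => w hw.
have dw : dev n w @[n --> \oo] --> 0.
  apply: (squeeze_cvgr _ (cvg_cst 0) hw); apply: nearW => n.
  by rewrite dev0 lerDl over0.
have ow : over n w @[n --> \oo] --> 0.
  apply: (squeeze_cvgr _ (cvg_cst 0) hw); apply: nearW => n.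
  by rewrite over0 lerDr dev0.
have dw' : (\sum_(i < block p n) trunc (k n) (xi i w) - k n * mean n) / k n
    @[n --> \oo] --> 0.
  apply/norm_cvg0P.
  have := cvg_comp _ _ dw (@sqrt_continuous R 0); rewrite sqrtr0.
  by apply: near_eq_cvgn; apply: nearW => n /=; rewrite /dev sqrtr_sqr.
have := cvgD dw' mean_cvg; rewrite add0r => /(_ _); apply: near_eq_cvgn.
(* [over n w] is a count: below 1 it vanishes, so no summand of the block exceeds the level and the
   truncated sum is the full one. *)
have /cvgrPdist_lt /(_ 1 ltr01) := ow; case=> n0 _ hn0.
exists n0 => // n /= /hn0 /=.
rewrite sub0r normrN ger0_norm// => o1.
rewrite mulrBl mulrAC mulfV ?gt_eqF// mul1r subrK; congr (_ / _).
apply: eq_bigr => i _; rewrite /trunc; case: ifPn => //; rewrite -ltNge => ki.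
suff : 1 <= over n w by rewrite leNgt o1.
rewrite /over (bigD1 i)//= {1}/tail ki lerDl; exact: sumr_ge0.
Qed.

End along_blocks.

(** Interpolation between blocks by [block_cvg] relies on monotone partial sums, hence on [h0]. It
    also takes all ratio parameters p at once, and these are countably many. *)
Theorem slln_nonneg : {ae P, forall w,
  n%:R^-1 * (\sum_(i < n) h (xi i w)) @[n --> \oo] --> \int[m]_x h x}.
Proof.
have : {ae P, forall w p, (\sum_(i < block p n) h (xi i w)) / (block p n)%:R
    @[n --> \oo] --> \int[m]_x h x}.
  by apply/ae_foralln => p; exact: slln_along_blocks.
apply: filterS => w hw; apply: block_cvg => // [n|a b ab].
  exact: sumr_ge0.
rewrite -(subnKC ab) big_split_ord /= lerDl; exact: sumr_ge0.
Qed.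

End slln.

(** * Borel measurability in separable Hilbert spaces *)

Section inner_theory.
Context (R : realType) (H : hilbertType R).
Implicit Types (x y z v : H) (a : R).

Lemma innerDr x y z : inner x (y + z) = inner x y + inner x z.
Proof. by rewrite innerC innerDl !(innerC x). Qed.

Lemma innerZr a x y : inner x (a *: y) = a * inner x y.
Proof. by rewrite innerC innerZl innerC. Qed.

Lemma inner0l x : inner 0 x = 0.
Proof. by rewrite -(scale0r 0) innerZl mul0r. Qed.

Lemma inner0r x : inner x 0 = 0.
Proof. by rewrite innerC inner0l. Qed.

Lemma innerNl x y : inner (- x) y = - inner x y.
Proof. by rewrite -scaleN1r innerZl mulN1r. Qed.

Lemma innerNr x y : inner x (- y) = - inner x y.
Proof. by rewrite innerC innerNl innerC. Qed.

Lemma innerBl x y z : inner (x - y) z = inner x z - inner y z.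
Proof. by rewrite innerDl innerNl. Qed.

Lemma innerBr x y z : inner x (y - z) = inner x y - inner x z.
Proof. by rewrite innerDr innerNr. Qed.

Lemma inner_suml (I : Type) (s : seq I) (Q : pred I) (F : I -> H) y :
  inner (\sum_(i <- s | Q i) F i) y = \sum_(i <- s | Q i) inner (F i) y.
Proof.
by apply: (big_morph (inner^~ y)) => [u v|]; rewrite ?innerDl ?inner0l.
Qed.

Lemma inner_eq x y : (forall v, inner x v = inner y v) -> x = y.
Proof.
move=> xy; apply/eqP; rewrite -subr_eq0 -normr_eq0 -sqrf_eq0 -innerxx innerBl.
by rewrite xy subrr.
Qed.

Lemma cauchy_schwarz x y : `|inner x y| <= `|x| * `|y|.
Proof.
have main u v : inner u v <= `|u| * `|v|.
  have [->|u0] := eqVneq u 0; first by rewrite inner0l mulr_ge0.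
  have [->|v0] := eqVneq v 0; first by rewrite inner0r mulr_ge0.
  have uv0 : 0 < `|u| * `|v| by rewrite mulr_gt0 ?normr_gt0.
  have := sqr_ge0 `| `|v| *: u - `|u| *: v|.
  rewrite -innerxx innerBl !innerBr !innerZl !innerZr !innerxx (innerC v u) => h.
  rewrite -subr_ge0 -(pmulr_rge0 _ uv0).
  by move: h; rewrite !expr2; lra.
rewrite ler_norml main andbT lerNl -innerNl (le_trans (main _ _))//.
by rewrite normrN.
Qed.

Lemma norm_tensor (H' : hilbertType R) x y (z : H') :
  `|tensor z y x| <= `|z| * `|y| * `|x|.
Proof. by rewrite normrZ mulrC -mulrA ler_wpM2l// cauchy_schwarz. Qed.

End inner_theory.

Lemma separable_sequence (R : realType) (H : hilbertType R) : separable H ->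
  exists q : nat -> H, forall x (e : R), 0 < e -> exists n, `|x - q n| < e.
Proof.
move=> [D cD dD]; have /pfcard_geP[D0|/unsquash f] := cD.
  have [//|x []] := dD setT _ openT; first by exists 0.
  by rewrite D0.
exists f => x e e0.
have [|y [/= xy Dy]] := dD (ball x e) _ (ball_open x e).
  by exists x; exact: ballxx.
have [n _ fn] := @surj _ _ _ _ f y Dy.
by exists n; move: xy; rewrite -ball_normE /= -fn.
Qed.

Section borel_measurability.
Context d (T : measurableType d) (R : realType).

Lemma measurable_open (U : ptopologicalType) (A : set (borel U)) :
  @open U A -> measurable A.
Proof. exact: sub_sigma_algebra. Qed.

Lemma continuous_borel_measurable (U V : ptopologicalType) (f : U -> V) :
  continuous f -> measurable_fun [set: borel U] (f : borel U -> borel V).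
Proof.
move=> cf; apply: (@measurability _ _ (borel U) (borel V) setT f (@open V)) => // _ [A oA <-].
by rewrite setTI; by apply: measurable_open; move/continuousP : cf; exact.
Qed.

Lemma continuous_realfun_measurable (U : ptopologicalType) (f : U -> R) :
  continuous f -> measurable_fun [set: borel U] (f : borel U -> R).
Proof.
move=> cf; apply: (measurability _ (RGenOInfty.measurableE R)) => // _ [_ [x ->] <-].
rewrite setTI; apply: measurable_open; move/continuousP : cf; apply.
exact: interval_open.
Qed.

Section nearest.
Context (H : hilbertType R) (q : nat -> H).
Hypothesis qd : forall x (e : R), 0 < e -> exists n, `|x - q n| < e.

(* A point of [{0, q 0, ..., q (n - 1)}] closest to x: since 0 is a candidate,
   these simple approximations are dominated, see [nearest_norm]. *)
Fixpoint nearest (n : nat) (x : H) : H :=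
  if n is n'.+1 then
    if `|x - q n'| < `|x - nearest n' x| then q n' else nearest n' x
  else 0.

Lemma nearestS_le n x : `|x - nearest n.+1 x| <= `|x - nearest n x|.
Proof. by rewrite /=; case: ifP => // /ltW. Qed.

Lemma nearest_dist n x : `|x - nearest n x| <= `|x|.
Proof.
elim: n => [|n ih]; first by rewrite /= subr0.
exact: le_trans (nearestS_le n x) ih.
Qed.

Lemma nearest_norm n x : `|nearest n x| <= 2 * `|x|.
Proof.
have -> : nearest n x = x - (x - nearest n x) by rewrite opprB addrC subrK.
by rewrite (le_trans (ler_normB _ _))// mulr_natl mulr2n lerD2l nearest_dist.
Qed.

(** The distance to the chosen point never increases, and it falls below e as soon as a point of the
    sequence within e of x becomes a candidate. *)
Lemma nearest_cvg x : nearest n x @[n --> \oo] --> x.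
Proof.
apply/cvgrPdist_lt => /= e e0; have [n0 hn0] := qd x e0.
exists n0.+1 => // n /= /subnKC <-.
elim: (n - n0.+1)%N => [|k ih]; last first.
  by rewrite addnS; exact: le_lt_trans (nearestS_le _ x) ih.
rewrite addn0 /=; case: ifP => // /negbT; rewrite -leNgt => h.
exact: le_lt_trans hn0.
Qed.

Lemma finite_range_nearest (f : T -> H) n : finite_set (range (fun x => nearest n (f x))).
Proof.
elim: n => [|n ih].
  by apply: (@sub_finite_set _ _ [set 0]) => // _ [x _ <-].
apply: (@sub_finite_set _ _ ([set q n] `|` range (fun x => nearest n (f x)))).
  by move=> _ [x _ <-] /=; case: ifP => _; [left|right; exists x].
by rewrite finite_setU; split.
Qed.

Lemma measurable_dist_cst (f : T -> H) y :
  measurable_fun setT (f : T -> borel H) -> measurable_fun setT (fun x => `|f x - y|).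
Proof.
move=> mf; apply: (@measurableT_comp _ _ _ _ _ _ (fun x : borel H => `|x - y|)) mf.
apply: continuous_realfun_measurable => x.
by apply: cvg_norm; apply: cvgB; [exact: cvg_id|exact: cvg_cst].
Qed.

Lemma measurable_dist_nearest (f : T -> H) n :
  measurable_fun setT (f : T -> borel H) ->
  measurable_fun setT (fun x => `|f x - nearest n (f x)|).
Proof.
move=> mf; elim: n => [|n ih]; first exact: measurable_dist_cst.
have -> : (fun x => `|f x - nearest n.+1 (f x)|) =
    (fun x => if `|f x - q n| < `|f x - nearest n (f x)| then `|f x - q n|
              else `|f x - nearest n (f x)|).
  by apply/funext => x /=; case: ifP.
by apply: measurable_fun_ifT => //; [apply: measurable_fun_ltr => //|];
  exact: measurable_dist_cst.
Qed.

(** Only finitely many values y can occur, and they are selected by comparing measurable distances;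
    measurability of [phi ^~ y] for each frozen y is therefore enough. *)
Lemma measurable_nearest_comp d' (S : measurableType d') (phi : T -> H -> S) (f : T -> H) n :
  measurable_fun setT (f : T -> borel H) ->
  (forall y, measurable_fun setT (phi ^~ y)) ->
  measurable_fun setT (fun x => phi x (nearest n (f x))).
Proof.
move=> mf mphi; elim: n => [|n ih]; first exact: mphi.
have -> : (fun x => phi x (nearest n.+1 (f x))) =
    (fun x => if `|f x - q n| < `|f x - nearest n (f x)| then phi x (q n)
              else phi x (nearest n (f x))).
  by apply/funext => x /=; case: ifP.
apply: measurable_fun_ifT => //; apply: measurable_fun_ltr.
  exact: measurable_dist_cst.
exact: measurable_dist_nearest.
Qed.

End nearest.

(** The function is the limit of [phi x (nearest q n (f x))], by continuity of [phi x]. This makes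
    sums and inner products of two measurable maps measurable without comparing the Borel sets of a
    product with the product sigma-algebra. *)
Lemma caratheodory_real (H : hilbertType R) (phi : T -> H -> R) (f : T -> H) :
  separable H -> measurable_fun setT (f : T -> borel H) ->
  (forall y, measurable_fun setT (phi ^~ y)) -> (forall x, continuous (phi x)) ->
  measurable_fun setT (fun x => phi x (f x)).
Proof.
move=> /separable_sequence[q qd] mf mphi cphi.
apply: (@measurable_fun_cvg _ _ _ _ (fun n x => phi x (nearest q n (f x)))).
  by move=> n; exact: measurable_nearest_comp.
move=> x _; apply: (@cvg_comp _ _ _ (fun n => nearest q n (f x)) (phi x)).
  exact: nearest_cvg.
exact: cphi.
Qed.

(** By separability an open set is a countable union of balls around the points [q n] with radii
    [k.+1%:R^-1], and the preimage of a ball is a condition on a distance. *)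
Lemma measurable_borelP (H : hilbertType R) (f : T -> H) : separable H ->
  (forall y, measurable_fun setT (fun x => `|f x - y|)) ->
  measurable_fun setT (f : T -> borel H).
Proof.
move=> /separable_sequence[q qd] mf.
apply: (@measurability _ _ T (borel H) setT f (@open H)) => // _ [A oA <-]; rewrite setTI.
pose J n := [set k : nat | ball (q n) (k.+1%:R^-1) `<=` A].
have -> : f @^-1` A = \bigcup_n \bigcup_(k in J n) [set x | `|f x - q n| < k.+1%:R^-1].
  apply/seteqP; split => [x /= Afx|x [n _ [k /= kA fp]]]; last first.
    by apply: kA; rewrite -ball_normE /= distrC.
  have := oA; rewrite openE => /(_ _ Afx) /nbhs_ballP[e /= e0 eA].
  (* With a radius below e/2, the ball around [q n] contains [f x] and stays in [ball (f x) e]. *)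
  have e20 : 0 < e / 2 by rewrite divr_gt0.
  pose N := Num.truncn (e / 2)^-1.
  have Ne : N.+1%:R^-1 < e / 2 by rewrite invf_plt ?posrE// truncnS_gt.
  have [n hn] := @qd (f x) N.+1%:R^-1 (ltac:(by rewrite invr_gt0)).
  exists n => //; exists N => //= y; rewrite -ball_normE /= => yn.
  apply: eA; rewrite -ball_normE /=.
  rewrite -(subrK (q n) (f x)) -addrA (le_lt_trans (ler_normD _ _))//.
  by rewrite (splitr e) ltrD// (lt_trans _ Ne).
apply: bigcup_measurable => n _; apply: bigcup_measurable => k _.
have m := @measurable_fun_ltr _ _ _ _ _ (cst k.+1%:R^-1) (mf (q n)) (measurable_cst _).
by have := m measurableT [set true] I; rewrite setTI.
Qed.

Lemma caratheodory_hilbert (H H' : hilbertType R) (phi : T -> H -> H') (f : T -> H) :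
  separable H -> separable H' -> measurable_fun setT (f : T -> borel H) ->
  (forall y, measurable_fun setT (phi ^~ y : T -> borel H')) ->
  (forall x, continuous (phi x)) ->
  measurable_fun setT (fun x => phi x (f x) : borel H').
Proof.
move=> sH sH' mf mphi cphi; apply: measurable_borelP => // y.
apply: (@caratheodory_real _ (fun x z => `|phi x z - y|)) => // [z|x z].
  exact: measurable_dist_cst.
by apply: cvg_norm; apply: cvgB; [exact: cphi|exact: cvg_cst].
Qed.

Section hilbert_measurable.
Context (H : hilbertType R) (sH : separable H).
Implicit Types f g : T -> H.

Lemma measurable_hilbertD f g :
  measurable_fun setT (f : T -> borel H) -> measurable_fun setT (g : T -> borel H) ->
  measurable_fun setT (fun x => f x + g x : borel H).
Proof.
move=> mf mg; apply: (@caratheodory_hilbert _ _ (fun x z => f x + z)) => // [y|x y].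
  apply: (@measurableT_comp _ _ _ _ _ _ (fun z : borel H => z + y : borel H)) mf.
  by apply: continuous_borel_measurable => z; apply: cvgD; [exact: cvg_id|exact: cvg_cst].
by apply: cvgD; [exact: cvg_cst|exact: cvg_id].
Qed.

Lemma measurable_hilbertZ (r : T -> R) f :
  measurable_fun setT r -> measurable_fun setT (f : T -> borel H) ->
  measurable_fun setT (fun x => r x *: f x : borel H).
Proof.
move=> mr mf; apply: (@caratheodory_hilbert _ _ (fun x z => r x *: z)) => // [y|x y].
  apply: measurable_borelP => // z.
  apply: (@measurableT_comp _ _ _ _ _ _ (fun t : R => `|t *: y - z|)) mr.
  apply: continuous_measurable_fun => t.
  apply: cvg_norm; apply: cvgB; last exact: cvg_cst.
  exact: cvgZl.
by apply: cvgZr; exact: cvg_id.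
Qed.

Lemma measurable_hilbertB f g :
  measurable_fun setT (f : T -> borel H) -> measurable_fun setT (g : T -> borel H) ->
  measurable_fun setT (fun x => f x - g x : borel H).
Proof.
move=> mf mg; apply: measurable_hilbertD => //.
rewrite (_ : (fun x => - g x) = (fun x => -1 *: g x)).
  exact: measurable_hilbertZ.
by apply/funext => x; rewrite scaleN1r.
Qed.

Lemma measurable_hilbert_norm f :
  measurable_fun setT (f : T -> borel H) -> measurable_fun setT (fun x => `|f x|).
Proof.
move=> mf; rewrite (_ : (fun x => _) = (fun x => `|f x - 0|)).
  exact: measurable_dist_cst.
by apply/funext => x; rewrite subr0.
Qed.

Lemma continuous_innerl (y : H) : continuous (fun x => inner x y).
Proof.
move=> x; apply/cvgrPdist_lt => /= e e0.
have y0 : 0 < `|y| + 1 by rewrite ltr_wpDl.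
near=> z; rewrite -innerBl (le_lt_trans (cauchy_schwarz _ _))//.
rewrite (@le_lt_trans _ _ (`|x - z| * (`|y| + 1)))// ?ler_wpM2l// ?lerDl//.
rewrite -ltr_pdivlMr//; near: z.
by apply: cvgr_dist_lt; [exact: cvg_id|rewrite divr_gt0].
Unshelve. all: by end_near. Qed.

Lemma measurable_hilbert_inner f g :
  measurable_fun setT (f : T -> borel H) -> measurable_fun setT (g : T -> borel H) ->
  measurable_fun setT (fun x => inner (f x) (g x)).
Proof.
move=> mf mg; apply: (@caratheodory_real _ (fun x z => inner (f x) z)) => // [y|x y].
  apply: (@measurableT_comp _ _ _ _ _ _ (fun z : borel H => inner z y)) mf.
  by apply: continuous_realfun_measurable; exact: continuous_innerl.
rewrite (_ : inner (f x) = (fun z => inner z (f x))); first exact: continuous_innerl.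
by apply/funext => z; rewrite innerC.
Qed.

End hilbert_measurable.

End borel_measurability.

(** * Bochner integral *)

(** [phi] is an arbitrary map into a module, so scalar, vector and operator valued functions of a
    simple function all reduce to the indicators of its fibres. *)
Lemma finite_range_decomposition (T : Type) (R : realType) (H : hilbertType R)
    (V : lmodType R) (s : T -> H) (phi : H -> V) x : finite_set (range s) ->
  phi (s x) = \sum_(y <- fset_set (range s)) (\1_(s @^-1` [set y]) x : R) *: phi y.
Proof.
move=> fs; rewrite (bigD1_seq (s x)) ?fset_uniq//=; last first.
  by rewrite in_fset_set// inE; exists x.
rewrite big1 ?addr0.
  by rewrite indicE mem_set//= scale1r.
by move=> y ysx; rewrite indicE memNset ?scale0r//= => syx; rewrite syx eqxx in ysx.
Qed.

Section bochner_theory.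
Context d (T : measurableType d) (R : realType) (H : hilbertType R).
Hypothesis sH : separable H.
Variable mu : {measure set T -> \bar R}.
Hypothesis muoo : (mu setT < +oo)%E.
Implicit Types (f s : T -> H) (y v : H).

Lemma finite_measure_fin_num A : measurable A -> mu A \is a fin_num.
Proof.
move=> mA; rewrite ge0_fin_numE// (le_lt_trans _ muoo)// le_measure// inE//.
Qed.

Lemma integrable_indic_fin A : measurable A -> mu.-integrable setT (EFin \o (\1_A : T -> R)).
Proof.
move=> mA; apply: (@bounded_measurable_integrable _ _ _ _ _ 1) => //.
by move=> x; rewrite indicE; case: (_ \in _); rewrite ?normr1 ?normr0.
Qed.

Lemma Rintegral_indic A : measurable A -> \int[mu]_x (\1_A x : R) = fine (mu A).
Proof. by move=> mA; rewrite /Rintegral integral_indic// setIT. Qed.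

Lemma measurable_fiber s y : measurable_fun setT (s : T -> borel H) ->
  measurable (s @^-1` [set y]).
Proof.
move=> ms; have := measurable_dist_cst y ms measurableT (measurable_set1 0).
rewrite setTI; congr (measurable _); apply/seteqP; split => x /=.
  by move=> /eqP; rewrite normr_eq0 subr_eq0 => /eqP.
by move=> ->; rewrite subrr normr0.
Qed.

Lemma simple_comp_integrable s (phi : H -> R) :
  measurable_fun setT (s : T -> borel H) -> finite_set (range s) ->
  mu.-integrable setT (EFin \o (fun x => phi (s x))).
Proof.
move=> ms fs.
rewrite (_ : (fun x => phi (s x)) =
    (fun x => \sum_(y <- fset_set (range s)) phi y * \1_(s @^-1` [set y]) x)).
  apply: integrable_sumr => y; apply: integrable_EFinZl; apply: integrable_indic_fin.
  exact: measurable_fiber.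
apply/funext => x; rewrite (@finite_range_decomposition _ _ _ R^o s phi x fs).
by apply: eq_bigr => y _; rewrite mulrC.
Qed.

Lemma simple_comp_Rintegral s (phi : H -> R) :
  measurable_fun setT (s : T -> borel H) -> finite_set (range s) ->
  \int[mu]_x phi (s x) =
  \sum_(y <- fset_set (range s)) fine (mu (s @^-1` [set y])) * phi y.
Proof.
move=> ms fs.
transitivity (\int[mu]_x (\sum_(y <- fset_set (range s)) phi y * \1_(s @^-1` [set y]) x)).
  apply: eq_Rintegral => x _; rewrite (@finite_range_decomposition _ _ _ R^o s phi x fs).
  by apply: eq_bigr => y _; rewrite mulrC.
have mfib y := measurable_fiber y ms.
rewrite Rintegral_sum; last by move=> y; apply: integrable_EFinZl; exact: integrable_indic_fin.
apply: eq_bigr => y _; rewrite RintegralZl//; last exact: integrable_indic_fin.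
by rewrite Rintegral_indic// mulrC.
Qed.

Lemma simple_integral_weak s v :
  measurable_fun setT (s : T -> borel H) -> finite_set (range s) ->
  inner (bochner_simple_integral mu s) v = \int[mu]_x inner (s x) v.
Proof.
move=> ms fs; rewrite (simple_comp_Rintegral (inner^~ v))//.
rewrite /bochner_simple_integral fsbig_finite// inner_suml.
by apply: eq_bigr => y _; rewrite innerZl.
Qed.

Lemma integrable_inner f v :
  measurable_fun setT (f : T -> borel H) ->
  mu.-integrable setT (EFin \o (fun x => `|f x|)) ->
  mu.-integrable setT (EFin \o (fun x => inner (f x) v)).
Proof.
move=> mf fi; apply: (le_integrable_EFin (g := fun x => `|v| * `|f x|)).
- exact: measurable_hilbert_inner.
- exact: integrable_EFinZl.
- by move=> x; rewrite (le_trans (cauchy_schwarz _ _))// mulrC.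
Qed.

Lemma integrable_norm_sub f g :
  measurable_fun setT (f : T -> borel H) -> measurable_fun setT (g : T -> borel H) ->
  mu.-integrable setT (EFin \o (fun x => `|f x|)) ->
  mu.-integrable setT (EFin \o (fun x => `|g x|)) ->
  mu.-integrable setT (EFin \o (fun x => `|f x - g x|)).
Proof.
move=> mf mg fi gi; apply: (le_integrable_EFin (g := fun x => `|f x| + `|g x|)).
- apply: measurable_hilbert_norm => //; exact: measurable_hilbertB.
- exact: integrable_EFinD.
- by move=> x; rewrite normr_id ler_normB.
Qed.

Lemma le_norm_Rintegral_inner f v :
  measurable_fun setT (f : T -> borel H) ->
  mu.-integrable setT (EFin \o (fun x => `|f x|)) ->
  `|\int[mu]_x inner (f x) v| <= `|v| * \int[mu]_x `|f x|.
Proof.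
move=> mf fi; have fvi := integrable_inner v mf fi.
rewrite (le_trans (le_normr_Rintegral measurableT fvi))//.
rewrite -RintegralZl//; apply: le_Rintegral => //.
- exact: integrable_norm.
- exact: integrable_EFinZl.
- by move=> x _; rewrite mulrC cauchy_schwarz.
Qed.

(** A single n with finite L1 distance to f suffices, since [s n] takes finitely many values on a
    space of finite measure. *)
Lemma bochner_integrable_norm f y : is_bochner_integral mu f y ->
  mu.-integrable setT (EFin \o (fun x => `|f x|)).
Proof.
move=> [mf [s [ss sf _]]].
have [n sn] : exists n, (\int[mu]_x (`|f x - s n x|)%:E < +oo)%E.
  have [n _ /(_ n (leqnn n)) /= h] := cvg_is_fine sf.
  by exists n; rewrite -ge0_fin_numE//; exact: integral_ge0.
have [ms fs _] := ss n.
have mB := measurable_hilbert_norm (measurable_hilbertB sH mf ms).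
apply: (le_integrable_EFin (g := fun x => `|f x - s n x| + `|s n x|)).
- exact: measurable_hilbert_norm.
- apply: integrable_EFinD; last exact: (simple_comp_integrable (fun z => `|z|)).
  apply/integrableP; split; first exact/measurable_EFinP.
  by under eq_integral do rewrite /= normr_id.
- by move=> x; rewrite normr_id -{1}(subrK (s n x) (f x)) ler_normD.
Qed.

(** The numbers [inner (bochner_simple_integral mu (s n)) v] converge to both sides: to the left one
    by continuity of the inner product, to the right one by the L1 convergence of [s n] to f. *)
Lemma bochner_weak f y v : is_bochner_integral mu f y ->
  inner y v = \int[mu]_x inner (f x) v.
Proof.
move=> bf; have fi := bochner_integrable_norm bf.
have [mf [s [ss sf sy]]] := bf.
have fsi n : mu.-integrable setT (EFin \o (fun x => `|f x - s n x|)).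
  have [ms fs _] := ss n; apply: integrable_norm_sub => //.
  exact: (simple_comp_integrable (fun z => `|z|)).
have D0 : `|v| * \int[mu]_x `|f x - s n x| @[n --> \oo] --> 0.
  rewrite -(mulr0 `|v|); apply: cvgMr.
  by apply: fine_cvg.
have l1 : inner (bochner_simple_integral mu (s n)) v @[n --> \oo] --> inner y v.
  apply: (@cvg_comp _ _ _ _ (fun x => inner x v)); first exact: sy.
  exact: continuous_innerl.
have l2 : inner (bochner_simple_integral mu (s n)) v @[n --> \oo] -->
    \int[mu]_x inner (f x) v.
  apply: cvg_dist_squeeze D0; apply: nearW => n; have [ms fs _] := ss n.
  rewrite simple_integral_weak// distrC -RintegralB//; last 2 first.
  - exact: integrable_inner.
  - exact: (simple_comp_integrable (inner^~ v)).
  rewrite (@eq_Rintegral _ _ _ mu setT (fun x => inner (f x - s n x) v)).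
    by apply: le_norm_Rintegral_inner => //; exact: measurable_hilbertB.
  by move=> x _; rewrite innerBl.
exact: cvg_unique l1 l2.
Qed.

Section nearest_approximation.
Variables (q : nat -> H) (f : T -> H).
Hypothesis qd : forall x (e : R), 0 < e -> exists n, `|x - q n| < e.
Hypothesis mf : measurable_fun setT (f : T -> borel H).

Lemma measurable_nearest n :
  measurable_fun setT (fun x => nearest q n (f x) : borel H).
Proof.
by apply: (@measurable_nearest_comp _ _ _ _ _ _ _ (fun _ z => z : borel H)).
Qed.

Lemma bochner_simple_nearest n : bochner_simple mu (fun x => nearest q n (f x)).
Proof.
split; [exact: measurable_nearest|exact: finite_range_nearest|].
rewrite -preimage_setC -ge0_fin_numE// finite_measure_fin_num//.
by apply: measurableC; apply: measurable_fiber; exact: measurable_nearest.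
Qed.

Lemma integrable_dist_nearest n :
  mu.-integrable setT (EFin \o (fun x => `|f x|)) ->
  mu.-integrable setT (EFin \o (fun x => `|f x - nearest q n (f x)|)).
Proof.
move=> fi; apply: le_integrable_EFin fi _; first exact: measurable_dist_nearest.
by move=> x; rewrite normr_id nearest_dist.
Qed.

Lemma nearest_L1_cvg : mu.-integrable setT (EFin \o (fun x => `|f x|)) ->
  \int[mu]_x `|f x - nearest q n (f x)| @[n --> \oo] --> 0.
Proof.
move=> fi; rewrite -(mul0r (fine (mu setT))) -(Rintegral_cst mu measurableT 0).
apply: Rintegral_dominated_cvg fi _ => //.
- by move=> n; exact: measurable_dist_nearest.
- move=> x; apply/cvgrPdist_lt => e e0.
  have /cvgrPdist_lt/(_ e e0) := @nearest_cvg _ _ _ qd (f x).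
  by apply: filterS => n; rewrite sub0r normrN normr_id.
- by move=> n x; rewrite normr_id nearest_dist.
Qed.

(** The integrals of the nearest-point approximations form a Cauchy sequence, and H is complete. *)
Lemma bochner_exists : mu.-integrable setT (EFin \o (fun x => `|f x|)) ->
  exists y, is_bochner_integral mu f y.
Proof.
move=> fi; pose s n x := nearest q n (f x).
have ss n : bochner_simple mu (s n) by exact: bochner_simple_nearest.
have isn n : mu.-integrable setT (EFin \o (fun x => `|s n x|)).
  have [ms fs _] := ss n; exact: (simple_comp_integrable (fun z => `|z|)).
have D0 := nearest_L1_cvg fi.
have ifs n := integrable_dist_nearest n fi.
pose I n := bochner_simple_integral mu (s n).
have Inm n m : `|I n - I m| <= \int[mu]_x `|f x - s n x| + \int[mu]_x `|f x - s m x|.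
  have [ms fs _] := ss n; have [ms' fs' _] := ss m.
  (* The difference is tested against itself, because the integrals of simple functions are known
     through their inner products. *)
  have [->|I0] := eqVneq (I n - I m) 0.
    by rewrite normr0 addr_ge0// Rintegral_ge0.
  have Ip : 0 < `|I n - I m| by rewrite normr_gt0.
  rewrite -(ler_pM2l Ip) -expr2 -innerxx innerBl !simple_integral_weak//.
  rewrite -RintegralB//; [|exact: (simple_comp_integrable (inner^~ _))..].
  rewrite (@eq_Rintegral _ _ _ mu setT (fun x => inner (s n x - s m x) (I n - I m))); last first.
    by move=> x _; rewrite innerBl.
  have iB := integrable_norm_sub ms ms' (isn n) (isn m).
  rewrite (le_trans (ler_norm _))// (le_trans (le_norm_Rintegral_inner _ _ iB))//.
    exact: measurable_hilbertB.
  rewrite ler_wpM2l//.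
  have -> : \int[mu]_x `|f x - s n x| + \int[mu]_x `|f x - s m x| =
      \int[mu]_x (`|f x - s n x| + `|f x - s m x|).
    by rewrite RintegralD//; exact: ifs.
  apply: le_Rintegral => //.
    by apply: integrable_EFinD; exact: ifs.
  move=> x _; rewrite [X in _ <= X + _]distrC.
  by rewrite (le_trans _ (ler_normD _ _))// addrA subrK.
have cI : cvgn I.
  apply: cauchy_cvg; apply: cauchy_exP => e e0.
  have e20 : 0 < e / 2 by rewrite divr_gt0.
  have /cvgrPdist_lt /(_ _ e20) [n0 _ hn0] := D0.
  exists (I n0), n0 => // n /= n0n; rewrite -ball_normE /=.
  have := hn0 n n0n; have := hn0 n0 (leqnn n0); rewrite /= !sub0r !normrN => h1 h2.
  rewrite (le_lt_trans (Inm n0 n))// (splitr e) ltrD//.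
    by rewrite (le_lt_trans (ler_norm _)).
  by rewrite (le_lt_trans (ler_norm _)).
exists (limn I); split => //; exists s; split => //.
rewrite (_ : (fun n => _) = EFin \o (fun n => \int[mu]_x `|f x - s n x|)).
  by apply: cvg_EFin => //; exact: nearW.
by apply/funext => n /=; rewrite /Rintegral fineK//; exact: integrable_fin_num (ifs n).
Qed.

End nearest_approximation.

(** This is the working form of the definition. For the converse an integral y' exists by
    [bochner_exists], and y = y' because both have the same inner product with every v. *)
Lemma is_bochnerP f y : is_bochner_integral mu f y <->
  [/\ measurable_fun setT (f : T -> borel H),
      mu.-integrable setT (EFin \o (fun x => `|f x|)) &
      forall v, inner y v = \int[mu]_x inner (f x) v].
Proof.
split=> [bf|[mf fi fy]].
  split; [by case: bf|exact: bochner_integrable_norm bf|].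
  by move=> v; exact: bochner_weak.
have [q qd] := separable_sequence sH.
have [y' by'] := bochner_exists qd mf fi.
suff -> : y = y' by [].
by apply: inner_eq => v; rewrite fy (bochner_weak v by').
Qed.

Lemma bochnerE f y : is_bochner_integral mu f y -> bochner mu f = y.
Proof.
move=> bf; apply: xget_unique => // y' by'.
by apply: inner_eq => v; rewrite (bochner_weak v by') (bochner_weak v bf).
Qed.

Lemma bochnerP f : measurable_fun setT (f : T -> borel H) ->
  mu.-integrable setT (EFin \o (fun x => `|f x|)) ->
  is_bochner_integral mu f (bochner mu f).
Proof.
move=> mf fi; have [q qd] := separable_sequence sH.
by have [y by_] := bochner_exists qd mf fi; rewrite (bochnerE by_).
Qed.

End bochner_theory.

Lemma lipschitz_continuous_fun (R : realType) (H : hilbertType R) (f : H -> R) :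
  (forall u v, `|f u - f v| <= `|u - v|) -> continuous f.
Proof.
move=> f1 x; apply/cvgrPdist_lt => r r0; apply/nbhs_ballP; exists r => //= y.
by rewrite -ball_normE /=; exact: le_lt_trans.
Qed.

Lemma lipschitz_integrable d (T : measurableType d) (R : realType)
    (mu : {measure set T -> \bar R}) (H : hilbertType R) (f : H -> R) (g : T -> H) :
  (mu setT < +oo)%E -> (forall u v, `|f u - f v| <= `|u - v|) ->
  measurable_fun setT (g : T -> borel H) ->
  mu.-integrable setT (EFin \o (fun x => `|g x|)) ->
  mu.-integrable setT (EFin \o (fun x => f (g x))).
Proof.
move=> muoo f1 mg ig; apply: (le_integrable_EFin (g := fun x => `|g x| + `|f 0|)).
- apply: (@measurableT_comp _ _ _ _ _ _ (f : borel H -> R)) mg.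
  exact: continuous_realfun_measurable (lipschitz_continuous_fun f1).
- by apply: integrable_EFinD => //; exact: integrable_cst_fin.
- move=> x; rewrite -{1}(subrK (f 0) (f (g x))) (le_trans (ler_normD _ _))//.
  by rewrite lerD2r (le_trans (f1 _ _))// subr0.
Qed.

(** The dominating sequence may depend on e. In the strong law below it belongs to one approximation
    index k, chosen so that the limit l of the bound is below e. *)
Lemma cvg0_approx (R : realType) (u : nat -> R) :
  (forall n, 0 <= u n) ->
  (forall e, 0 < e -> exists (a : nat -> R) (l : R),
    [/\ a n @[n --> \oo] --> l, l < e & \forall n \near \oo, u n <= a n]) ->
  u n @[n --> \oo] --> 0.
Proof.
move=> u0 ua; apply/cvgrPdist_lt => e e0; have [a [l [al le ua']]] := ua e e0.
have /cvgrPdist_lt /(_ (e - l)) := al; rewrite subr_gt0 => /(_ le).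
apply: filterS2 ua' => n un h; rewrite sub0r normrN ger0_norm//.
rewrite distrC in h; rewrite (le_lt_trans un)// -(subrK l (a n)) -ltrBrDr (le_lt_trans _ h)//.
exact: ler_norm.
Qed.

Lemma ae_all_seq d (T : measurableType d) (R : realType)
    (P : {measure set T -> \bar R}) (I : eqType) (s : seq I) (Q : I -> T -> Prop) :
  (forall i, {ae P, forall x, Q i x}) -> {ae P, forall x i, i \in s -> Q i x}.
Proof.
move=> aeQ; elim: s => [|a s ih]; first by apply: aeW.
apply: filterS2 (aeQ a) ih => x Qa Qs i; rewrite inE => /orP[/eqP ->//|]; exact: Qs.
Qed.

Lemma average_cst (R : realType) (V : lmodType R) n (v : V) : (0 < n)%N ->
  n%:R^-1 *: (\sum_(i < n) v) = v :> V.
Proof.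
move=> n0; rewrite sumr_const card_ord -[v *+ n]scaler_nat scalerA mulVf ?scale1r//.
by rewrite pnatr_eq0 -lt0n.
Qed.

Lemma norm_average_le (R : realType) (V : normedModType R) n (u : nat -> V) :
  `|n%:R^-1 *: \sum_(i < n) u i| <= n%:R^-1 * \sum_(i < n) `|u i|.
Proof.
by rewrite normrZ ger0_norm ?invr_ge0// ler_wpM2l ?invr_ge0// ler_norm_sum.
Qed.

Section bochner_algebra.
Context d (T : measurableType d) (R : realType) (H : hilbertType R).
Hypothesis sH : separable H.
Variable mu : {measure set T -> \bar R}.
Hypothesis muoo : (mu setT < +oo)%E.
Implicit Types (f g : T -> H).

(** Testing against y itself reduces this to [le_norm_Rintegral_inner]. *)
Lemma is_bochner_norm_le f y : is_bochner_integral mu f y ->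
  `|y| <= \int[mu]_x `|f x|.
Proof.
move=> /(is_bochnerP sH muoo)[mf fi fy].
have [->|y0] := eqVneq y 0; first by rewrite normr0 Rintegral_ge0.
have yp : 0 < `|y| by rewrite normr_gt0.
rewrite -(ler_pM2l yp) -expr2 -innerxx fy (le_trans (ler_norm _))//.
exact: le_norm_Rintegral_inner.
Qed.

Lemma is_bochnerD f g y z : is_bochner_integral mu f y -> is_bochner_integral mu g z ->
  is_bochner_integral mu (fun x => f x + g x) (y + z).
Proof.
move=> /(is_bochnerP sH muoo)[mf fi fy] /(is_bochnerP sH muoo)[mg gi gz].
apply/is_bochnerP => //; split; first exact: measurable_hilbertD.
- apply: (le_integrable_EFin (g := fun x => `|f x| + `|g x|)).
  + by apply: measurable_hilbert_norm; exact: measurable_hilbertD.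
  + exact: integrable_EFinD.
  + by move=> x; rewrite normr_id ler_normD.
- move=> v; rewrite innerDl fy gz -RintegralD//; [|exact: integrable_inner..].
  by apply: eq_Rintegral => x _; rewrite innerDl.
Qed.

Lemma is_bochnerZ (a : R) f y : is_bochner_integral mu f y ->
  is_bochner_integral mu (fun x => a *: f x) (a *: y).
Proof.
move=> /(is_bochnerP sH muoo)[mf fi fy]; apply/is_bochnerP => //; split.
- exact: measurable_hilbertZ.
- rewrite (_ : (fun x => _) = (fun x => `|a| * `|f x|)); first exact: integrable_EFinZl.
  by apply/funext => x; rewrite normrZ.
- move=> v; rewrite innerZl fy -RintegralZl//; last exact: integrable_inner.
  by apply: eq_Rintegral => x _; rewrite innerZl.
Qed.

Lemma is_bochnerB f g y z : is_bochner_integral mu f y -> is_bochner_integral mu g z ->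
  is_bochner_integral mu (fun x => f x - g x) (y - z).
Proof.
move=> bf /(is_bochnerZ (-1)); rewrite scaleN1r => /(is_bochnerD bf).
by congr is_bochner_integral; apply/funext => x; rewrite scaleN1r.
Qed.

Lemma is_bochner_cst (y : H) : fine (mu setT) = 1 -> is_bochner_integral mu (fun=> y) y.
Proof.
move=> mu1; apply/is_bochnerP => //; split => //.
  by apply: (@bounded_measurable_integrable _ _ _ _ _ `|y|) => // x; rewrite normr_id.
by move=> v; rewrite Rintegral_cst// mu1 mulr1.
Qed.

End bochner_algebra.

Lemma is_bochner_law d d' (T : measurableType d) (E : measurableType d') (R : realType)
    (P : {measure set T -> \bar R}) (mu : {measure set E -> \bar R}) (X : T -> E)
    (H : hilbertType R) (f : E -> H) (y : H) :
  separable H -> (P setT < +oo)%E -> (mu setT < +oo)%E ->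
  measurable_fun setT X -> (forall A, measurable A -> P (X @^-1` A) = mu A) ->
  is_bochner_integral mu f y -> is_bochner_integral P (f \o X) y.
Proof.
move=> sH Poo muoo mX law /(is_bochnerP sH muoo)[mf fi fy].
apply/is_bochnerP => //; split.
- exact: measurableT_comp mf mX.
- exact: law_integrable fi.
- move=> v; rewrite fy -(law_Rintegral mX law)//; exact: integrable_inner.
Qed.

(** * Square integrable maps *)

Section square_integrable.
Context d (T : measurableType d) (R : realType) (mu : {measure set T -> \bar R}).
Hypothesis muoo : (mu setT < +oo)%E.

Definition square_integrable (H : hilbertType R) (f : T -> H) :=
  measurable_fun setT (f : T -> borel H) /\
  mu.-integrable setT (EFin \o (fun x => `|f x| ^+ 2)).

Lemma square_integrable_norm (H : hilbertType R) (f : T -> H) :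
  square_integrable f -> mu.-integrable setT (EFin \o (fun x => `|f x|)).
Proof.
move=> [mf f2]; apply: (le_integrable_EFin (g := fun x => 1 + `|f x| ^+ 2)).
- exact: measurable_hilbert_norm.
- by apply: integrable_EFinD => //; exact: integrable_cst_fin.
- move=> x; rewrite normr_id; have := sqr_ge0 (`|f x| - 1); rewrite sqrrB1 mulr2n.
  by have := sqr_ge0 `|f x|; lra.
Qed.

Lemma integrable_mul_norm (H H' : hilbertType R) (f : T -> H) (g : T -> H') :
  square_integrable f -> square_integrable g ->
  mu.-integrable setT (EFin \o (fun x => `|f x| * `|g x|)).
Proof.
move=> [mf f2] [mg g2]; apply: (le_integrable_EFin (g := fun x => `|f x| ^+ 2 + `|g x| ^+ 2)).
- by apply: measurable_funM; exact: measurable_hilbert_norm.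
- exact: integrable_EFinD.
- move=> x; rewrite ger0_norm ?mulr_ge0//.
  have := sqr_ge0 (`|f x| - `|g x|); rewrite sqrrB mulr2n.
  by have := mulr_ge0 (normr_ge0 (f x)) (normr_ge0 (g x)); lra.
Qed.

Lemma is_bochner_scalar (H : hilbertType R) (r : T -> R) (c : H) : separable H ->
  mu.-integrable setT (EFin \o r) ->
  is_bochner_integral mu (fun x => r x *: c) ((\int[mu]_x r x) *: c).
Proof.
move=> sH ir; have mr : measurable_fun setT r.
  by apply/measurable_EFinP; case/integrableP: ir.
have mrc : measurable_fun setT (fun x => r x *: c : borel H) by exact: measurable_hilbertZ.
apply/is_bochnerP => //; split => //.
  apply: (le_integrable_EFin (g := fun x => `|c| * `|r x|)).
  - exact: measurable_hilbert_norm.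
  - by apply: integrable_EFinZl; exact: integrable_norm.
  - by move=> x; rewrite normr_id normrZ mulrC.
move=> v; rewrite innerZl -RintegralZr//.
by apply: eq_Rintegral => x _; rewrite innerZl.
Qed.

Lemma is_bochner_tensor (H1 H2 : hilbertType R) (f : T -> H1) (g : T -> H2) v :
  separable H1 -> separable H2 -> square_integrable f -> square_integrable g ->
  is_bochner_integral mu (fun x => tensor (f x) (g x) v)
    (bochner mu (fun x => tensor (f x) (g x) v)).
Proof.
move=> s1 s2 sf sg; have [mf f2] := sf; have [mg g2] := sg.
have mt : measurable_fun setT (fun x => tensor (f x) (g x) v : borel H1).
  by apply: measurable_hilbertZ => //; exact: measurable_hilbert_inner.
apply: bochnerP => //; apply: (le_integrable_EFin (g := fun x => `|v| * (`|f x| * `|g x|))).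
- exact: measurable_hilbert_norm.
- by apply: integrable_EFinZl; exact: integrable_mul_norm.
- by move=> x; rewrite normr_id mulrC; exact: norm_tensor.
Qed.

End square_integrable.

Lemma square_integrableD d (T : measurableType d) (R : realType)
    (mu : {measure set T -> \bar R}) (H : hilbertType R) (f g : T -> H) : separable H ->
  square_integrable mu f -> square_integrable mu g ->
  square_integrable mu (fun x => f x + g x).
Proof.
move=> sH [mf f2] [mg g2]; have mfg := measurable_hilbertD sH mf mg.
split=> //; apply: (le_integrable_EFin (g := fun x => 2 * (`|f x| ^+ 2 + `|g x| ^+ 2))).
- by apply: measurable_funX; exact: measurable_hilbert_norm.
- by apply: integrable_EFinZl; exact: integrable_EFinD.
- move=> x; rewrite ger0_norm ?sqr_ge0//.
  rewrite (@le_trans _ _ ((`|f x| + `|g x|) ^+ 2))//.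
    by rewrite lerXn2r ?nnegrE ?addr_ge0// ler_normD.
  have := sqr_ge0 (`|f x| - `|g x|); rewrite sqrrB sqrrD !mulr2n; lra.
Qed.

Lemma square_integrable_le d (T : measurableType d) (R : realType)
    (mu : {measure set T -> \bar R}) (H H' : hilbertType R) (f : T -> H) (g : T -> H')
    (L : R) : square_integrable mu g -> measurable_fun setT (f : T -> borel H) ->
  (forall x, `|f x| <= L * `|g x|) -> square_integrable mu f.
Proof.
move=> [mg g2] mf fg; split => //.
apply: (le_integrable_EFin (g := fun x => L ^+ 2 * `|g x| ^+ 2)).
- by apply: measurable_funX; exact: measurable_hilbert_norm.
- exact: integrable_EFinZl.
- move=> x; rewrite ger0_norm ?sqr_ge0// -exprMn lerXn2r ?nnegrE//.
  exact: le_trans (normr_ge0 _) (fg x).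
Qed.

Lemma square_integrable_cst d (T : measurableType d) (R : realType)
    (mu : {measure set T -> \bar R}) (H : hilbertType R) (c : H) :
  (mu setT < +oo)%E -> square_integrable mu (fun=> c).
Proof. by move=> muoo; split => //; exact: integrable_cst_fin. Qed.

Lemma square_integrable_law dT dE (T : measurableType dT) (E : measurableType dE)
    (R : realType) (P : {measure set T -> \bar R}) (m : {measure set E -> \bar R})
    (X : T -> E) (H : hilbertType R) (f : E -> H) :
  measurable_fun setT X -> (forall A, measurable A -> P (X @^-1` A) = m A) ->
  square_integrable m f -> square_integrable P (f \o X).
Proof.
move=> mX law [mf f2]; split; first exact: measurableT_comp mf mX.
exact: law_integrable mX law _ f2.
Qed.

Lemma square_integrable_moment dT (T : measurableType dT) (R : realType)
    (mu : {measure set T -> \bar R}) (H : hilbertType R) (f : T -> H) :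
  measurable_fun setT (f : T -> borel H) ->
  (\int[mu]_x (`|f x| ^+ 2)%:E < +oo)%E -> square_integrable mu f.
Proof.
move=> mf foo; split => //; apply/integrableP; split.
  by apply/measurable_EFinP; apply: measurable_funX; exact: measurable_hilbert_norm.
rewrite (eq_integral (fun x => (`|f x| ^+ 2)%:E)) // => x _.
by rewrite /= ger0_norm ?sqr_ge0.
Qed.

(** * Laws of large numbers in Hilbert spaces *)

Section vector_slln.
Context d d' (Omega : measurableType d) (E : measurableType d') (R : realType).
Variables (P : probability Omega R) (m : probability E R).
Variable xi : nat -> Omega -> E.
Hypothesis law : forall j, has_law P (xi j) m.
Hypothesis ind : mutually_independent P xi.
Context (H : hilbertType R) (sH : separable H).

Let m1 : (m setT < +oo)%E.
Proof. by rewrite [X in (X < _)%E](@probability_setT _ _ _ m) ltry. Qed.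

Definition frequency (A : set E) n w : R := n%:R^-1 * \sum_(i < n) \1_A (xi i w).

Lemma frequency_cvg A : measurable A ->
  {ae P, forall w, frequency A n w @[n --> \oo] --> fine (m A)}.
Proof.
move=> mA; rewrite -Rintegral_indic//; apply: (slln_nonneg law ind) => //.
exact: integrable_indic_fin.
Qed.

Section simple.
Variable s : E -> H.
Hypotheses (ms : measurable_fun setT (s : E -> borel H)) (fs : finite_set (range s)).

(** One quantity for a whole class: it bounds the error of the averages of [phi \o s] for every phi
    whose norm is at most [omega] on the values of s. The uniform statements below come from taking
    [omega] independent of phi. *)
Definition frequency_error (omega : H -> R) n w : R :=
  \sum_(y <- fset_set (range s))
    `|frequency (s @^-1` [set y]) n w - fine (m (s @^-1` [set y]))| * omega y.

Lemma frequency_error_cvg0 omega :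
  {ae P, forall w, frequency_error omega n w @[n --> \oo] --> 0}.
Proof.
have := ae_all_seq (fset_set (range s)) (fun y => frequency_cvg (measurable_fiber y ms)).
apply: filterS => w; rewrite /frequency_error.
have aux (t : seq H) : (forall y, y \in t ->
    frequency (s @^-1` [set y]) n w @[n --> \oo] --> fine (m (s @^-1` [set y]))) ->
  \sum_(y <- t) `|frequency (s @^-1` [set y]) n w - fine (m (s @^-1` [set y]))| * omega y
    @[n --> \oo] --> 0; last exact: aux.
elim: t => [|a t ih] hw.
  by under eq_fun do rewrite big_nil; exact: cvg_cst.
have C1 : `|frequency (s @^-1` [set a]) n w - fine (m (s @^-1` [set a]))| * omega a
    @[n --> \oo] --> 0.
  rewrite -(mul0r (omega a)); apply: cvgMl.
  by apply/norm_cvg0P/subr_cvg0; exact/hw/mem_head.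
have ht y : y \in t -> y \in a :: t by rewrite inE => ->; rewrite orbT.
have := cvgD C1 (ih (fun y yt => hw y (ht y yt))); rewrite addr0 => C.
by apply: near_eq_cvgn (C _); apply: nearW => n; rewrite big_cons.
Qed.

Lemma simple_averageE (V : lmodType R) (phi : H -> V) n w :
  n%:R^-1 *: (\sum_(i < n) phi (s (xi i w))) =
  \sum_(y <- fset_set (range s)) frequency (s @^-1` [set y]) n w *: phi y.
Proof.
rewrite (eq_bigr (fun i : 'I_n => \sum_(y <- fset_set (range s))
    (\1_(s @^-1` [set y]) (xi i w) : R) *: phi y)); last first.
  by move=> i _; exact: finite_range_decomposition.
rewrite exchange_big /= scaler_sumr; apply: eq_bigr => y _.
by rewrite /frequency -scaler_suml scalerA.
Qed.

Lemma simple_average_dist (V : normedModType R) (phi : H -> V) n w :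
  `|n%:R^-1 *: (\sum_(i < n) phi (s (xi i w)))
    - \sum_(y <- fset_set (range s)) fine (m (s @^-1` [set y])) *: phi y|
  <= frequency_error (fun y => `|phi y|) n w.
Proof.
rewrite simple_averageE.
rewrite -sumrB (le_trans (ler_norm_sum _ _ _))//.
by apply: ler_sum => y _; rewrite -scalerBl normrZ.
Qed.

End simple.

Variable h : E -> H.
Hypothesis mh : measurable_fun setT (h : E -> borel H).
Hypothesis ih : m.-integrable setT (EFin \o (fun x => `|h x|)).

(** Three errors are added: the mean distance from h to [s k], handled by the scalar law, the
    frequency error of [s k], and the distance between the two integrals. The limit of the first and
    the bound on the last are both D, which is below e/2 for a suitable k. *)
Lemma slln_hilbert :
  {ae P, forall w, n%:R^-1 *: (\sum_(i < n) h (xi i w)) @[n --> \oo] --> bochner m h}.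
Proof.
have [q qd] := separable_sequence sH.
pose s k x := nearest q k (h x).
have ms k : measurable_fun setT (s k : E -> borel H) by exact: measurable_nearest.
have fs k : finite_set (range (s k)) by exact: finite_range_nearest.
have isk k := integrable_dist_nearest q mh k ih.
have D0 := nearest_L1_cvg qd mh ih.
have A1 : {ae P, forall w k, n%:R^-1 * (\sum_(i < n) `|h (xi i w) - s k (xi i w)|)
    @[n --> \oo] --> \int[m]_x `|h x - s k x|}.
  apply/ae_foralln => k; apply: (slln_nonneg law ind (h := fun x => `|h x - s k x|)) => //.
    exact: measurable_dist_nearest.
  exact: isk.
have A2 : {ae P, forall w k, frequency_error (s k) (fun y => `|y|) n w @[n --> \oo] --> 0}.
  by apply/ae_foralln => k; exact: frequency_error_cvg0.
apply: filterS2 A1 A2 => w A1 A2.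
apply/subr_cvg0/norm_cvg0P; apply: cvg0_approx => // e e0.
have e20 : 0 < e / 2 by rewrite divr_gt0.
have /cvgrPdist_lt /(_ _ e20) [k _ /(_ k (leqnn k))] := D0.
rewrite /= sub0r normrN ger0_norm ?Rintegral_ge0// => De.
set D := \int[m]_x _ in De.
exists (fun n => n%:R^-1 * (\sum_(i < n) `|h (xi i w) - s k (xi i w)|)
  + (frequency_error (s k) (fun y => `|y|) n w + D)), (D + (0 + D)); split.
- by apply: cvgD (A1 k) _; apply: cvgD (A2 k) _; exact: cvg_cst.
- by rewrite add0r (splitr e) ltrD.
apply: nearW => n.
have bh := bochnerP sH m1 mh ih.
have bs : is_bochner_integral m (s k) (bochner_simple_integral m (s k)).
  apply/is_bochnerP => //; split => //.
    exact: (simple_comp_integrable m1 (fun z => `|z|)).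
  by move=> v; exact: simple_integral_weak.
have -> : n%:R^-1 *: (\sum_(i < n) h (xi i w)) - bochner m h =
  n%:R^-1 *: (\sum_(i < n) (h (xi i w) - s k (xi i w))) +
  ((n%:R^-1 *: (\sum_(i < n) s k (xi i w)) - bochner_simple_integral m (s k))
  + (bochner_simple_integral m (s k) - bochner m h)).
  by rewrite sumrB scalerBr !addrA !subrK.
rewrite (le_trans (ler_normD _ _))// lerD//; first
  exact: (norm_average_le n (fun i => h (xi i w) - s k (xi i w))).
rewrite (le_trans (ler_normD _ _))// lerD//.
  rewrite /bochner_simple_integral fsbig_finite//.
  exact: (simple_average_dist (fs k) id).
by rewrite distrC; exact: is_bochner_norm_le (is_bochnerB sH m1 bh bs).
Qed.

(** The dominating sequence is built before f is chosen: f enters only through the distance from h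
    to [s k] and through the growth of [f - f 0]. *)
Lemma slln_lipschitz : {ae P, forall w, forall e, 0 < e -> \forall n \near \oo,
  forall f : H -> R, (forall u v, `|f u - f v| <= `|u - v|) ->
  `|n%:R^-1 * (\sum_(i < n) f (h (xi i w))) - \int[m]_x f (h x)| <= e}.
Proof.
have [q qd] := separable_sequence sH.
pose s k x := nearest q k (h x).
have ms k : measurable_fun setT (s k : E -> borel H) by exact: measurable_nearest.
have fs k : finite_set (range (s k)) by exact: finite_range_nearest.
have isk k := integrable_dist_nearest q mh k ih.
have D0 := nearest_L1_cvg qd mh ih.
have A1 : {ae P, forall w k, n%:R^-1 * (\sum_(i < n) `|h (xi i w) - s k (xi i w)|)
    @[n --> \oo] --> \int[m]_x `|h x - s k x|}.
  apply/ae_foralln => k; apply: (slln_nonneg law ind (h := fun x => `|h x - s k x|)) => //.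
    exact: measurable_dist_nearest.
  exact: isk.
have A2 : {ae P, forall w k, frequency_error (s k) (fun y => `|y|) n w @[n --> \oo] --> 0}.
  by apply/ae_foralln => k; exact: frequency_error_cvg0.
apply: filterS2 A1 A2 => w A1 A2 e e0.
have e20 : 0 < e / 2 by rewrite divr_gt0.
have /cvgrPdist_lt /(_ _ e20) [k _ /(_ k (leqnn k))] := D0.
rewrite /= sub0r normrN ger0_norm ?Rintegral_ge0// => De.
set D := \int[m]_x _ in De.
pose a n := n%:R^-1 * (\sum_(i < n) `|h (xi i w) - s k (xi i w)|)
  + (frequency_error (s k) (fun y => `|y|) n w + D).
have aD : a n @[n --> \oo] --> D + (0 + D).
  by apply: cvgD (A1 k) _; apply: cvgD (A2 k) _; exact: cvg_cst.
have ae : \forall n \near \oo, a n <= e.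
  have De2 : D + (0 + D) < e by rewrite add0r (splitr e) ltrD.
  exact: cvgr_le aD _ De2.
apply: filterS2 (nbhs_infty_gt 0) ae => n n0 ane f f1.
rewrite (le_trans _ ane)// /a.
(* Subtracting [f 0] gives the weights [|y|] whatever f is. The constant cancels because the average
   of a constant over n > 0 terms is that constant. *)
pose g y := f y - f 0.
have gle y : `|g y| <= `|y| by rewrite (le_trans (f1 _ _))// subr0.
have ifg (v : E -> H) : measurable_fun setT (v : E -> borel H) ->
    m.-integrable setT (EFin \o (fun x => `|v x|)) ->
    m.-integrable setT (EFin \o (fun x => f (v x))).
  exact: lipschitz_integrable.
have isn : m.-integrable setT (EFin \o (fun x => `|s k x|)).
  exact: (simple_comp_integrable m1 (fun z => `|z|)).
have m1' : fine (m setT) = 1 by rewrite probability_setT.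
have gs : \int[m]_x g (s k x) = \int[m]_x f (s k x) - f 0.
  by rewrite RintegralB ?Rintegral_cst ?m1' ?mulr1//;
    [exact: ifg|exact: integrable_cst_fin].
have -> : n%:R^-1 * (\sum_(i < n) f (h (xi i w))) - \int[m]_x f (h x) =
  n%:R^-1 *: (\sum_(i < n) (f (h (xi i w)) - f (s k (xi i w))) : R^o) +
  ((n%:R^-1 *: (\sum_(i < n) g (s k (xi i w)) : R^o) - \int[m]_x g (s k x))
  + (\int[m]_x f (s k x) - \int[m]_x f (h x))).
  rewrite gs !sumrB !scalerBr (average_cst (f 0 : R^o) n0) /GRing.scale /=.
  by rewrite !addrA subrK opprB; lra.
rewrite (le_trans (ler_normD _ _))// lerD//.
  rewrite (le_trans (norm_average_le _ (fun i => f (h (xi i w)) - f (s k (xi i w)) : R^o)))//.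
  by rewrite ler_wpM2l ?invr_ge0// ler_sum.
rewrite (le_trans (ler_normD _ _))// lerD//.
  rewrite simple_comp_Rintegral//.
  rewrite (le_trans (simple_average_dist (fs k) (g : H -> R^o) n w))//.
  by apply: ler_sum => y _; rewrite ler_wpM2l.
rewrite -RintegralB//; [|exact: ifg..].
rewrite (le_trans (le_normr_Rintegral _ _))//.
  by apply: integrable_EFinB; exact: ifg.
apply: le_Rintegral => //.
  by apply: integrable_norm; apply: integrable_EFinB; exact: ifg.
by move=> x _; rewrite distrC.
Qed.

End vector_slln.

(** * Hilbert-Schmidt estimates on finite orthonormal families *)

Section finite_hilbert_schmidt.
Context (R : realType) (H H' : hilbertType R).
Implicit Types (A : H -> H') (B : seq H).

Lemma sum_cauchy_schwarz (I : Type) (s : seq I) (a b : I -> R) :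
  \sum_(i <- s) a i * b i <=
  Num.sqrt (\sum_(i <- s) a i ^+ 2) * Num.sqrt (\sum_(i <- s) b i ^+ 2).
Proof.
set x := Num.sqrt _; set y := Num.sqrt _.
have x2 : x ^+ 2 = \sum_(i <- s) a i ^+ 2.
  by rewrite sqr_sqrtr// sumr_ge0// => i _; exact: sqr_ge0.
have y2 : y ^+ 2 = \sum_(i <- s) b i ^+ 2.
  by rewrite sqr_sqrtr// sumr_ge0// => i _; exact: sqr_ge0.
have x0 : 0 <= x by exact: sqrtr_ge0.
have y0 : 0 <= y by exact: sqrtr_ge0.
(* AM-GM with weights: [2 a b <= t a^2 + t^-1 b^2] *)
have amgm t : 0 < t -> 2 * \sum_(i <- s) a i * b i <= t * x ^+ 2 + t^-1 * y ^+ 2.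
  move=> t0; rewrite x2 y2 !mulr_sumr -big_split /=; apply: ler_sum => i _.
  rewrite -subr_ge0 (_ : _ - _ = t^-1 * (t * a i - b i) ^+ 2).
    by rewrite mulr_ge0 ?invr_ge0 ?sqr_ge0// ltW.
  by field; rewrite gt_eqF.
apply/ler_addgt0Pr => e e0.
have [xy|] := ltP 0 (x * y).
  have xp : 0 < x by rewrite lt_def x0 andbT; apply: contraTneq xy => ->; rewrite mul0r ltxx.
  have yp : 0 < y by rewrite lt_def y0 andbT; apply: contraTneq xy => ->; rewrite mulr0 ltxx.
  (* This t makes both terms of the bound equal to [x * y]. *)
  have := amgm (y / x) (divr_gt0 yp xp).
  rewrite (_ : _ + _ = 2 * (x * y)); first by lra.
  by field; rewrite !gt_eqF.
have xy0 : 0 <= x * y by exact: mulr_ge0.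
move=> xyle; have /eqP : x * y == 0 by rewrite eq_le xyle xy0.
move=> /eqP; rewrite mulf_eq0 => /orP[]/eqP z0; rewrite z0 ?mul0r ?mulr0 add0r.
  (* One factor vanishes and there may be no optimal t. For x = 0 it is taken so large, and for y =
     0 so small, that the remaining term is at most e. *)
  have t0 : 0 < (y ^+ 2 + 1) / e by rewrite divr_gt0// ltr_wpDl// sqr_ge0.
  have := amgm _ t0; rewrite z0 expr0n/= mulr0 add0r invf_div.
  have : e / (y ^+ 2 + 1) * y ^+ 2 <= e.
    by rewrite mulrAC ler_pdivrMr ?ltr_wpDl ?sqr_ge0// ler_pM2l// lerDl.
  lra.
have t0 : 0 < e / (x ^+ 2 + 1) by rewrite divr_gt0// ltr_wpDl// sqr_ge0.
have := amgm _ t0; rewrite z0 expr0n/= mulr0 addr0.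
have : e / (x ^+ 2 + 1) * x ^+ 2 <= e.
  by rewrite mulrAC ler_pdivrMr ?ltr_wpDl ?sqr_ge0// ler_pM2l// lerDl.
lra.
Qed.

(* For orthonormal B, the Hilbert-Schmidt norm of the restriction of A to the
   span of B; bounding it uniformly in B bounds [hs_norm A]. *)
Definition hs_on B A : R := Num.sqrt (\sum_(e <- B) `|A e| ^+ 2).

Lemma hs_on_ge0 B A : 0 <= hs_on B A. Proof. exact: sqrtr_ge0. Qed.

Lemma hs_on_sqr B A : hs_on B A ^+ 2 = \sum_(e <- B) `|A e| ^+ 2.
Proof. by rewrite sqr_sqrtr// sumr_ge0// => e _; exact: sqr_ge0. Qed.

Lemma hs_onD B A A' : hs_on B (A + A') <= hs_on B A + hs_on B A'.
Proof.
rewrite -(@ler_pXn2r _ 2) ?nnegrE ?addr_ge0 ?hs_on_ge0// sqrrD !hs_on_sqr.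
have := sum_cauchy_schwarz B (fun e => `|A e|) (fun e => `|A' e|).
rewrite -/(hs_on B A) -/(hs_on B A') => cs.
rewrite (@le_trans _ _ (\sum_(e <- B) (`|A e| + `|A' e|) ^+ 2))//.
  apply: ler_sum => e _; rewrite lerXn2r ?nnegrE ?addr_ge0//; exact: ler_normD.
under eq_bigr do rewrite sqrrD.
rewrite !big_split /= lerD2r lerD2l mulr2n; move: cs; lra.
Qed.

Lemma hs_onZ B (a : R) A : hs_on B (a *: A) = `|a| * hs_on B A.
Proof.
rewrite /hs_on -(sqrtr_sqr a) -sqrtrM ?sqr_ge0// mulr_sumr; congr Num.sqrt.
by apply: eq_bigr => e _; rewrite normrZ exprMn real_normK ?num_real.
Qed.

Lemma hs_on0 B : hs_on B (0 : H -> H') = 0.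
Proof. by rewrite /hs_on big1 ?sqrtr0// => e _; rewrite normr0 expr0n. Qed.

Lemma hs_on_sum B (I : Type) (s : seq I) (F : I -> H -> H') :
  hs_on B (\sum_(i <- s) F i) <= \sum_(i <- s) hs_on B (F i).
Proof.
elim: s => [|i s ih]; first by rewrite !big_nil hs_on0.
by rewrite !big_cons (le_trans (hs_onD _ _ _))// lerD2l.
Qed.

Definition orthonormal_seq B :=
  uniq B /\ forall e f, e \in B -> f \in B -> inner e f = (e == f)%:R.

(** z is the orthogonal projection of y onto the span of B, and the square of [|y - z|] is
    nonnegative. *)
Lemma bessel B (y : H) : orthonormal_seq B ->
  \sum_(e <- B) inner y e ^+ 2 <= `|y| ^+ 2.
Proof.
move=> [uB oB]; pose z := \sum_(e <- B) inner y e *: e.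
have zy : inner z y = \sum_(e <- B) inner y e ^+ 2.
  by rewrite inner_suml; apply: eq_bigr => e _; rewrite innerZl innerC expr2.
have zz : `|z| ^+ 2 = \sum_(e <- B) inner y e ^+ 2.
  rewrite -innerxx {1}/z inner_suml big_seq [RHS]big_seq.
  apply: eq_bigr => e eB; rewrite innerZl (innerC e z) {1}/z inner_suml.
  rewrite (bigD1_seq e)//= innerZl (oB e e eB eB) eqxx mulr1 big_seq_cond big1 ?addr0 ?expr2//.
  by move=> f /andP[fB fe]; rewrite innerZl (oB f e fB eB) (negbTE fe) mulr0.
have := sqr_ge0 `|y - z|; rewrite -innerxx innerBl !innerBr (innerC y z) !innerxx zz zy.
lra.
Qed.

Lemma hs_on_tensor B (x : H') (y : H) : orthonormal_seq B ->
  hs_on B (tensor x y) <= `|x| * `|y|.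
Proof.
move=> oB; rewrite -(@ler_pXn2r _ 2) ?nnegrE ?hs_on_ge0 ?mulr_ge0//.
rewrite hs_on_sqr exprMn mulrC.
rewrite (eq_bigr (fun e => inner y e ^+ 2 * `|x| ^+ 2)); last first.
  by move=> e _; rewrite normrZ exprMn real_normK ?num_real.
by rewrite -mulr_suml ler_wpM2r ?sqr_ge0// bessel.
Qed.

(** The sum over an orthonormal set is a supremum over its finite subsets, and each of these
    enumerates to an orthonormal sequence, so a bound uniform in B passes to both suprema. *)
Lemma hs_norm_le A (c : R) : 0 <= c ->
  (forall B, orthonormal_seq B -> hs_on B A <= c) -> (hs_norm A <= c%:E)%E.
Proof.
move=> c0 hA.
have -> : c%:E = sqrte (c ^+ 2)%:E by rewrite /= sqrtr_sqr ger0_norm.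
rewrite /hs_norm lee_sqrt ?lee_fin ?sqr_ge0//; apply: ge_ereal_sup => _ [S oS <-].
apply: ge_ereal_sup => _ [F [fF FS] <-].
rewrite fsbig_finite// sumEFin lee_fin -hs_on_sqr.
rewrite lerXn2r ?nnegrE ?hs_on_ge0//; apply: hA; split; first exact: fset_uniq.
by move=> e f; rewrite !in_fset_set// !inE => /FS Se /FS Sf; exact: oS.
Qed.

End finite_hilbert_schmidt.

(** The difference splits as [tensor (x - y) x + tensor y (x - y)]. The resulting bound has the
    quadratic form of the growth condition on test functions. *)
Lemma hs_on_tensor_sub (R : realType) (H : hilbertType R) (B : seq H) (x y : H) :
  orthonormal_seq B ->
  hs_on B (tensor x x - tensor y y) <= `|x - y| * (`|x| + `|y|).
Proof.
move=> oB; rewrite (_ : _ - _ = tensor (x - y) x + tensor y (x - y)).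
  rewrite (le_trans (hs_onD _ _ _))// mulrDr lerD//; first exact: hs_on_tensor.
  by rewrite [leRHS]mulrC; exact: hs_on_tensor.
apply/funext => v; rewrite /tensor !fctE scalerBr innerBl scalerBl.
by rewrite addrA subrK.
Qed.

(** This is Minkowski's integral inequality, for an operator-valued integrand that is integrated on
    each vector separately. Pairing with A writes [hs_on B A ^+ 2] as the integral of the sums of
    [inner (g x e) (A e)], and by Cauchy-Schwarz this is at most [hs_on B A] times the integral of
    k. *)
Lemma hs_on_bochner_le d (T : measurableType d) (R : realType) (H H' : hilbertType R)
    (mu : {measure set T -> \bar R}) (B : seq H) (g : T -> H -> H') (A : H -> H')
    (k : T -> R) :
  separable H' -> (mu setT < +oo)%E ->
  (forall e, is_bochner_integral mu (fun x => g x e) (A e)) ->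
  mu.-integrable setT (EFin \o k) -> (forall x, hs_on B (g x) <= k x) ->
  hs_on B A <= \int[mu]_x k x.
Proof.
move=> sH' muoo gA ik gk.
have [->|N0] := eqVneq (hs_on B A) 0.
  by apply: Rintegral_ge0 => x _; rewrite (le_trans (hs_on_ge0 _ _) (gk x)).
have Np : 0 < hs_on B A by rewrite lt_def N0 hs_on_ge0.
have gA' e := (is_bochnerP sH' muoo _ _).1 (gA e).
have igA e : mu.-integrable setT (EFin \o (fun x => inner (g x e) (A e))).
  by have [mg ig _] := gA' e; exact: integrable_inner.
rewrite -(ler_pM2l Np) -expr2 hs_on_sqr.
rewrite (eq_bigr (fun e => \int[mu]_x inner (g x e) (A e))); last first.
  by move=> e _; have [_ _ <-] := gA' e; rewrite innerxx.
rewrite -Rintegral_sum// -RintegralZl//; apply: le_Rintegral => //.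
- exact: integrable_sumr.
- exact: integrable_EFinZl.
move=> x _; rewrite (@le_trans _ _ (hs_on B (g x) * hs_on B A))//; last first.
  by rewrite mulrC ler_wpM2l// hs_on_ge0.
rewrite (le_trans _ (sum_cauchy_schwarz _ _ _))//; apply: ler_sum => e _.
by rewrite (le_trans (ler_norm _))// cauchy_schwarz.
Qed.

Section hs_slln.
Context d d' (Omega : measurableType d) (E : measurableType d') (R : realType).
Variables (P : probability Omega R) (m : probability E R).
Variable xi : nat -> Omega -> E.
Hypothesis law : forall j, has_law P (xi j) m.
Hypothesis ind : mutually_independent P xi.
Context (H : hilbertType R) (sH : separable H).
Variable h : E -> H.
Hypothesis sh : square_integrable m h.

Let m1 : (m setT < +oo)%E.
Proof. by rewrite [X in (X < _)%E](@probability_setT _ _ _ m) ltry. Qed.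

(** The scheme is that of [slln_lipschitz]: the bounds of [hs_on_tensor_sub] and [hs_on_tensor] do
    not depend on B, so [D k] measures the approximation and the squared norm is the weight of the
    frequencies. *)
Lemma slln_hs : {ae P, forall w, forall e, 0 < e -> \forall n \near \oo,
  forall B : seq H, orthonormal_seq B ->
  hs_on B (n%:R^-1 *: (\sum_(i < n) tensor (h (xi i w)) (h (xi i w)))
           - (fun v => bochner m (fun x => tensor (h x) (h x) v))) <= e}.
Proof.
have [mh ih] := sh; have [q qd] := separable_sequence sH.
pose s k x := nearest q k (h x).
have ms k : measurable_fun setT (s k : E -> borel H) by exact: measurable_nearest.
have fs k : finite_set (range (s k)) by exact: finite_range_nearest.
pose D k x := `|h x - s k x| * (`|h x| + `|s k x|).
have mD k : measurable_fun setT (D k).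
  apply: measurable_funM; first exact: measurable_dist_nearest.
  by apply: measurable_funD; exact: measurable_hilbert_norm.
have D_ge0 k x : 0 <= D k x by rewrite mulr_ge0// addr_ge0.
(* The factor is 3 = 1 + 2, the 2 coming from [nearest_norm]. *)
have D_le k x : `|D k x| <= 3 * `|h x| ^+ 2.
  rewrite ger0_norm// /D (@le_trans _ _ (`|h x| * (3 * `|h x|)))//; last first.
    by rewrite mulrCA -expr2.
  rewrite ler_pM ?addr_ge0//; first exact: nearest_dist.
  by rewrite mulrDl mul1r lerD2l nearest_norm.
have i3 : m.-integrable setT (EFin \o (fun x => 3 * `|h x| ^+ 2)).
  exact: integrable_EFinZl.
have iD k : m.-integrable setT (EFin \o D k) by exact: le_integrable_EFin i3 _.
have D0 : \int[m]_x D n x @[n --> \oo] --> 0.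
  rewrite -(mul0r (fine (m setT))) -(Rintegral_cst m measurableT 0).
  apply: Rintegral_dominated_cvg i3 _ => // x.
  have C1 : `|h x - s n x| * (3 * `|h x|) @[n --> \oo] --> 0.
    rewrite -(mul0r (3 * `|h x|)); apply: cvgMl.
    apply/cvgrPdist_lt => e e0; have /cvgrPdist_lt/(_ e e0) := @nearest_cvg _ _ _ qd (h x).
    by apply: filterS => n; rewrite sub0r normrN normr_id.
  apply: (squeeze_cvgr _ (cvg_cst 0) C1); apply: nearW => n; rewrite D_ge0/=.
  by rewrite ler_wpM2l// mulrDl mul1r lerD2l nearest_norm.
have A1 : {ae P, forall w k, n%:R^-1 * (\sum_(i < n) D k (xi i w))
    @[n --> \oo] --> \int[m]_x D k x}.
  by apply/ae_foralln => k; exact: (slln_nonneg law ind).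
have A2 : {ae P, forall w k,
    frequency_error m xi (s k) (fun y => `|y| * `|y|) n w @[n --> \oo] --> 0}.
  by apply/ae_foralln => k; exact: frequency_error_cvg0.
apply: filterS2 A1 A2 => w A1 A2 e e0.
have e20 : 0 < e / 2 by rewrite divr_gt0.
have /cvgrPdist_lt /(_ _ e20) [k _ /(_ k (leqnn k))] := D0.
rewrite /= sub0r normrN ger0_norm ?Rintegral_ge0// => De.
pose a n := n%:R^-1 * (\sum_(i < n) D k (xi i w))
  + (frequency_error m xi (s k) (fun y => `|y| * `|y|) n w + \int[m]_x D k x).
have aD : a n @[n --> \oo] --> \int[m]_x D k x + (0 + \int[m]_x D k x).
  by apply: cvgD (A1 k) _; apply: cvgD (A2 k) _; exact: cvg_cst.
have : \forall n \near \oo, a n <= e.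
  have De2 : \int[m]_x D k x + (0 + \int[m]_x D k x) < e.
    by rewrite add0r (splitr e) ltrD.
  exact: cvgr_le aD _ De2.
apply: filterS => n ane B oB; rewrite (le_trans _ ane)// /a.
pose tt (x : H) := tensor x x.
pose Tk := \sum_(y <- fset_set (range (s k))) fine (m (s k @^-1` [set y])) *: tt y.
pose T v := bochner m (fun x => tt (h x) v).
rewrite -/T (_ : _ - T = n%:R^-1 *: (\sum_(i < n) (tt (h (xi i w)) - tt (s k (xi i w))))
  + ((n%:R^-1 *: (\sum_(i < n) tt (s k (xi i w))) - Tk) + (Tk - T))); last first.
  by rewrite sumrB scalerBr !addrA !subrK.
rewrite (le_trans (hs_onD _ _ _))// lerD//.
  rewrite hs_onZ ger0_norm ?invr_ge0// ler_wpM2l ?invr_ge0//.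
  rewrite (le_trans (hs_on_sum _ _ _))//; apply: ler_sum => i _.
  exact: hs_on_tensor_sub.
rewrite (le_trans (hs_onD _ _ _))// lerD//.
  rewrite (simple_averageE _ (fs k)) -sumrB (le_trans (hs_on_sum _ _ _))//.
  apply: ler_sum => y _; rewrite -scalerBl hs_onZ ler_wpM2l//.
  exact: hs_on_tensor.
apply: (@hs_on_bochner_le _ _ _ _ _ m B (fun x => tt (s k x) - tt (h x))) => //.
  move=> v; apply: is_bochnerB => //; last exact: (is_bochner_tensor m1 v sH sH sh sh).
  apply/is_bochnerP => //.
  have mt : measurable_fun setT (fun x => tt (s k x) v : borel H).
    by apply: measurable_hilbertZ => //; exact: measurable_hilbert_inner.
  split => //; first exact: (simple_comp_integrable m1 (fun z => `|tt z v|)).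
  move=> u; rewrite (simple_comp_Rintegral m1 (fun z => inner (tt z v) u))//.
  rewrite /Tk fct_sumE inner_suml; apply: eq_bigr => y _.
  by rewrite fctE innerZl.
move=> x; rewrite /D distrC (addrC `|h x|); exact: hs_on_tensor_sub.
Qed.

End hs_slln.

(** * Covariance operators *)

Section covariance.
Context d (E : measurableType d) (R : realType) (m : probability E R).
Context (H1 H2 : hilbertType R) (s1 : separable H1) (s2 : separable H2).
Variables (f : E -> H1) (g : E -> H2).
Hypotheses (sf : square_integrable m f) (sg : square_integrable m g).

Let m1 : (m setT < +oo)%E.
Proof. by rewrite [X in (X < _)%E](@probability_setT _ _ _ m) ltry. Qed.
Let m1' : fine (m setT) = 1. Proof. by rewrite probability_setT. Qed.
Let bf : is_bochner_integral m f (bochner m f).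
Proof. by apply: bochnerP => //; [case: sf|exact: square_integrable_norm]. Qed.
Let bg : is_bochner_integral m g (bochner m g).
Proof. by apply: bochnerP => //; [case: sg|exact: square_integrable_norm]. Qed.
Let ig v : m.-integrable setT (EFin \o (fun x => inner (g x) v)).
Proof. by apply: integrable_inner => //; [case: sg|exact: square_integrable_norm]. Qed.

(** The four terms of the expansion are integrable separately, and the last three each integrate, up
    to sign, to the same product of means. *)
Lemma is_bochner_Cov v : is_bochner_integral m
  (fun x => tensor (f x - bochner m f) (g x - bochner m g) v)
  (bochner m (fun x => tensor (f x) (g x) v) - inner (bochner m g) v *: bochner m f).
Proof.
have b1 := is_bochner_tensor m1 v s1 s2 sf sg.
have b2 := is_bochner_scalar m1 (bochner m f) s1 (ig v).
rewrite -(bochner_weak s2 m1 v bg) in b2.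
have b3 := is_bochnerZ s1 m1 (inner (bochner m g) v) bf.
have b4 := is_bochner_cst s1 m1 (inner (bochner m g) v *: bochner m f) m1'.
have := is_bochnerD s1 m1 (is_bochnerB s1 m1 (is_bochnerB s1 m1 b1 b2) b3) b4.
rewrite subrK; congr is_bochner_integral; apply/funext => x.
by rewrite /tensor innerBl scalerBl !scalerBr (opprD (_ *: f x)) opprK addrA.
Qed.

Lemma CovE v : Cov m f g v =
  bochner m (fun x => tensor (f x) (g x) v) - inner (bochner m g) v *: bochner m f.
Proof. by rewrite /Cov (bochnerE s1 m1 (is_bochner_Cov v)). Qed.

Lemma is_bochner_CovP v : is_bochner_integral m
  (fun x => tensor (f x - bochner m f) (g x - bochner m g) v) (Cov m f g v).
Proof. by rewrite CovE; exact: is_bochner_Cov. Qed.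

Lemma CovD v v' : Cov m f g (v + v') = Cov m f g v + Cov m f g v'.
Proof.
apply: bochnerE => //.
have := is_bochnerD s1 m1 (is_bochner_CovP v) (is_bochner_CovP v').
congr is_bochner_integral; apply/funext => x.
by rewrite /tensor innerDr scalerDl.
Qed.

Lemma CovZ a v : Cov m f g (a *: v) = a *: Cov m f g v.
Proof.
apply: bochnerE => //; have := is_bochnerZ s1 m1 a (is_bochner_CovP v).
congr is_bochner_integral; apply/funext => x.
by rewrite /tensor innerZr scalerA.
Qed.

Lemma inner_Cov v x : inner (Cov m f g v) x =
  \int[m]_w (inner (g w - bochner m g) v * inner (f w - bochner m f) x).
Proof.
rewrite (bochner_weak s1 m1 x (is_bochner_CovP v)).
by apply: eq_Rintegral => w _; rewrite innerZl.
Qed.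

End covariance.

(** The factor M/(M-1) converts the divisor M-1 into plain averages, to which the strong law applies
    term by term. *)
Lemma emp_CovE (R : realType) (H1 H2 : hilbertType R) (M : nat) (x : nat -> H1)
    (y : nat -> H2) v : (1 < M)%N ->
  emp_Cov M x y v = (M%:R / M.-1%:R) *:
    (M%:R^-1 *: (\sum_(j < M) tensor (x j) (y j) v) - inner (emp_mean M y) v *: emp_mean M x).
Proof.
move=> M1; have M0 : M%:R != 0 :> R by rewrite pnatr_eq0 -lt0n ltnW.
have sx : \sum_(j < M) x j = M%:R *: emp_mean M x by rewrite scalerA mulfV ?scale1r.
have sy : \sum_(j < M) inner (y j) v = M%:R * inner (emp_mean M y) v.
  by rewrite -innerZl scalerA mulfV// scale1r inner_suml.
rewrite /emp_Cov fctE fct_sumE mulrC -scalerA; congr (_ *: _).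
rewrite /tensor; under eq_bigr do rewrite innerBl scalerBl !scalerBr.
rewrite !sumrB -scaler_suml sy -scaler_sumr sx sumr_const card_ord.
move: (emp_mean M x) (inner _ _) => mx r.
rewrite [RHS]scalerBr (scalerA M%:R M%:R^-1) mulfV// scale1r [in RHS]scalerA.
rewrite (_ : r *: (M%:R *: mx) = (r *: mx) *+ M) ?subrr ?subr0//.
by rewrite scalerA mulrC -scalerA scaler_nat.
Qed.

Lemma emp_Cov_linear (R : realType) (H1 H2 : hilbertType R) (M : nat) (x : nat -> H1)
    (y : nat -> H2) : linear (emp_Cov M x y).
Proof.
move=> a v v'; rewrite /emp_Cov !fctE !fct_sumE scalerA mulrC -scalerA -scalerDr.
congr (_ *: _); rewrite scaler_sumr -big_split /=; apply: eq_bigr => j _.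
by rewrite /tensor innerDr innerZr scalerDl scalerA.
Qed.

(** * Nullity of hyperplanes *)

Section hyperplane.
Context (R : realType).

Lemma lebesgue_euclid0 d : @lebesgue_euclid R d set0 = 0%E.
Proof.
elim: d => [|d ih]; first by rewrite /= dirac0.
rewrite /= /pushforward preimage_set0 /product_measure1.
by rewrite integral0_eq// => a _ /=; rewrite xsection0 ih.
Qed.

Lemma euclid_dot_cons d (x y : euclid R d.+1) :
  euclid_dot x y = x ord0 ord0 * y ord0 ord0 +
    euclid_dot (\row_j x ord0 (lift ord0 j) : euclid R d) (\row_j y ord0 (lift ord0 j)).
Proof.
rewrite /euclid_dot big_ord_recl; congr (_ + _).
by apply: eq_bigr => i _; rewrite !mxE.
Qed.

Lemma euclid_cons0 d (a : R) (v : euclid R d) : euclid_cons (a, v) ord0 ord0 = a.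
Proof.
rewrite /euclid_cons (_ : ord0 = lshift d (ord0 : 'I_1)); last exact: val_inj.
by rewrite (row_mxEl (a%:M : 'rV[R]_1) v) mxE eqxx.
Qed.

Lemma euclid_consS d (a : R) (v : euclid R d) :
  \row_j (euclid_cons (a, v)) ord0 (lift ord0 j) = v.
Proof.
apply/rowP => j; rewrite mxE /euclid_cons.
rewrite (_ : lift ord0 j = rshift 1 j); last exact: val_inj.
by rewrite (row_mxEr (a%:M : 'rV[R]_1) v).
Qed.

(** Induction on the dimension, slicing along the first coordinate. B ranges over all subsets of the
    hyperplane, measurable or not, because [integral_null_support] asks for all of them. *)
Lemma lebesgue_euclid_hyperplane d (x : euclid R d) (t : R)
    (B : set (borel (euclid R d))) :
  x != 0 -> B `<=` [set v | euclid_dot x v = t] -> lebesgue_euclid B = 0%E.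
Proof.
elim: d x t B => [|d ih] x t B x0 Bx.
  by exfalso; move/eqP: x0; apply; apply/rowP => -[].
pose x' : euclid R d := \row_j x ord0 (lift ord0 j).
have sec a v : B (euclid_cons (a, v)) -> x ord0 ord0 * a + euclid_dot x' v = t.
  by move=> /Bx /=; rewrite euclid_dot_cons euclid_cons0 euclid_consS.
rewrite /= /pushforward /product_measure1.
(* If [x'] is nonzero, every slice lies in a hyperplane of lower dimension. Otherwise the equation
   pins the first coordinate to [t / x ord0 ord0]: only the slice there can be nonempty, and its
   measure c, possibly infinite, counts on a single point of the line. *)
have [x'0|x'0] := eqVneq x' 0; last first.
  rewrite integral0_eq// => a _ /=; apply: (ih x' (t - x ord0 ord0 * a)) => //.
  by move=> v; rewrite /xsection /= inE => /sec <-; rewrite addrC addKr.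
have x00 : x ord0 ord0 != 0.
  apply: contra x0 => /eqP x00; apply/eqP/rowP => j; rewrite mxE.
  have [j' ->|->//] := unliftP ord0 j.
  by have := congr1 (fun r : euclid R d => r ord0 j') x'0; rewrite !mxE.
have [c cE] : exists c : \bar R, forall a,
    lebesgue_euclid (xsection (@euclid_cons R d @^-1` B) a) =
    (if (a == t / x ord0 ord0)%R then c else 0%E).
  exists (lebesgue_euclid (xsection (@euclid_cons R d @^-1` B) (t / x ord0 ord0))) => a.
  case: eqP => [->//|at0].
  rewrite (_ : xsection _ _ = set0) ?lebesgue_euclid0//.
  apply/seteqP; split => v //; rewrite /xsection /= inE => /sec.
  rewrite x'0 /euclid_dot big1 ?addr0 => [h|i _]; last by rewrite mxE mul0r.
  by apply: at0; rewrite -h mulrAC mulfV ?mul1r.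
transitivity (\int[@lebesgue_measure R]_(a in [set: measurableTypeR R])
    (if (a == t / x ord0 ord0)%R then c else 0%E))%E.
  by apply: eq_integral => a _; exact: cE.
rewrite -[RHS](integral0 (@lebesgue_measure R) [set: measurableTypeR R]).
apply: ae_eq_integral => //.
  apply: measurable_fun_ifT => //; exact: measurable_fun_eqr.
exists [set t / x ord0 ord0]; split => //; first exact: lebesgue_measure_set1.
by move=> a /= /not_implyP[_]; case: eqP.
Qed.

Import HBNNSimple.

(* [lebesgue_euclid] is defined as a mere set function, so the hypothesis asks
   for the nullity of all subsets of A instead of invoking monotonicity. *)
Lemma integral_null_support d (T : measurableType d) (mu : set T -> \bar R) (A : set T)
    (f : T -> \bar R) :
  (forall B, B `<=` A -> mu B = 0%E) -> (\int[mu]_(x in A) f x = 0)%E.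
Proof.
move=> mu0.
have nn0 (g : T -> \bar R) : (forall x, 0 <= g x)%E -> (forall x, ~ A x -> g x = 0%E) ->
    ereal_sup [set sintegral mu h | h in
      [set h : {nnsfun T >-> R} | forall x, ((h x)%:E <= g x)%E]] = 0%E.
  move=> g0 gA.
  (* A simple function below g is nonzero only inside A, so each of its fibres other than that of 0
     is null by [mu0]. *)
  have s0 (h : {nnsfun T >-> R}) : (forall x, ((h x)%:E <= g x)%E) -> sintegral mu h = 0%E.
    move=> hg; rewrite /sintegral fsbig1// => y _.
    have [->|y0] := eqVneq y 0; first by rewrite mul0e.
    rewrite mu0 ?mule0// => x /= hx; apply: contrapT => /gA gx0.
    have := hg x; rewrite gx0 hx lee_fin => y_le0.
    by move/eqP: y0; apply; apply/eqP; rewrite eq_le y_le0 -hx/=.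
  apply/eqP; rewrite eq_le; apply/andP; split.
    by apply: ge_ereal_sup => _ [h hg <-]; rewrite s0.
  apply: ereal_sup_ubound; exists nnsfun0 => /=; first by move=> x; exact: g0.
  by rewrite (s0 nnsfun0)// => x; exact: g0.
rewrite /integral nn0; last 2 first.
- by move=> x; exact: funepos_ge0.
- by move=> x nA; rewrite funepos_restrict /patch memNset.
rewrite nn0 ?sube0//.
by move=> x nA; rewrite funeneg_restrict /patch memNset.
Qed.

End hyperplane.

(** * Convergence of the gain and of the analysis ensemble *)

Section gain_convergence.
Context (R : realType).

Lemma linear_scale_sum (V W : lmodType R) (f : V -> W) (I : Type) (s : seq I)
    (c : I -> R) (w : I -> V) : linear f ->
  f (\sum_(i <- s) c i *: w i) = \sum_(i <- s) c i *: f (w i).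
Proof.
move=> lf; have f0 : f 0 = 0.
  have := lf (-1) 0 0; rewrite scaler0 addr0 scaleN1r => ->.
  by rewrite addNr.
by elim: s => [|i s ih]; rewrite ?big_nil// !big_cons lf ih.
Qed.

Lemma euclid_sum_delta d (v : euclid R d) :
  v = \sum_(i <- enum 'I_d) v ord0 i *: (delta_mx ord0 i : euclid R d).
Proof. by rewrite big_enum /=; exact: row_sum_delta. Qed.

Lemma linear_euclidE d (W : lmodType R) (f : euclid R d -> W) v : linear f ->
  f v = \sum_(i <- enum 'I_d) v ord0 i *: f (delta_mx ord0 i).
Proof. by move=> lf; rewrite {1}(euclid_sum_delta v) linear_scale_sum. Qed.

Lemma linear_kalman_gain (H : hilbertType R) d (C : euclid R d -> H)
    (D : euclid R d -> euclid R d) : linear C -> linear (kalman_gain C D).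
Proof.
move=> lC a u v; rewrite /kalman_gain /= /euclid_inv -lC.
by rewrite mulmxDl -scalemxAl.
Qed.

Lemma cvg_prodr (I : Type) (s : seq I) (u : I -> nat -> R) (l : I -> R) :
  (forall i, u i n @[n --> \oo] --> l i) ->
  \prod_(i <- s) u i n @[n --> \oo] --> \prod_(i <- s) l i.
Proof.
move=> ul; elim: s => [|i s ih].
  rewrite big_nil; under eq_fun do rewrite big_nil; exact: cvg_cst.
rewrite big_cons; under eq_fun do rewrite big_cons; exact: cvgM.
Qed.

Lemma cvg_sumr (V : normedModType R) (I : Type) (s : seq I) (u : I -> nat -> V) (l : I -> V) :
  (forall i, u i n @[n --> \oo] --> l i) ->
  \sum_(i <- s) u i n @[n --> \oo] --> \sum_(i <- s) l i.
Proof.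
move=> ul; elim: s => [|i s ih].
  rewrite big_nil; under eq_fun do rewrite big_nil; exact: cvg_cst.
rewrite big_cons; under eq_fun do rewrite big_cons; exact: cvgD.
Qed.

Lemma cvg_det d (A : nat -> 'M[R]_d) (B : 'M[R]_d) :
  (forall i j, A n i j @[n --> \oo] --> B i j) -> \det (A n) @[n --> \oo] --> \det B.
Proof.
move=> AB; rewrite /determinant; apply: cvg_sumr => s.
by apply: cvgMr; apply: cvg_prodr => i; exact: AB.
Qed.

(** Cramer's rule: the entries of the inverse are cofactors divided by the determinant. The
    determinants of [A n] are nonzero from some n on, so the value of [invmx] on singular matrices
    does not affect the limit. *)
Lemma cvg_invmx d (A : nat -> 'M[R]_d) (B : 'M[R]_d) : B \in unitmx ->
  (forall i j, A n i j @[n --> \oo] --> B i j) ->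
  forall i j, invmx (A n) i j @[n --> \oo] --> invmx B i j.
Proof.
move=> uB AB i j; have dA := cvg_det AB.
have dB : \det B != 0 by rewrite -unitfE -unitmxE.
have nA : \forall n \near \oo, \det (A n) != 0 by exact: cvgr_neq0 dA dB.
have C : (\det (A n))^-1 * \adj (A n) i j @[n --> \oo] --> (\det B)^-1 * \adj B i j.
  apply: cvgM; first exact: cvgV.
  rewrite mxE; under eq_fun do rewrite mxE; rewrite /cofactor.
  apply: cvgMr; apply: cvg_det => k l; rewrite !mxE; under eq_fun do rewrite !mxE.
  exact: AB.
have -> : invmx B i j = (\det B)^-1 * \adj B i j by rewrite /invmx uB [LHS]mxE.
apply: near_eq_cvgn C.
apply: filterS nA => n dn; by rewrite /invmx unitmxE unitfE dn [RHS]mxE.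
Qed.

Lemma cvg_euclid_coord d (u : nat -> euclid R d) (l : euclid R d) i :
  u n @[n --> \oo] --> l -> u n ord0 i @[n --> \oo] --> l ord0 i.
Proof.
move=> /cvgrPdist_lt ul; apply/cvgrPdist_lt => e /ul.
apply: filterS => n; apply: le_lt_trans.
by have := euclid_coord_le (l - u n) i; rewrite !mxE.
Qed.

Section kalman_gain_cvg.
Context (H : hilbertType R) (d : nat).
Variables (Cn : nat -> euclid R d -> H) (C : euclid R d -> H).
Variables (Dn : nat -> euclid R d -> euclid R d) (D : euclid R d -> euclid R d).
Hypotheses (lCn : forall n, linear (Cn n)) (lC : linear C).
Hypothesis CnC : forall v, Cn n v @[n --> \oo] --> C v.
Hypothesis DnD : forall v, Dn n v @[n --> \oo] --> D v.
Hypothesis uD : lin1_mx D \in unitmx.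

Let delta i : euclid R d := delta_mx ord0 i.

Lemma kalman_gain_cvg v :
  kalman_gain (Cn n) (Dn n) v @[n --> \oo] --> kalman_gain C D v.
Proof.
rewrite /kalman_gain /= /euclid_inv.
rewrite (linear_euclidE _ lC); under eq_fun do rewrite linear_euclidE//.
apply: cvg_sumr => i; apply: cvgZ => //.
rewrite mxE; under eq_fun do rewrite mxE.
apply: cvg_sumr => k; apply: cvgMr; apply: cvg_invmx => // a b.
rewrite mxE; under eq_fun do rewrite mxE.
exact: cvg_euclid_coord.
Qed.

Lemma kalman_gain_bound : exists2 L : R, 0 <= L &
  forall v, `|kalman_gain C D v| <= L * `|v|.
Proof.
exists (\sum_(i <- enum 'I_d) `|kalman_gain C D (delta i)|); first exact: sumr_ge0.
move=> v; rewrite (linear_euclidE v (linear_kalman_gain D lC)) mulr_suml.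
rewrite (le_trans (ler_norm_sum _ _ _))//; apply: ler_sum => i _.
by rewrite normrZ mulrC ler_wpM2l// euclid_coord_le.
Qed.

(** kappa is the sum of the errors on the canonical basis. It bounds the operator norm of the
    difference because coordinates are at most the Euclidean norm. *)
Lemma kalman_gain_cvg_uniform : exists2 kappa : nat -> R,
  kappa n @[n --> \oo] --> 0 & forall n, 0 <= kappa n /\
  forall v, `|kalman_gain (Cn n) (Dn n) v - kalman_gain C D v| <= kappa n * `|v|.
Proof.
exists (fun n => \sum_(i <- enum 'I_d)
    `|kalman_gain (Cn n) (Dn n) (delta i) - kalman_gain C D (delta i)|).
  have := @cvg_sumr R^o _ (enum 'I_d) (fun i n =>
    `|kalman_gain (Cn n) (Dn n) (delta i) - kalman_gain C D (delta i)| : R^o) (fun=> 0).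
  rewrite big1 => [|//]; apply=> i.
  by apply/norm_cvg0P/subr_cvg0; exact: kalman_gain_cvg.
move=> n; split; first exact: sumr_ge0.
move=> v; rewrite (linear_euclidE v (linear_kalman_gain D lC)).
rewrite (linear_euclidE v (linear_kalman_gain (Dn n) (lCn n))) -sumrB mulr_suml.
rewrite (le_trans (ler_norm_sum _ _ _))//; apply: ler_sum => i _.
by rewrite -scalerBr normrZ mulrC ler_wpM2l// euclid_coord_le.
Qed.

End kalman_gain_cvg.

End gain_convergence.

Lemma separable_euclid (R : realType) (d : nat) : separable (euclid R d).
Proof.
pose q (r : 'rV[rat]_d) : euclid R d := \row_i ratr (r ord0 i).
exists (range q); first exact: (sub_countable (card_image_le _ _) (countableP _)).
move=> O [x Ox] oO; have := oO; rewrite openE => /(_ _ Ox)/nbhs_ballP[e /= e0 eO].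
pose L := \sum_(i <- enum 'I_d) `|delta_mx ord0 i : euclid R d|.
have L0 : 0 <= L by exact: sumr_ge0.
have L1 : 0 < L + 1 by rewrite ltr_wpDl.
(* Coordinate errors below e/(L+1) add up to less than e, as L is the total norm of the basis
   vectors. The summand 1 covers d = 0, where L = 0. *)
have a0 : 0 < e / (L + 1) by rewrite divr_gt0.
have hx i : exists r : rat, `|x ord0 i - ratr r| < e / (L + 1).
  have [|t /[!in_itv]/= /andP[t1 t2]] := @rat_in_itvoo R (x ord0 i - e / (L + 1)) (x ord0 i).
    by rewrite ltrBlDr ltrDl.
  by exists t; rewrite ger0_norm ?subr_ge0 ?ltW// ltrBlDr -ltrBlDl.
pose r i := projT1 (cid (hx i)).
have hr i : `|x ord0 i - ratr (r i)| < e / (L + 1) := projT2 (cid (hx i)).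
exists (q (\row_i r i)); split; last by exists (\row_i r i).
apply: eO; rewrite -ball_normE /= (euclid_sum_delta (x - _)).
rewrite (le_lt_trans (ler_norm_sum _ _ _))//.
rewrite (@le_lt_trans _ _ (e / (L + 1) * L))//; last first.
  by rewrite mulrAC ltr_pdivrMr// ltr_pM2l// ltrDl.
rewrite mulr_sumr; apply: ler_sum => i _; rewrite normrZ ler_wpM2r//.
by have := hr i; rewrite !mxE => /ltW.
Qed.

Lemma bounded_linear_continuous (R : realType) (H H' : hilbertType R) (f : H -> H') (L : R) :
  linear f -> 0 <= L -> (forall v, `|f v| <= L * `|v|) -> continuous f.
Proof.
move=> lf L0 fL v; apply/cvgrPdist_lt => e e0.
have L1 : 0 < L + 1 by rewrite ltr_wpDl.
near=> v'; have -> : f v - f v' = f (v - v').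
  by rewrite addrC -scaleN1r -lf scaleN1r addrC.
rewrite (le_lt_trans (fL _))// (@le_lt_trans _ _ ((L + 1) * `|v - v'|))//.
  by rewrite ler_wpM2r// lerDl.
rewrite mulrC -ltr_pdivlMr//; near: v'.
by apply: cvgr_dist_lt; [exact: cvg_id|rewrite divr_gt0].
Unshelve. all: by end_near. Qed.

Lemma quadratic_growth_continuous (R : realType) (H H' : hilbertType R) (f : H -> H') (C : R) :
  (forall u v, `|f u - f v| <= C * (1 + `|u| + `|v|) * `|u - v|) -> continuous f.
Proof.
move=> fC x; apply/cvgrPdist_lt => e e0.
(* Within distance 1 of x, [1 + |x| + |v|] is at most [2 + 2 |x|]. The absolute value allows for a
   negative C, and the summand 1 makes c positive. *)
pose c := `|C| * (2 + 2 * `|x|) + 1.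
have c0 : 0 < c by rewrite ltr_wpDl// mulr_ge0// addr_ge0// mulr_ge0.
near=> v.
have vx1 : `|x - v| < 1 by near: v; apply: cvgr_dist_lt; [exact: cvg_id|].
have vxe : `|x - v| < e / c.
  by near: v; apply: cvgr_dist_lt; [exact: cvg_id|rewrite divr_gt0].
rewrite (le_lt_trans (fC _ _))// (@le_lt_trans _ _ (c * `|x - v|))//; last first.
  by rewrite mulrC -ltr_pdivlMr.
rewrite ler_wpM2r// /c (@le_trans _ _ (`|C| * (2 + 2 * `|x|)))//; last by rewrite lerDl.
have vle : `|v| <= `|x| + 1.
  rewrite -(subrK x v) addrC (le_trans (ler_normD _ _))// lerD2l distrC.
  exact: ltW.
rewrite (@le_trans _ _ (`|C| * (1 + `|x| + `|v|)))//.
  by rewrite ler_wpM2r ?addr_ge0// ler_norm.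
by rewrite ler_wpM2l//; lra.
Unshelve. all: by end_near. Qed.

Section enkf_convergence.
Context dO dE (Omega : measurableType dO) (E : measurableType dE) (R : realType).
Variables (P : probability Omega R) (m : probability E R).
Variable xi : nat -> Omega -> E.
Hypothesis law : forall j, has_law P (xi j) m.
Hypothesis ind : mutually_independent P xi.

Let m1 : (m setT < +oo)%E.
Proof. by rewrite [X in (X < _)%E](@probability_setT _ _ _ m) ltry. Qed.

(** The strong law for f, for g and for their tensor at v is inserted into [emp_CovE], whose factor
    M/(M-1) tends to 1. *)
Lemma emp_Cov_cvg (H1 H2 : hilbertType R) (f : E -> H1) (g : E -> H2) v :
  separable H1 -> separable H2 -> square_integrable m f -> square_integrable m g ->
  {ae P, forall w, emp_Cov M (fun j => f (xi j w)) (fun j => g (xi j w)) v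
    @[M --> \oo] --> Cov m f g v}.
Proof.
move=> s1 s2 sf sg; have [mf _] := sf; have [mg _] := sg.
have nf := square_integrable_norm m1 sf; have ng := square_integrable_norm m1 sg.
have mt : measurable_fun setT (fun x => tensor (f x) (g x) v : borel H1).
  by apply: measurable_hilbertZ => //; exact: measurable_hilbert_inner.
have it : m.-integrable setT (EFin \o (fun x => `|tensor (f x) (g x) v|)).
  by have [_ ->] := (is_bochnerP s1 m1 _ _).1 (is_bochner_tensor m1 v s1 s2 sf sg).
have A1 := slln_hilbert law ind s1 mf nf.
have A2 := slln_hilbert law ind s2 mg ng.
have A3 := slln_hilbert law ind s1 mt it.
apply: filterS3 A1 A2 A3 => w c1 c2 c3; rewrite CovE//.
have C : (M%:R / M.-1%:R : R) *: (M%:R^-1 *: (\sum_(j < M) tensor (f (xi j w)) (g (xi j w)) v)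
      - inner (M%:R^-1 *: \sum_(j < M) g (xi j w)) v *: (M%:R^-1 *: \sum_(j < M) f (xi j w)))
    @[M --> \oo] --> (1 : R) *: (bochner m (fun x => tensor (f x) (g x) v)
      - inner (bochner m g) v *: bochner m f).
  apply: cvgZ; last first.
    apply: cvgB => //; apply: cvgZ => //.
    by apply: (@cvg_comp _ _ _ _ (fun x => inner x v)) c2 _; exact: continuous_innerl.
  have C1 : 1 + (M.-1%:R)^-1 @[M --> \oo] --> (1 + 0 : R).
    apply: cvgD; first exact: cvg_cst.
    rewrite -(@cvg_shiftS _ (fun M => (M.-1%:R)^-1 : R)) /=.
    rewrite -(@cvg_shiftS _ (fun M => (M%:R)^-1 : R)); exact: cvg_harmonic.
  rewrite addr0 in C1; apply: near_eq_cvgn C1.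
  exists 2 => // M /= M2; rewrite -{2}(prednK (ltnW M2)) -natr1 mulrDl mul1r mulfV//.
  by rewrite pnatr_eq0 -lt0n -subn1 subn_gt0.
rewrite scale1r in C; apply: near_eq_cvgn C.
by exists 2 => // M /= M2; rewrite emp_CovE.
Qed.

Context (X : hilbertType R) (d : nat) (sX : separable X).
Variables (u : E -> X) (y : E -> euclid R d) (z : euclid R d).
Hypotheses (su : square_integrable m u) (sy : square_integrable m y).
Hypothesis unitC : lin1_mx (Cov m y y) \in unitmx.

Let sE : separable (euclid R d) := separable_euclid R d.

Let K := kalman_gain (Cov m u y) (Cov m y y).

Definition analysis_map (x : E) : X := u x + K (z - y x).

Definition analysis_ensemble M w j : X :=
  enkf_analysis M (fun i => u (xi i w)) (fun i => y (xi i w)) z j.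

Let linear_Cov (H : hilbertType R) (f : E -> H) : separable H -> square_integrable m f ->
  linear (Cov m f y).
Proof. by move=> sH sf a v v'; rewrite CovD// CovZ. Qed.

(** One null set serves all v: the finitely many basis vectors are treated together, and linearity
    of both operators does the rest. *)
Let emp_Cov_cvg_all (H : hilbertType R) (f : E -> H) : separable H ->
  square_integrable m f ->
  {ae P, forall w v, emp_Cov M (fun j => f (xi j w)) (fun j => y (xi j w)) v
    @[M --> \oo] --> Cov m f y v}.
Proof.
move=> sH sf.
have := ae_all_seq (enum 'I_d)
  (fun i => emp_Cov_cvg (delta_mx ord0 i : euclid R d) sH sE sf sy).
apply: filterS => w hw v; rewrite (linear_euclidE v (linear_Cov sH sf)).
under eq_fun do rewrite (linear_euclidE v (emp_Cov_linear _ _ _)).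
by apply: cvg_sumr => i; apply: cvgZr; apply: hw; rewrite mem_enum.
Qed.

Let gain_bound : exists2 L : R, 0 <= L & forall v, `|K v| <= L * `|v|.
Proof. by apply: kalman_gain_bound; exact: linear_Cov. Qed.

Lemma square_integrable_innovation : square_integrable m (fun x => z - y x).
Proof.
apply: square_integrableD => //; first exact: square_integrable_cst.
apply: (square_integrable_le (L := 1) sy) => [|x]; last by rewrite mul1r normrN.
rewrite (_ : (fun x => - y x) = (fun x => -1 *: y x)).
  by apply: measurable_hilbertZ => //; case: sy.
by apply/funext => x; rewrite scaleN1r.
Qed.

Lemma square_integrable_analysis : square_integrable m analysis_map.
Proof.
have [L L0 KL] := gain_bound; have sI := square_integrable_innovation.
apply: square_integrableD => //.
apply: (square_integrable_le (L := L) sI) => [|x]; last exact: KL.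
apply: (@measurableT_comp _ _ _ _ _ _ (K : borel (euclid R d) -> borel X)); last by case: sI.
apply: continuous_borel_measurable; apply: bounded_linear_continuous L0 KL.
by apply: linear_kalman_gain; exact: linear_Cov.
Qed.

(** The weight is the one in the growth condition on f, so the error controls averages of
    differences of such f up to the factor [|C|]. Being at least 1, the weight covers 1-Lipschitz f
    as well. *)
Definition ensemble_error M w : R := M%:R^-1 * \sum_(j < M)
  (`|analysis_ensemble M w j - analysis_map (xi j w)|
   * (1 + `|analysis_ensemble M w j| + `|analysis_map (xi j w)|)).

Lemma ensemble_error_ge0 M w : 0 <= ensemble_error M w.
Proof.
by rewrite mulr_ge0 ?invr_ge0// sumr_ge0// => j _; rewrite mulr_ge0// !addr_ge0.
Qed.

Lemma ensemble_error_cvg0 : {ae P, forall w, ensemble_error M w @[M --> \oo] --> 0}.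
Proof.
have [L L0 KL] := gain_bound; have sI := square_integrable_innovation.
(* With t = z - y x, gain error kappa and bound L for K, the deviation is at most [kappa |t|] and
   the weight at most [1 + 2 |u x| + (2 L + kappa) |t|], hence at most 1 + kappa times the second
   factor of b. So b is free of M, and second moments make it integrable. *)
pose b x := `|z - y x| * (1 + 2 * `|u x| + (2 * L + 1) * `|z - y x|).
have b0 x : 0 <= b x by rewrite mulr_ge0// !addr_ge0 ?mulr_ge0// addr_ge0 ?mulr_ge0.
have mb : measurable_fun setT b.
  have [[mu_ _] [mI _]] := (su, sI).
  apply: measurable_funM; first exact: measurable_hilbert_norm.
  by apply: measurable_funD; [apply: measurable_funD|]; rewrite //;
    apply: measurable_funM => //; exact: measurable_hilbert_norm.
have ib : m.-integrable setT (EFin \o b).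
  rewrite (_ : b = fun x => `|z - y x| + (2 * (`|z - y x| * `|u x|)
      + (2 * L + 1) * (`|z - y x| * `|z - y x|))); last first.
    by apply/funext => x; rewrite /b; ring.
  apply: integrable_EFinD; first exact: square_integrable_norm.
  by apply: integrable_EFinD; apply: integrable_EFinZl; exact: integrable_mul_norm.
have A1 := slln_nonneg law ind mb b0 ib.
have A2 := emp_Cov_cvg_all sX su.
have A3 := emp_Cov_cvg_all sE sy.
apply: filterS3 A1 A2 A3 => w c1 c2 c3.
have [kappa k0 hk] := kalman_gain_cvg_uniform
  (fun n => emp_Cov_linear n (fun i => u (xi i w)) (fun i => y (xi i w)))
  (linear_Cov sX su) c2 c3 unitC.
have C : kappa M * (1 + kappa M) * (M%:R^-1 * \sum_(j < M) b (xi j w))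
    @[M --> \oo] --> 0 * (1 + 0) * \int[m]_x b x.
  by apply: cvgM => //; apply: cvgM => //; apply: cvgD => //; exact: cvg_cst.
rewrite !mul0r in C; apply: (squeeze_cvgr _ (cvg_cst 0) C).
apply: nearW => M; rewrite ensemble_error_ge0 /= /ensemble_error mulrCA.
rewrite ler_wpM2l ?invr_ge0// mulr_sumr; apply: ler_sum => j _.
have [kM0 hkM] := hk M.
set t := z - y (xi j w); set v := u (xi j w).
have dle : `|analysis_ensemble M w j - analysis_map (xi j w)| <= kappa M * `|t|.
  rewrite /analysis_ensemble /enkf_analysis /analysis_map opprD addrACA subrr add0r.
  exact: hkM.
have ale : `|analysis_map (xi j w)| <= `|v| + L * `|t|.
  by rewrite (le_trans (ler_normD _ _))// lerD2l; exact: KL.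
have aMle : `|analysis_ensemble M w j| <= `|v| + L * `|t| + kappa M * `|t|.
  rewrite -(subrK (analysis_map (xi j w)) (analysis_ensemble M w j)) addrC.
  by rewrite (le_trans (ler_normD _ _))// lerD.
rewrite (@le_trans _ _ (kappa M * `|t| *
   (1 + (`|v| + L * `|t| + kappa M * `|t|) + (`|v| + L * `|t|))))//.
  by rewrite ler_pM ?addr_ge0// !lerD.
rewrite /b -/t -/v -!mulrA ler_wpM2l// [leRHS]mulrCA ler_wpM2l//.
rewrite -subr_ge0 (_ : _ - _ = `|t| + kappa M * (1 + 2 * `|v| + 2 * L * `|t|)); last by ring.
by rewrite addr_ge0// mulr_ge0// !addr_ge0 ?mulr_ge0.
Qed.

Let sa := square_integrable_analysis.
Let norm_a := square_integrable_norm m1 sa.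

Lemma average_deviation_le M w :
  M%:R^-1 * (\sum_(j < M) `|analysis_ensemble M w j - analysis_map (xi j w)|)
    <= ensemble_error M w.
Proof.
rewrite ler_wpM2l ?invr_ge0//; apply: ler_sum => j _.
by rewrite ler_peMr// -addrA lerDl addr_ge0.
Qed.

Section quadratic_growth.
Context (Y : hilbertType R) (sY : separable Y) (f : X -> Y) (C : R).
Hypothesis fC : forall u v, `|f u - f v| <= C * (1 + `|u| + `|v|) * `|u - v|.

(** The measure and g are left general because two instances are used: [analysis_map] under m, and
    the identity under the law of the analysis variable. *)
Lemma quadratic_growth_integrable dT (T : measurableType dT) (mu : {measure set T -> \bar R})
    (g : T -> X) : (mu setT < +oo)%E -> square_integrable mu g ->
  measurable_fun setT (f \o g : T -> borel Y) /\
  mu.-integrable setT (EFin \o (fun x => `|f (g x)|)).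
Proof.
move=> muoo sg; have [mg g2] := sg.
have mf : measurable_fun setT (f \o g : T -> borel Y).
  apply: (@measurableT_comp _ _ _ _ _ _ (f : borel X -> borel Y)) mg.
  exact: continuous_borel_measurable (quadratic_growth_continuous fC).
split=> //; apply: (le_integrable_EFin
    (g := fun x => `|f 0| + (`|C| * `|g x| + `|C| * `|g x| ^+ 2))).
- exact: measurable_hilbert_norm.
- apply: integrable_EFinD; first exact: integrable_cst_fin.
  by apply: integrable_EFinD; apply: integrable_EFinZl => //; exact: square_integrable_norm.
- move=> x; rewrite normr_id -(subrK (f 0) (f (g x))) addrC.
  rewrite (le_trans (ler_normD _ _))// lerD2l (le_trans (fC _ _))//.
  rewrite normr0 addr0 subr0 -mulrA mulrDl mul1r -expr2 -mulrDr.
  by rewrite ler_wpM2r ?ler_norm// addr_ge0// sqr_ge0.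
Qed.

(** The averages over the analysis ensemble and over the i.i.d. sample [analysis_map (xi j w)]
    differ by at most [|C| * ensemble_error M w]. *)
Lemma average_analysis_cvg : {ae P, forall w,
  M%:R^-1 *: (\sum_(j < M) f (analysis_ensemble M w j))
    @[M --> \oo] --> bochner m (f \o analysis_map)}.
Proof.
have [mfa ifa] := quadratic_growth_integrable m1 sa.
have A1 := slln_hilbert law ind sY mfa ifa.
apply: filterS2 A1 ensemble_error_cvg0 => w c1 c2.
pose D M := M%:R^-1 *: (\sum_(j < M) (f (analysis_ensemble M w j)
  - f (analysis_map (xi j w)))).
have D0 : D M @[M --> \oo] --> 0.
  have C2 : `|C| * ensemble_error M w @[M --> \oo] --> 0.
    by rewrite -(mulr0 `|C|); apply: cvgMr.
  apply: cvg_dist_squeeze C2; apply: nearW => M; rewrite subr0.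
  rewrite (le_trans (norm_average_le M (fun j => f (analysis_ensemble M w j)
    - f (analysis_map (xi j w)))))// /ensemble_error mulrCA ler_wpM2l ?invr_ge0//.
  rewrite mulr_sumr; apply: ler_sum => j _; rewrite (le_trans (fC _ _))//.
  by rewrite [X in _ <= _ * X]mulrC mulrA ler_wpM2r// ler_wpM2r ?addr_ge0// ler_norm.
have CC := cvgD D0 c1; rewrite add0r in CC; apply: near_eq_cvgn (CC _).
by apply: nearW => M; rewrite fctE /D sumrB scalerBr subrK.
Qed.

End quadratic_growth.

Lemma analysis_mean_cvg : {ae P, forall w,
  emp_mean M (analysis_ensemble M w) @[M --> \oo] --> bochner m analysis_map}.
Proof.
apply: (@average_analysis_cvg X sX id 1) => u' v'.
by rewrite mul1r ler_peMl// -addrA lerDl addr_ge0.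
Qed.

(** Both contributions are uniform in f: the sampling error by [slln_lipschitz], the gain error by
    [average_deviation_le]. *)
Lemma analysis_lipschitz : {ae P, forall w, forall e, 0 < e -> \forall M \near \oo,
  forall f : X -> R, (forall u v, `|f u - f v| <= `|u - v|) ->
  `|M%:R^-1 * (\sum_(j < M) f (analysis_ensemble M w j))
    - \int[m]_x f (analysis_map x)| <= e}.
Proof.
have [ma _] := sa.
have A1 := slln_lipschitz law ind sX ma norm_a.
apply: filterS2 A1 ensemble_error_cvg0 => w c1 c2 e e0.
have e20 : 0 < e / 2 by rewrite divr_gt0.
have n2 : \forall M \near \oo, ensemble_error M w <= e / 2 by exact: cvgr_le c2 _ e20.
apply: filterS2 (c1 _ e20) n2 => M h1 h2 f f1.
have -> : M%:R^-1 * (\sum_(j < M) f (analysis_ensemble M w j))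
    - \int[m]_x f (analysis_map x) =
  M%:R^-1 *: (\sum_(j < M) (f (analysis_ensemble M w j) - f (analysis_map (xi j w))) : R^o)
  + (M%:R^-1 * (\sum_(j < M) f (analysis_map (xi j w))) - \int[m]_x f (analysis_map x)).
  by rewrite sumrB scalerBr /GRing.scale /= addrA subrK.
rewrite (le_trans (ler_normD _ _))// (splitr e) lerD//; last exact: h1.
rewrite (le_trans (norm_average_le M (fun j => f (analysis_ensemble M w j)
  - f (analysis_map (xi j w)) : R^o)))//.
rewrite (le_trans _ h2)// (le_trans _ (average_deviation_le M w))//.
by rewrite ler_wpM2l ?invr_ge0// ler_sum.
Qed.

(** Centring at the true mean a0 gives i.i.d. variables [b (xi j w)] whose second moment is the
    covariance, so [slln_hs] applies. Exchanging a0 for the empirical mean costs eta. *)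
Lemma analysis_covariance_hs : {ae P, forall w, forall e, 0 < e -> \forall M \near \oo,
  (hs_norm (M%:R^-1 *: (\sum_(j < M)
      tensor (analysis_ensemble M w j - emp_mean M (analysis_ensemble M w))
             (analysis_ensemble M w j - emp_mean M (analysis_ensemble M w)))
    - Cov m analysis_map analysis_map)%R <= e%:E)%E}.
Proof.
pose a0 := bochner m analysis_map.
pose b x := analysis_map x - a0.
have sb : square_integrable m b.
  by apply: square_integrableD => //; exact: square_integrable_cst.
have [ma _] := sa.
have A1 := slln_hs law ind sX sb.
have A2 := slln_nonneg law ind (measurable_hilbert_norm ma) (fun x => normr_ge0 _) norm_a.
have A3 := analysis_mean_cvg.
apply: filterS3 A1 A2 (filterI A3 ensemble_error_cvg0) => w c1 c2 [c3 c4] e e0.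
pose eta M := `|emp_mean M (analysis_ensemble M w) - a0|.
have eta0 : eta M @[M --> \oo] --> 0 by apply/norm_cvg0P/subr_cvg0.
pose S M := M%:R^-1 * \sum_(j < M) `|analysis_map (xi j w)|.
pose rho M := ensemble_error M w.
pose c M := 2 * `|a0| + eta M.
(* For each j the tensor difference is at most [(dl j + eta) * (T j + c)]. Bounding
   [dl j * (T j + c)] by [dl j * (1 + T j) * (1 + c)], and [T j] in the other product by
   [dl j + 2 |analysis_map (xi j w)|], leaves only averages with known limits. *)
pose bd M := rho M * (1 + c M) + eta M * (rho M + 2 * S M + c M).
have cC : c M @[M --> \oo] --> 2 * `|a0| + 0 by apply: cvgD => //; exact: cvg_cst.
have bd0 : bd M @[M --> \oo] --> 0 * (1 + (2 * `|a0| + 0)) + 0 * (0 + 2 * \int[m]_x `|analysis_map x| + (2 * `|a0| + 0)).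
  apply: cvgD; apply: cvgM => //; apply: cvgD => //; first exact: cvg_cst.
  by apply: cvgD => //; apply: cvgMr.
rewrite !mul0r addr0 in bd0.
have e20 : 0 < e / 2 by rewrite divr_gt0.
have n2 : \forall M \near \oo, bd M <= e / 2 by exact: cvgr_le bd0 _ e20.
apply: filterS3 (nbhs_infty_gt 0) (c1 _ e20) n2 => M M0 h1 h2.
apply: hs_norm_le (ltW e0) _ => B oB.
set aM := emp_mean M _.
pose beta j := analysis_ensemble M w j - aM.
rewrite (_ : _ - Cov _ _ _ = M%:R^-1 *: (\sum_(j < M)
    (tensor (beta j) (beta j) - tensor (b (xi j w)) (b (xi j w))))
  + (M%:R^-1 *: (\sum_(j < M) tensor (b (xi j w)) (b (xi j w)))
     - (fun v => bochner m (fun x => tensor (b x) (b x) v)))); last first.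
  by rewrite sumrB scalerBr addrA subrK.
rewrite (le_trans (hs_onD _ _ _))// (splitr e) lerD//; last exact: h1.
rewrite (le_trans _ h2)// hs_onZ ger0_norm ?invr_ge0//.
have etaM : 0 <= eta M by exact: normr_ge0.
pose dl j := `|analysis_ensemble M w j - analysis_map (xi j w)|.
pose T j := `|analysis_ensemble M w j| + `|analysis_map (xi j w)|.
have cM0 : 0 <= c M by rewrite addr_ge0// mulr_ge0.
have T0 j : 0 <= T j by rewrite addr_ge0.
have step : M%:R^-1 * hs_on B (\sum_(j < M)
    (tensor (beta j) (beta j) - tensor (b (xi j w)) (b (xi j w)))) <=
  M%:R^-1 * \sum_(j < M) ((dl j * (1 + `|analysis_ensemble M w j| + `|analysis_map (xi j w)|))
    * (1 + c M) + eta M * (dl j + 2 * `|analysis_map (xi j w)| + c M)).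
  rewrite ler_wpM2l ?invr_ge0// (le_trans (hs_on_sum _ _ _))//.
  apply: ler_sum => j _; rewrite (le_trans (hs_on_tensor_sub _ _ oB))//.
  have d1 : `|beta j - b (xi j w)| <= dl j + eta M.
    rewrite (_ : beta j - _ = (analysis_ensemble M w j - analysis_map (xi j w)) - (aM - a0)).
      exact: ler_normB.
    by rewrite /beta /b !opprD addrACA.
  have d2 : `|beta j| + `|b (xi j w)| <= T j + c M.
    have q1 : `|aM| <= `|a0| + eta M.
      by rewrite -(subrK a0 aM) addrC (le_trans (ler_normD _ _)).
    have := ler_normB (analysis_ensemble M w j) aM.
    have := ler_normB (analysis_map (xi j w)) a0.
    by rewrite -/(beta j) -/(b (xi j w)) /T /c; lra.
  rewrite (le_trans (ler_pM _ _ d1 d2)) ?addr_ge0//.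
  have d3 : T j <= dl j + 2 * `|analysis_map (xi j w)|.
    have : `|analysis_ensemble M w j| <= dl j + `|analysis_map (xi j w)|.
      by rewrite -{1}(subrK (analysis_map (xi j w)) (analysis_ensemble M w j)) ler_normD.
    by rewrite /T; lra.
  have p1 : eta M * T j <= eta M * (dl j + 2 * `|analysis_map (xi j w)|).
    by rewrite ler_wpM2l.
  have dl0 : 0 <= dl j by exact: normr_ge0.
  have p2 : 0 <= dl j + dl j * (T j * c M).
    exact: addr_ge0 dl0 (mulr_ge0 dl0 (mulr_ge0 (T0 j) cM0)).
  rewrite -(addrA 1) -/(T j); clearbody T dl.
  move: p1 p2; move: (T j) (dl j) (eta M) (c M) `|_| => t r h k n p1 p2.
  lra.
rewrite (le_trans step)// big_split /= mulrDr /bd lerD//.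
  by rewrite -mulr_suml mulrA.
rewrite -mulr_sumr mulrCA ler_wpM2l// big_split /= big_split /= !mulrDr.
rewrite -mulr_sumr [X in _ + X + _]mulrCA -/(S M) !lerD//.
  exact: average_deviation_le.
by have := average_cst (c M : R^o) M0; rewrite /GRing.scale /= => ->.
Qed.

End enkf_convergence.

(** * Integration against the empirical measure *)

Section empirical_measure.
Context (R : realType) (H : hilbertType R) (M : nat) (x : nat -> H).

Let mu : {measure set (borel H) -> \bar R} :=
  mscale (M%:R^-1)%:nng (msum (fun j => \d_(x j : borel H)) M).

Lemma ge0_integral_emp_measure (f : H -> R) :
  measurable_fun setT (f : borel H -> R) -> (forall y, 0 <= f y) ->
  (\int[mu]_y (f y)%:E = (M%:R^-1 * \sum_(j < M) f (x j))%:E)%E.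
Proof.
move=> mf f0; rewrite ge0_integral_mscale//; last 2 first.
- exact/measurable_EFinP.
- by move=> y _; rewrite lee_fin.
rewrite ge0_integral_measure_sum//; last 2 first.
- by move=> y _; rewrite lee_fin.
- exact/measurable_EFinP.
rewrite EFinM -sumEFin; congr (_ * _)%E; apply: eq_bigr => j _.
rewrite integral_dirac ?diracT ?mul1e//; exact/measurable_EFinP.
Qed.

(** The total mass is 1 for M > 0 and 0 for M = 0, so the lemmas on finite measures apply for every
    M. *)
Lemma emp_measureT_fin : (mu setT < +oo)%E.
Proof.
have := @ge0_integral_emp_measure (fun=> 1) (measurable_cst _) (fun=> ler01).
by rewrite integral_cst// mul1e => ->; rewrite ltry.
Qed.

Lemma integral_emp_measure (f : H -> R) :
  measurable_fun setT (f : borel H -> R) ->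
  (\int[mu]_y (f y)%:E = (M%:R^-1 * \sum_(j < M) f (x j))%:E)%E.
Proof.
move=> mf.
rewrite integralE -/(EFin \o f) funerpos funerneg.
rewrite ge0_integral_emp_measure; [|exact: measurable_funrpos|exact: funrpos_ge0].
rewrite ge0_integral_emp_measure; [|exact: measurable_funrneg|exact: funrneg_ge0].
rewrite -EFinB -mulrBr -sumrB; congr (_ * _)%:E; apply: eq_bigr => j _.
by rewrite -[in RHS](funrposBneg f).
Qed.

Lemma integrable_emp_measure (f : H -> R) : measurable_fun setT (f : borel H -> R) ->
  mu.-integrable setT (EFin \o f).
Proof.
move=> mf; apply/integrableP; split; first exact/measurable_EFinP.
have mnf : measurable_fun setT (fun y : borel H => `|f y|) by exact: measurableT_comp mf.
by rewrite [X in (X < _)%E](ge0_integral_emp_measure mnf (fun=> normr_ge0 _)) ltry.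
Qed.

Lemma is_bochner_emp_measure (Y : hilbertType R) (f : H -> Y) : separable Y ->
  measurable_fun setT (f : borel H -> borel Y) ->
  is_bochner_integral (emp_measure M x) f (M%:R^-1 *: \sum_(j < M) f (x j)).
Proof.
move=> sY mf; apply/(is_bochnerP sY emp_measureT_fin); split => //.
  by apply: integrable_emp_measure; exact: measurable_hilbert_norm.
move=> v; rewrite /Rintegral integral_emp_measure; last exact: measurable_hilbert_inner.
by rewrite innerZl inner_suml.
Qed.

End empirical_measure.

Lemma cvge0_le (R : realType) (u : nat -> \bar R) : (forall n, 0 <= u n)%E ->
  (forall e : R, 0 < e -> \forall n \near \oo, (u n <= e%:E)%E) ->
  u n @[n --> \oo] --> 0%E.
Proof.
move=> u0 ue; apply/fine_cvgP; split.
  apply: filterS (ue 1 ltr01) => n un; rewrite ge0_fin_numE//.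
  by rewrite (le_lt_trans un)// ltry.
apply/cvgrPdist_le => e e0; apply: filterS (ue e e0) => n un /=.
have un_fin : u n \is a fin_num by rewrite ge0_fin_numE// (le_lt_trans un)// ltry.
by rewrite sub0r normrN ger0_norm ?fine_ge0// -lee_fin fineK.
Qed.

(** * Covariance under a law and its invertibility *)

(** This moves the covariances of U and Z from [Omega] to the space of pairs, where the ensemble
    members have the same law as (U, eps). *)
Lemma Cov_law dT dE (T : measurableType dT) (E : measurableType dE) (R : realType)
    (P : probability T R) (m : probability E R) (X : T -> E) (H1 H2 : hilbertType R)
    (f : E -> H1) (g : E -> H2) :
  separable H1 -> separable H2 -> has_law P X m ->
  square_integrable m f -> square_integrable m g ->
  Cov P (f \o X) (g \o X) = Cov m f g.
Proof.
move=> s1 s2 [mX law] sf sg.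
have m1 : (m setT < +oo)%E by rewrite [X in (X < _)%E](@probability_setT _ _ _ m) ltry.
have P1 : (P setT < +oo)%E by rewrite [X in (X < _)%E](@probability_setT _ _ _ P) ltry.
have bf : bochner P (f \o X) = bochner m f.
  apply: (bochnerE s1 P1); apply: is_bochner_law mX law _ => //.
  by apply: bochnerP => //; [case: sf|exact: square_integrable_norm].
have bg : bochner P (g \o X) = bochner m g.
  apply: (bochnerE s2 P1); apply: is_bochner_law mX law _ => //.
  by apply: bochnerP => //; [case: sg|exact: square_integrable_norm].
apply/funext => v; apply: (bochnerE s1 P1); rewrite bf bg.
exact: is_bochner_law s1 P1 m1 mX law (is_bochner_CovP s1 s2 sf sg v).
Qed.

(** A kernel vector x gives [inner (Cov m y y x) x = 0], which is the variance of [inner (y p) x].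
    This function is then almost everywhere constant, which the hypothesis excludes. *)
Lemma Cov_unitmx dE (E : measurableType dE) (R : realType) (m : probability E R) (d : nat)
    (y : E -> euclid R d) : square_integrable m y ->
  (forall (x : euclid R d) (t : R), x != 0 -> ~ {ae m, forall p, inner (y p) x = t}) ->
  lin1_mx (Cov m y y) \in unitmx.
Proof.
move=> sy nd; have sE := separable_euclid R d; have [my _] := sy.
have m1 : (m setT < +oo)%E by rewrite [X in (X < _)%E](@probability_setT _ _ _ m) ltry.
have m1' : fine (m setT) = 1 by rewrite probability_setT.
(* Operators act on rows from the right, so singularity is used through a left kernel vector. *)
rewrite unitmxE unitfE; apply/negP => /det0P[x x0 xA].
have lC : linear (Cov m y y) by move=> a v v'; rewrite CovD// CovZ.
have Cx : Cov m y y (x : euclid R d) = 0.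
  rewrite -xA (linear_euclidE (x : euclid R d) lC) big_enum /=.
  apply/rowP => j; rewrite mxE summxE; apply: eq_bigr => i _.
  by rewrite !mxE.
pose h p := inner (y p - bochner m y) (x : euclid R d).
have mh : measurable_fun setT h.
  apply: measurable_hilbert_inner => //; exact: measurable_hilbertB.
have := inner_Cov sE sE sy sy (x : euclid R d) (x : euclid R d).
rewrite Cx inner0l => /esym h0.
apply: (nd (x : euclid R d) (inner (bochner m y) (x : euclid R d)) x0).
have ih : m.-integrable setT (EFin \o (fun p => h p ^+ 2)).
  have sb : square_integrable m (fun p => y p - bochner m y).
    by apply: square_integrableD => //; exact: square_integrable_cst.
  have [mb b2] := sb.
  apply: (le_integrable_EFin (g := fun p => `|x : euclid R d| ^+ 2 * `|y p - bochner m y| ^+ 2)).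
  - exact: measurable_funX.
  - exact: integrable_EFinZl.
  - move=> p; rewrite normrX -exprMn lerXn2r ?nnegrE ?mulr_ge0// mulrC.
    exact: cauchy_schwarz.
have hh0 : (\int[m]_p `|(h p ^+ 2)%:E| = 0)%E.
  rewrite (eq_integral (fun p => (h p ^+ 2)%:E)) => [|p _]; last first.
    by rewrite gee0_abs// lee_fin sqr_ge0.
  rewrite -[LHS]fineK; last exact: integrable_fin_num ih.
  by congr (_%:E); rewrite -[RHS]h0; apply: eq_Rintegral => p _; rewrite expr2.
have mh2 : measurable_fun setT (fun p => (h p ^+ 2)%:E).
  by apply/measurable_EFinP; exact: measurable_funX.
have := (ae_eq_integral_abs m measurableT mh2).1 hh0.
apply: filterS => p /(_ I) /= /eqP; rewrite eqe sqrf_eq0 /h innerBl subr_eq0.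
by move/eqP.
Qed.

(** For fixed u the noise would have to lie in the hyperplane of level [t - inner (G u) x], which is
    nu-null. An exceptional set N thus has sections of full measure for every u, so its product
    measure is 1 instead of 0. *)
Lemma product_hyperplane_not_ae (R : realType) (X : hilbertType R) (d : nat)
    (mu0 : probability (borel X) R) (nu : probability (borel (euclid R d)) R)
    (G : X -> euclid R d) (x : euclid R d) (t : R) :
  measurable_fun setT (G : borel X -> borel (euclid R d)) ->
  (forall r, nu [set e : euclid R d | inner e x = r] = 0%E) ->
  ~ {ae (mu0 \x nu)%E, forall p, inner (G p.1 + p.2) x = t}.
Proof.
move=> mG nu0 [N [mN N0 subN]].
have mH r : measurable ([set e : euclid R d | inner e x = r] : set (borel (euclid R d))).
  have mi : measurable_fun setT ((fun e => inner e x) : borel (euclid R d) -> R).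
    by apply: continuous_realfun_measurable; exact: continuous_innerl.
  by have := mi measurableT _ (measurable_set1 r); rewrite setTI.
have : (mu0 \x nu)%E N = 1%E; last by rewrite [LHS]N0 => /eqP; rewrite eq_sym onee_eq0.
rewrite /product_measure1 (eq_integral (fun=> 1%E)) => [|u _].
  by rewrite integral_cst// mul1e; exact: probability_setT.
apply/eqP; rewrite eq_le probability_le1 /=; last exact: measurable_xsection.
have <- : nu (~` [set e : euclid R d | inner e x = t - inner (G u) x]) = 1%E.
  by rewrite probability_setC// nu0 sube0.
apply: le_measure; rewrite ?inE; [exact: measurableC|exact: measurable_xsection|].
move=> e /= ne; rewrite /xsection /= inE; apply: subN => /= h.
by apply: ne; rewrite -h innerDl addrC addKr.
Qed.

Lemma wasserstein_ge0 (R : realType) (H : hilbertType R) (mu1 mu2 : set (borel H) -> \bar R) :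
  (0 <= wasserstein mu1 mu2)%E.
Proof.
apply: le_trans (abse_ge0 _) (ereal_sup_ubound _).
exists (fun=> 0) => //= u v; by rewrite subrr normr0.
Qed.

Lemma density_hyperplane (R : realType) (d : nat)
    (nu : set (borel (euclid R d)) -> \bar R) (rho : euclid R d -> \bar R) :
  (forall A : set (borel (euclid R d)), measurable A ->
     nu A = (\int[@lebesgue_euclid R d]_(x in A) rho x)%E) ->
  forall (x : euclid R d) (t : R), x != 0 ->
  nu [set e : euclid R d | inner e x = t] = 0%E.
Proof.
move=> density x t x0; rewrite density; last first.
  have mi : measurable_fun setT ((fun e => inner e x) : borel (euclid R d) -> R).
    by apply: continuous_realfun_measurable; exact: continuous_innerl.
  by have := mi measurableT _ (measurable_set1 t); rewrite setTI.
apply: integral_null_support => B Bx.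
apply: lebesgue_euclid_hyperplane x0 _ => v /Bx /=; rewrite innerC; exact.
Qed.

(** The limits are identified on the space of pairs (u, e) and carried back through laws. The first
    clause also asserts [bochner_integrable], since [bochner] is 0 on a function that is not
    integrable and the limit alone would leave the existence of the integral open. *)
Theorem theorem11 (R : realType) (X : hilbertType R) (d : nat)
    (dO : measure_display) (Omega : measurableType dO)
    (P : probability Omega R)
    (mu0 : probability (borel X) R)
    (nu : probability (borel (euclid R d)) R)
    (G : X -> euclid R d) (U : Omega -> X) (eps : Omega -> euclid R d)
    (c : R) (l : euclid R d -> R) (psi : R -> R)
    (us : nat -> Omega -> X) (epss : nat -> Omega -> euclid R d)
    (z : euclid R d)
    (sepX : separable X)
    (* condition (1) *)
    (lawU : has_law P (U : Omega -> borel X) mu0)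
    (laweps : has_law P (eps : Omega -> borel (euclid R d)) nu)
    (lawUeps : has_law P
       ((fun w => (U w, eps w)) : Omega -> borel X * borel (euclid R d))
       (mu0 \x nu)%E)
    (* condition (2) *)
    (c_gt0 : 0 < c) (l_ge0 : forall x, 0 <= l x)
    (ml : measurable_fun [set: borel (euclid R d)]
       (l : borel (euclid R d) -> R))
    (density : forall A : set (borel (euclid R d)), measurable A ->
       nu A = (\int[@lebesgue_euclid R d]_(x in A) (c * expR (- l x))%:E)%E)
    (* condition (3) *)
    (contG : continuous G)
    (* condition (4) *)
    (psi_ge0 : forall s, 0 <= s -> 0 <= psi s)
    (psi_nd : forall s t, 0 <= s -> s <= t -> psi s <= psi t)
    (psi0 : psi 0 = 0) (psi_lim : psi s @[s --> 0^'+] --> 0)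
    (Phi_reg : forall z1 z2 : euclid R d,
       (\int[mu0]_u ((`|l (z1 - G u) - l (z2 - G u)| ^+ 2)%:E)
          <= (psi `|z1 - z2|)%:E)%E)
    (* condition (5) *)
    (moment0 : (\int[mu0]_u ((`|u : X| ^+ 2 + `|G u| ^+ 2)%:E) < +oo)%E)
    (moment_eps : (\int[nu]_x ((`|x : euclid R d| ^+ 2)%:E) < +oo)%E)
    (* the initial ensemble *)
    (law_ens : forall j, has_law P
       ((fun w => (us j w, epss j w)) :
          Omega -> borel X * borel (euclid R d)) (mu0 \x nu)%E)
    (indep_ens : mutually_independent P
       ((fun j w => (us j w, epss j w)) :
          nat -> Omega -> borel X * borel (euclid R d))) :
  let Z : Omega -> euclid R d := fun w => G (U w) + eps w in
  let zs : nat -> Omega -> euclid R d :=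
    fun j w => G (us j w) + epss j w in
  let K : euclid R d -> X := kalman_gain (Cov P U Z) (Cov P Z Z) in
  let Ua : Omega -> X := fun w => U w + K (z - Z w) in
  let mua : set (borel X) -> \bar R :=
    pushforward P (Ua : Omega -> borel X) in
  let ua : nat -> Omega -> nat -> X := fun M w j =>
    enkf_analysis M (fun i => us i w) (fun i => zs i w) z j in
  let muaM : nat -> Omega -> set (borel X) -> \bar R :=
    fun M w => emp_measure M (ua M w) in
  [/\ (forall (Y : hilbertType R) (f : X -> Y), separable Y ->
         (exists C : R, forall u v : X,
            `|f u - f v| <= C * (1 + `|u| + `|v|) * `|u - v|) ->
         bochner_integrable mua f /\
         {ae P, forall w,
            bochner (muaM M w) f @[M --> \oo] --> bochner mua f}),
      {ae P, forall w, emp_mean M (ua M w) @[M --> \oo] --> bochner P Ua},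
      {ae P, forall w,
         hs_norm (M%:R^-1 *: (\sum_(j < M)
                    tensor (ua M w j - emp_mean M (ua M w))
                           (ua M w j - emp_mean M (ua M w))) - Cov P Ua Ua)
           @[M --> \oo] --> 0%E} &
      {ae P, forall w, wasserstein (muaM M w) mua @[M --> \oo] --> 0%E}].

Proof.
move=> Z zs K Ua mua ua muaM.
pose E : measurableType _ := (borel X * borel (euclid R d))%type.
pose m : probability E R := (mu0 \x nu)%E.
pose xi (j : nat) (w : Omega) : E := (us j w, epss j w).
pose xi0 (w : Omega) : E := (U w, eps w).
pose u (p : E) : X := p.1.
pose y (p : E) : euclid R d := G p.1 + p.2.
have sE := separable_euclid R d.
have m1 : (m setT < +oo)%E by rewrite [X in (X < _)%E](@probability_setT _ _ _ m) ltry.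
have P1 : (P setT < +oo)%E by rewrite [X in (X < _)%E](@probability_setT _ _ _ P) ltry.
have mG : measurable_fun setT (G : borel X -> borel (euclid R d)).
  exact: continuous_borel_measurable.
have law0 : has_law P xi0 m := lawUeps.
have [mxi0 lawxi0] := law0.
have law1 A : measurable A -> m ((fst : E -> borel X) @^-1` A) = mu0 A.
  move=> mA; rewrite -lawU.2// -lawxi0//.
  by rewrite -[X in measurable X]setTI; exact: measurable_fst.
have law2 A : measurable A -> m ((snd : E -> borel (euclid R d)) @^-1` A) = nu A.
  move=> mA; rewrite -laweps.2// -lawxi0//.
  by rewrite -[X in measurable X]setTI; exact: measurable_snd.
(* The joint moment bound is split here: f will be the squared norm of v or of [G v]. *)
have mom (f : X -> R) : (forall v, f v <= `|v| ^+ 2 + `|G v| ^+ 2) ->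
    (forall v, 0 <= f v) -> measurable_fun setT (f : borel X -> R) ->
    (\int[mu0]_v (f v)%:E < +oo)%E.
  move=> fle f0 mf; apply: le_lt_trans moment0; apply: ge0_le_integral => //.
  - by move=> v _; rewrite lee_fin.
  - exact/measurable_EFinP.
  - apply/measurable_EFinP; apply: measurable_funD; apply: measurable_funX.
      by apply: measurable_hilbert_norm.
    exact: measurable_hilbert_norm.
  - by move=> v _; rewrite lee_fin.
have mid : measurable_fun setT (id : borel X -> borel X) by exact: measurable_id.
have mid' : measurable_fun setT (id : borel (euclid R d) -> borel (euclid R d)).
  exact: measurable_id.
have su : square_integrable m u.
  suff h : square_integrable mu0 (id : borel X -> X).
    exact: (square_integrable_law measurable_fst law1 h).
  apply: square_integrable_moment => //; apply: mom => [v|v|].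
  - by rewrite lerDl sqr_ge0.
  - exact: sqr_ge0.
  - by apply: measurable_funX; exact: measurable_hilbert_norm mid.
have sy : square_integrable m y.
  apply: square_integrableD => //.
    suff h : square_integrable mu0 (G : borel X -> euclid R d).
      exact: (square_integrable_law measurable_fst law1 h).
    apply: square_integrable_moment => //; apply: mom => [v|v|].
    - by rewrite lerDr sqr_ge0.
    - exact: sqr_ge0.
    - by apply: measurable_funX; exact: measurable_hilbert_norm mG.
  suff h : square_integrable nu (id : borel (euclid R d) -> euclid R d).
    exact: (square_integrable_law measurable_snd law2 h).
  exact: square_integrable_moment.
have unitC : lin1_mx (Cov m y y) \in unitmx.
  apply: Cov_unitmx => // x t x0; apply: product_hyperplane_not_ae => // r.
  exact: density_hyperplane density x r x0.
pose a : E -> X := analysis_map m u y z.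
have sa : square_integrable m a by exact: square_integrable_analysis.
(* The gains under P and under m agree by [Cov_law], so [Ua] is the analysis map evaluated at (U,
   eps). *)
have UaE : Ua = a \o xi0.
  have KE : K = kalman_gain (Cov m u y) (Cov m y y).
    by rewrite -(Cov_law sepX sE law0 su sy) -(Cov_law sE sE law0 sy sy).
  by apply/funext => w; rewrite /Ua KE.
have [ma _] := sa.
have mUa : measurable_fun setT (Ua : Omega -> borel X).
  by rewrite UaE; exact: measurableT_comp ma mxi0.
(* [mua] is a mere set function; [mua'] is the same function with its measure structure, as the
   lemmas on integrals require. *)
pose mua' : {measure set (borel X) -> \bar R} :=
  measure_function_pushforward__canonical__measure_function_Measure P mUa.
have lawa A : measurable A -> m ((a : E -> borel X) @^-1` A) = mua' A.
  move=> mA; rewrite -lawxi0.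
    by rewrite /mua' /= /pushforward UaE.
  by rewrite -[X in measurable X]setTI; exact: ma.
have mua1 : (mua' setT < +oo)%E by rewrite -lawa.
have bm (Y : hilbertType R) (f : X -> Y) v : separable Y ->
    is_bochner_integral mua' f v -> bochner m (f \o a) = v.
  by move=> sY h; apply: (bochnerE sY m1); exact: is_bochner_law sY m1 mua1 ma lawa h.
have smua : square_integrable mua' id.
  apply: square_integrable_moment => //.
  rewrite -(law_ge0_integral ma lawa (f := fun v => (`|v| ^+ 2)%:E)).
  - by have [_ /(integral_fune_lt_pinfty measurableT)] := sa.
  - by apply/measurable_EFinP; apply: measurable_funX; exact: measurable_hilbert_norm mid.
  - by move=> v; rewrite lee_fin sqr_ge0.
have bUa : bochner P Ua = bochner m a.
  rewrite UaE; apply: (bochnerE sepX P1); apply: is_bochner_law mxi0 lawxi0 _ => //.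
  by apply: bochnerP => //; exact: square_integrable_norm.
split.
- move=> Y f sY [C fC].
  have [mf fi] := quadratic_growth_integrable fC mua1 smua.
  have bf := bochnerP sY mua1 mf fi.
  split; first by exists (bochner mua f).
  have := average_analysis_cvg law_ens indep_ens sepX z su sy unitC sY fC.
  apply: filterS => w; rewrite (bm _ _ _ sY bf); apply: cvg_trans.
  apply: near_eq_cvg; apply: nearW => M /=.
  by apply/esym/(bochnerE sY (emp_measureT_fin _ _))/is_bochner_emp_measure.
- rewrite bUa; exact: (analysis_mean_cvg law_ens indep_ens sepX z su sy unitC).
- rewrite UaE (Cov_law sepX sepX law0 sa sa).
  have := analysis_covariance_hs law_ens indep_ens sepX z su sy unitC.
  apply: filterS => w h; apply: cvge0_le => // M; exact: sqrte_ge0.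
- have := analysis_lipschitz law_ens indep_ens sepX z su sy unitC.
  apply: filterS => w h; apply: cvge0_le => [M|e e0]; first exact: wasserstein_ge0.
  apply: filterS (h e e0) => M hM; apply: ge_ereal_sup => _ [f f1 <-].
  have mf : measurable_fun setT (f : borel X -> R).
    exact: continuous_realfun_measurable (lipschitz_continuous_fun f1).
  have ifm : mua'.-integrable setT (EFin \o f).
    apply: (lipschitz_integrable mua1 f1 mid).
    exact: (square_integrable_norm mua1 smua).
  rewrite integral_emp_measure// -[X in (_ - X)%E]fineK; last exact: integrable_fin_num ifm.
  rewrite -/(Rintegral mua' setT f) -(law_Rintegral ma lawa ifm) -EFinB abse_EFin lee_fin.
  exact: hM.
Qed.
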